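(* If $\mathbf{g}_1,\mathbf{g}_2\in\mathrm{Diff}_{+*}(\overline{B^3})_0$ satisfy $\mathbf{g}_1|_{S^2}=\mathbf{g}_2|_{S^2}$, then $W(\mathbf{g}_1)=W(\mathbf{g}_2)$. That is, $W(\mathbf{g})$ for $\mathbf{g}\in\mathrm{Diff}_{+*}(\overline{B^3})_0$ depends only on the boundary value $\mathbf{g}|_{S^2}$.
   Context: Identify $S^2=\widehat{\mathbb{C}}=\mathbb{C}\cup\{\infty\}$ with the unit sphere bounding the open unit ball $B^3\subset\mathbb{R}^3$ by a fixed diffeomorphism (e.g. stereographic projection); $(x,y)$ are the real and imaginary parts of the coordinate on $\mathbb{C}=S^2\setminus\{\infty\}$, and $\rho\in[0,1]$ is the radial coordinate, so that $(\rho,x,y)$ are coordinates on $\overline{B^3}=B^3\cup S^2$ away from the origin and the ray through $\infty$. $B^3$ is oriented by $(\rho,x,y)$. $\mathrm{Diff}_+(M)$ is the group of orientation-preserving $C^\infty$ self-diffeomorphisms of $M$. $\mathrm{Diff}_{\mathrm{ci}}(S^2)$ is the set of elements of $\mathrm{Diff}_+(S^2)$ whose support (closure of the set of non-fixed points) does not contain $\infty$. $\mathrm{Diff}_{+*}(\overline{B^3})$ is the group of all $\mathbf{B}\in\mathrm{Diff}_+(\overline{B^3})$ of the form $\mathbf{B}(\rho,p)=(\rho,B_\rho(p))$ for $\rho\in[0,1]$, $p\in S^2$, with every $B_\rho\in\mathrm{Diff}_{\mathrm{ci}}(S^2)$, and with $B_\rho$ independent of $\rho$ for $\rho\in(1-\epsilon,1]$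 for some $\epsilon\in(0,1)$. $\mathrm{Diff}_{+*}(\overline{B^3})_0$ is the subgroup of elements smoothly isotopic to $\mathrm{id}_{\overline{B^3}}$ through elements of $\mathrm{Diff}_{+*}(\overline{B^3})$ (isotopy: a smooth map $\overline{B^3}\times[0,1]\to\overline{B^3}$). For $\mathbf{g}\in\mathrm{Diff}_{+*}(\overline{B^3})$, $J_{B^3}(\mathbf{g})$ is the $3\times3$ Jacobian matrix of $\mathbf{g}$ in the coordinates $(\rho,x,y)$, $\theta_{B^3}(\mathbf{g})=J_{B^3}(\mathbf{g})^{-1}dJ_{B^3}(\mathbf{g})$, and $$W(\mathbf{g})=\int_{B^3}\mathrm{tr}\left(\theta_{B^3}(\mathbf{g})^{\wedge3}\right),$$ where $\wedge$ of matrix-valued forms combines matrix product and wedge product. *)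

(* Defs.v *)
From HB Require Import structures.
From mathcomp Require Import all_boot all_order all_algebra.
From mathcomp Require Import all_classical all_reals all_analysis.
Set Implicit Arguments.
Unset Strict Implicit.
Unset Printing Implicit Defensive.
Import Order.TTheory GRing.Theory Num.Theory.
Import numFieldNormedType.Exports.
Local Open Scope classical_set_scope.
Local Open Scope ring_scope.

Section Smooth.
Context {R : realType} {V W : normedModType R}.

(* Only used for finite-dimensional V and open U, where it is equivalent to
   the existence and continuity of all partial derivatives of order <= k. *)
Fixpoint Ck (k : nat) (U : set V) (f : V -> W) : Prop :=
  (forall x, U x -> {for x, continuous f}) /\
  match k with
  | 0 => True
  | k'.+1 => forall v : V,
      (forall x, U x -> derivable f x v) /\ Ck k' U (fun x => 'D_v f x)
  end.

Definition smooth_open (U : set V) (f : V -> W) : Prop := forall k, Ck k U f.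

Definition smooth_ext (A : set V) (f : V -> W) (p : V) (G : V -> W) : Prop :=
  exists U : set V, [/\ open U, U p, smooth_open U G &
    forall x, A x -> U x -> G x = f x].

(* Smooth maps on a submanifold (possibly with boundary or corners) A of V:
   those which locally extend to smooth maps on open subsets of V. Functions
   are total, their values outside A are irrelevant. *)
Definition smooth_on (A : set V) (f : V -> W) : Prop :=
  forall p, A p -> exists G, smooth_ext A f p G.

End Smooth.

Definition diffeo_pair {R : realType} {V : normedModType R} (A : set V)
    (f f' : V -> V) : Prop :=
  [/\ smooth_on A f /\ smooth_on A f',
      (forall p, A p -> A (f p)) /\ (forall p, A p -> A (f' p)),
      forall p, A p -> f' (f p) = p &
      forall p, A p -> f (f' p) = p].

Definition diffeo {R : realType} {V : normedModType R} (A : set V)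
    (f : V -> V) : Prop := exists f', diffeo_pair A f f'.

Section Ball.
Context {R : realType}.
Implicit Types (p u v q : 'rV[R]_3) (f g : 'rV[R]_3 -> 'rV[R]_3).

Definition row3 (a b c : R) : 'rV[R]_3 := \row_(i < 3) nth 0 [:: a; b; c] i.

Definition dot u v : R := \sum_(i < 3) u 0 i * v 0 i.

(* The library norm on row vectors is the sup norm, hence this definition. *)
Definition enorm v : R := Num.sqrt (dot v v).

Definition cball : set 'rV[R]_3 := [set p | enorm p <= 1].
Definition oball : set 'rV[R]_3 := [set p | enorm p < 1].
Definition sphere : set 'rV[R]_3 := [set p | enorm p = 1].

Definition det3 p u v : R := \det (\matrix_(i < 3) nth 0 [:: p; u; v] i).

(* 'J is the transpose of the usual Jacobian matrix, with the same
   determinant; positivity on the boundary follows by continuity. *)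
Definition Diffp_cball f : Prop :=
  diffeo cball f /\ (forall p, oball p -> 0 < \det ('J f p)).

(* The differential of f on the tangent plane of the sphere at p is computed
   through a local smooth extension G of f, and does not depend on it. A tangent
   basis (u, v) at p is direct when (p, u, v) is a direct basis of R^3. *)
Definition Diffp_sphere f : Prop :=
  diffeo sphere f /\
  (forall p, sphere p -> forall G, smooth_ext sphere f p G ->
   forall u v, dot p u = 0 -> dot p v = 0 ->
     0 < det3 p u v -> 0 < det3 (f p) ('D_u G p) ('D_v G p)).

Definition north : 'rV[R]_3 := row3 0 0 1.

Definition stereo p : R * R :=
  (p 0 0 / (1 - p 0 2%:R), p 0 1 / (1 - p 0 2%:R)).

Definition stereo_inv (x y : R) : 'rV[R]_3 :=
  let s := x ^+ 2 + y ^+ 2 in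
  row3 (x *+ 2 / (s + 1)) (y *+ 2 / (s + 1)) ((s - 1) / (s + 1)).

(* The Riemann sphere is realised as the unit sphere through the stereographic
   projection, so that an arbitrary identification of it with the unit sphere
   is (x + i y) |-> psi (stereo_inv x y), infinity |-> psi north, for some
   diffeomorphism psi of the unit sphere, with inverse psi'. Standard
   stereographic coordinates are the case psi = psi' = id. *)
Section Identification.
Variables psi psi' : 'rV[R]_3 -> 'rV[R]_3.

Definition infty : 'rV[R]_3 := psi north.

Definition support f : set 'rV[R]_3 :=
  closure [set p | sphere p /\ f p <> p].

Definition Diff_ci f : Prop := Diffp_sphere f /\ ~ support f infty.

(* For rho = 0 the equation only says that B fixes the origin. *)
Definition Diffps (B : 'rV[R]_3 -> 'rV[R]_3) : Prop :=
  Diffp_cball B /\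
  exists b : R -> 'rV[R]_3 -> 'rV[R]_3,
  [/\ forall rho : R, 0 <= rho <= 1 -> Diff_ci (b rho),
      forall (rho : R) p, 0 <= rho <= 1 -> sphere p ->
        B (rho *: p) = rho *: b rho p &
      exists2 eps : R, 0 < eps < 1 &
        forall (rho : R) p, 1 - eps < rho <= 1 -> sphere p ->
          b rho p = b 1 p].

Definition Diffps0 g : Prop :=
  Diffps g /\
  exists h : 'rV[R]_3 * R -> 'rV[R]_3,
  [/\ smooth_on (cball `*` [set t : R | 0 <= t <= 1]) h,
      forall t : R, 0 <= t <= 1 -> Diffps (fun p => h (p, t)),
      forall p, cball p -> h (p, 0) = p &
      forall p, cball p -> h (p, 1) = g p].

Definition of_coord q : 'rV[R]_3 := q 0 0 *: psi (stereo_inv (q 0 1) (q 0 2%:R)).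

Definition to_coord v : 'rV[R]_3 :=
  let z := stereo (psi' ((enorm v)^-1 *: v)) in row3 (enorm v) z.1 z.2.

Definition in_coord g : 'rV[R]_3 -> 'rV[R]_3 := to_coord \o g \o of_coord.

(* The usual Jacobian matrix: row i contains the partial derivatives of the
   i-th component. *)
Definition J_B3 g q : 'M[R]_3 := ('J (in_coord g) q)^T.

End Identification.

(* A matrix-valued exterior form at a point of R^3 is given by its coefficients
   F I, for I = {i1 < ... < ik}, on dx_i1 /\ ... /\ dx_ik. *)
Definition mxform := {set 'I_3} -> 'M[R]_3.

Definition form1 (a : 'I_3 -> 'M[R]_3) : mxform :=
  fun I => \sum_(i < 3 | I == [set i]%SET) a i.

(* The sign of the shuffle sorting A followed by B. *)
Definition shuffle_sign (A B : {set 'I_3}) : R :=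
  (-1) ^+ #|[pred ab : 'I_3 * 'I_3 |
              [&& ab.1 \in A, ab.2 \in B & (ab.2 < ab.1)%N]]|.

Definition wedge (F G : mxform) : mxform :=
  fun I => \sum_(A : {set 'I_3} | A \subset I)
    shuffle_sign A (I :\: A) *: (F A *m G (I :\: A)).

Definition dmx (M : 'rV[R]_3 -> 'M[R]_3) q : mxform :=
  form1 (fun k => 'D_(delta_mx 0 k) M q).

Definition mulmx_form (M : 'M[R]_3) (F : mxform) : mxform := fun I => M *m F I.

Definition theta_B3 (psi psi' g : 'rV[R]_3 -> 'rV[R]_3) q : mxform :=
  mulmx_form (invmx (J_B3 psi psi' g q)) (dmx (J_B3 psi psi' g) q).

(* The coefficient of the scalar 3-form tr (theta /\ theta /\ theta) on
   d rho /\ dx /\ dy. *)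
Definition W_density (psi psi' g : 'rV[R]_3 -> 'rV[R]_3) q : R :=
  let th := theta_B3 psi psi' g q in
  \tr (wedge (wedge th th) th [set: 'I_3]%SET).

(* The complement in the open ball of the coordinate domain 0 < rho < 1,
   (x, y) in R^2, is negligible (the origin and the ray through infinity). *)
Definition W (psi psi' g : 'rV[R]_3 -> 'rV[R]_3) : R :=
  \int[((@lebesgue_measure R \x @lebesgue_measure R)
        \x @lebesgue_measure R)%E]_(c in
      [set c : (R * R) * R | 0 < c.1.1 < 1])
    W_density psi psi' g (row3 c.1.1 c.1.2 c.2).

End Ball.

(* Main.v *)
(* Since [g] preserves the radius, the Jacobian matrix has first row (1, 0, 0), and
   only its lower right 2x2 block j = [[a, b], [c, d]] contributes to the density.
   On GL_2 the closed form tr ((j^-1 dj)^3) equals 3 dalpha /\ dq /\ du, where alpha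
   is the argument of a + i c, q = (a^2 + c^2) / det j and u = (a b + c d) / (a^2 + c^2);
   as dalpha, q and u are globally defined, 3 u dalpha /\ dq is a primitive. Hence the
   density is the divergence of an explicit field. Its x- and y-components vanish near
   infinity on each sphere and integrate to 0. Its radial component vanishes at
   rho = 0, because the maps B_rho extend smoothly to rho = 0 with B_0 = id: indeed
   g is tangent to the identity at the origin, all its radial germs at infinity being
   trivial. Finally B_rho is constant in rho near rho = 1, where the density is
   therefore 0. So W(g) is the integral of the radial component over a sphere
   rho = r1 close to 1, and only depends on B_1. The supports of B_rho are not assumed
   to be uniformly bounded as rho tends to 0; integrability holds because the
   deviation of g from the identity is flat along the ray through infinity, hence
   rapidly decreasing in (x, y) uniformly for 0 < rho <= r1. *)
Require Import Defs.
From HB Require Import structures.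
From mathcomp Require Import all_boot all_order all_algebra.
From mathcomp Require Import all_classical all_reals all_analysis.
From mathcomp Require Import measurable_realfun.
From mathcomp Require Import ring lra.
Set Implicit Arguments.
Unset Strict Implicit.
Unset Printing Implicit Defensive.
Import Order.TTheory GRing.Theory Num.Theory.
Import numFieldNormedType.Exports.
Local Open Scope classical_set_scope.
Local Open Scope ring_scope.

(** * Partial derivatives *)

(** The primitive exists because each component of GL_2 retracts onto a circle, so that the closed
    cubic trace form is exact; alpha, q and u come from writing j as a rotation times a diagonal
    matrix times a shear. The obstacle is analytic: near rho = 0 the maps are only known as g(rho p)
    / rho, with no control on supports. The division is made by Hadamard's lemma on a two-sided
    neighbourhood of rho = 0, the values at negative rho coming from antipodes. For the decay, the
    deviation from the identity is read in the stereographic chart centred at infinity. There it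
    vanishes near each axis point with rho > 0, on neighbourhoods that may shrink; but it is smooth
    up to rho = 0, and compactness makes its Taylor constants uniform. Inversion converts this into
    rapid decrease. Growth is then handled by a calculus of two classes stable under
    differentiation, moderate functions and rapidly decreasing ones, the latter a module over the
    former, so that no derivative of the primitive is estimated by hand. *)

Section PartialDerivatives.
Context {R : realType}.
Local Notation V := 'rV[R]_3.
Implicit Types (f g h : V -> R) (q v : V) (i j : 'I_3) (U : set V).

Definition evec i : V := delta_mx 0 i.
Definition pd i f : V -> R := fun q => 'D_(evec i) f q.

Lemma is_derive_line h q v t : derivable h (q + t *: v) v ->
  is_derive t 1 (fun s : R => h (q + s *: v)) ('D_v h (q + t *: v)).
Proof.
move=> dh.
have E : (fun s : R => s^-1 *: (((fun s : R => h (q + s *: v)) \o shift t) (s *: 1) - h (q + t *: v)))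
   = (fun s => s^-1 *: ((h \o shift (q + t *: v)) (s *: v) - h (q + t *: v))).
  apply/funext => s /=; congr (_ *: (h _ - _)).
  by rewrite [s *: 1]mulr1 scalerDl addrCA addrA.
by split; rewrite ?/derivable ?/derive E.
Qed.

Lemma mvt_line h q v : (forall t, 0 <= t <= 1 -> derivable h (q + t *: v) v) ->
  exists2 t : R, 0 <= t <= 1 & h (q + v) - h q = 'D_v h (q + t *: v).
Proof.
move=> dh.
have [|||t] := @MVT_segment R (fun s : R => h (q + s *: v))
   (fun s : R => 'D_v h (q + s *: v)) 0 1.
- by [].
- by move=> x; rewrite in_itv /= => /andP[x0 x1]; apply/is_derive_line/dh; rewrite !ltW.
- apply: derivable_within_continuous => x; rewrite in_itv /= => x01.
  by have [] := is_derive_line (dh _ x01).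
- rewrite in_itv /= => t01; rewrite scale1r scale0r addr0 subr0 mulr1 => E.
  by exists t.
Qed.

Lemma row_evecE (v : V) : v = \sum_i v 0 i *: evec i.
Proof. by rewrite [LHS]row_sum_delta. Qed.

Lemma derive_basis h q v : differentiable h q ->
  'D_v h q = \sum_i v 0 i * pd i h q.
Proof.
move=> dh; rewrite deriveE// {1}[v]row_evecE linear_sum; apply: eq_bigr => i _.
by rewrite linearZ /pd deriveE.
Qed.

Lemma normr_basis i : `|evec i| <= 1.
Proof.
rewrite /Num.Def.normr/= mx_normrE; apply: bigmax_le => // -[a b] _ /=.
by rewrite mxE; case: (_ && _); rewrite ?normr1 ?normr0.
Qed.

Lemma normr_coord (v : V) i : `|v 0 i| <= `|v|.
Proof. by rewrite [leRHS]/Num.Def.normr/= mx_normrE; apply: (le_bigmax _ _ (0, i)). Qed.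

Lemma is_derive_scale h q v (c : R) : derivable h q v ->
  is_derive q (c *: v) h (c * 'D_v h q).
Proof.
move=> dh.
pose g (s : R) := h (q + s *: v).
have dg : is_derive (0 : R) 1 g ('D_v h q).
  by have := @is_derive_line h q v 0; rewrite scale0r addr0; apply.
have dgc : is_derive (0 : R) 1 (g \o (fun s => s * c)) ('D_v h q * c).
  apply: is_derive1_comp; first by rewrite mul0r.
  have -> : (fun s : R => s * c) = c \*: id.
    by apply/funext => s /=; rewrite /GRing.scale_fun /= [RHS]mulrC.
  by apply: is_derive_eq; rewrite /GRing.scale /= mulr1.
have E : (fun s : R => s^-1 *: ((h \o shift q) (s *: (c *: v)) - h q)) =
   (fun s : R => s^-1 *: (((g \o (fun s => s * c)) \o shift 0) (s *: 1) - (g \o (fun s => s * c)) 0)).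
  apply/funext => s; congr (_ *: _); rewrite /g /= mul0r scale0r !addr0.
  by rewrite scalerA [s%:A]mulr1 [_ + q]addrC.
by case: dgc => dgc1 dgc2; split; rewrite ?/derivable ?/derive E // mulrC -dgc2.
Qed.

Lemma increment_basis h q i (c m eps : R) :
  (forall t, 0 <= t <= 1 -> derivable h (q + (t * c) *: evec i) (evec i) /\
     `|pd i h (q + (t * c) *: evec i) - m| <= eps) ->
  `|h (q + c *: evec i) - h q - c * m| <= `|c| * eps.
Proof.
move=> H.
have [t t01|t t01 ->] := @mvt_line h q (c *: evec i).
  rewrite scalerA.
  by have [] := @is_derive_scale h _ (evec i) c (H _ t01).1.
rewrite scalerA; have [_ ->] := @is_derive_scale h _ (evec i) c (H _ t01).1.
by rewrite -mulrBr normrM ler_wpM2l // (H _ t01).2.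
Qed.

Definition dotform (c : 'I_3 -> R) (v : V) : R := \sum_i v 0 i * c i.

Lemma dotform_is_linear (c : 'I_3 -> R) : linear (dotform c).
Proof.
move=> a u v; rewrite /dotform scaler_sumr -big_split /=; apply: eq_bigr => i _.
by rewrite !mxE mulrDl -mulrA.
Qed.

HB.instance Definition _ (c : 'I_3 -> R) :=
  GRing.isLinear.Build R V R _ (dotform c) (dotform_is_linear c).

Lemma continuous_dotform (c : 'I_3 -> R) : continuous (dotform c).
Proof.
apply: continuous_big => [|i _ v]; first exact: add_continuous.
by apply: continuousM; [exact: coord_continuous|exact: cst_continuous].
Qed.

(** Going from [q] to [q + v] along a path parallel to the axes, each of the three legs contributes
    an error of at most [|v| * (eps / 3)] by the mean value theorem ([increment_basis]). *)
Lemma C1_differentiable h q :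
  (forall i, \forall x \near q, derivable h x (evec i)) ->
  (forall i, {for q, continuous (pd i h)}) -> differentiable h q.
Proof.
move=> dh ch.
pose L := dotform (fun i => pd i h q).
have E : (h : V -> R^o) \o shift q = cst (h q : R^o) + (L : V -> R^o) +o_ (0 : V) id.
  apply/eqaddoP => eps eps0.
  have : \forall x \near q, forall i, derivable h x (evec i) /\
      `|pd i h x - pd i h q| <= eps / 3.
    apply: (@filter_forall _ _ (fun i x => derivable h x (evec i) /\
      `|pd i h x - pd i h q| <= eps / 3) (nbhs q)) => i.
  apply: filterI; first exact: (dh i).
    have /cvgrPdist_le/(_ (eps / 3)) := ch i; rewrite divr_gt0// => /(_ isT).
    by apply: filterS => x; rewrite distrC.
  move=> /nbhs_ballP[d /= d0 Hd].
  near=> v.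
  have vd : `|v| < d.
    by near: v; apply/nbhs_ballP; exists d => // x; rewrite -ball_normE /= sub0r normrN.
  rewrite /= opprD -![(_ + _ : _ -> _) _]/(_ + _) -![(- _ : _ -> _) _]/(- _) /cst /=.
  (* Corner of the path once the coordinates below [n] have been moved. *)
  pose w (n : 'I_3) : V := q + \sum_(i < 3 | (i < n)%N) v 0 i *: evec i.
  (* In the sup norm every coordinate of the displacement is 0 or a coordinate of [v], possibly
     shortened by [t], so no leg leaves the ball. *)
  have wd (n i : 'I_3) (t : R) : (n <= i)%N -> 0 <= t <= 1 ->
      ball q d (w n + (t * v 0 i) *: evec i).
    move=> ni t01; rewrite -ball_normE /= /w -addrA opprD addNKr normrN.
    apply: le_lt_trans vd; rewrite [leLHS]/Num.Def.normr/= mx_normrE.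
    apply: bigmax_le => // -[a b] _ /=; rewrite [a]ord1.
    rewrite !mxE summxE.
    have -> : \sum_(i0 < 3 | (i0 < n)%N) (v 0 i0 *: evec i0) 0 b =
       (if (b < n)%N then v 0 b else 0).
      case: ifPn => bn.
        rewrite (bigD1 b) //= big1 => [|k /andP[_ kb]].
          by rewrite addr0 !mxE !eqxx mulr1.
        by rewrite !mxE [b == k]eq_sym (negbTE kb) andbF mulr0.
      rewrite big1 // => k kn; rewrite !mxE; case: (eqVneq b k) => [bk|]; last by rewrite andbF mulr0.
      by move: bn; rewrite bk kn.
    case: ifPn => bn.
      case: (eqVneq b i) => [bi|_]; last by rewrite andbF mulr0 addr0 normr_coord.
      by move: bn; rewrite bi ltnNge ni.
    rewrite add0r eqxx /=; case: (eqVneq b i) => [_|_]; last by rewrite mulr0 normr0.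
    rewrite mulr1 normrM; case/andP: t01 => t0 t1.
    by rewrite (ger0_norm t0) (le_trans _ (normr_coord v i))// ler_piMl.
  have step (n i : 'I_3) : (n <= i)%N ->
      `|h (w n + v 0 i *: evec i) - h (w n) - v 0 i * pd i h q| <= `|v| * (eps / 3).
    move=> ni; apply: le_trans (_ : `|v 0 i| * (eps / 3) <= _); last first.
      by rewrite ler_wpM2r ?normr_coord // divr_ge0// ltW.
    by apply: increment_basis => t t01; apply: Hd; apply: wd.
  have s0 := step ord0 ord0 (leqnn _).
  have s1 := step 1 1 (leqnn _).
  have s2 := step (lift ord0 (lift ord0 ord0)) (lift ord0 (lift ord0 ord0)) (leqnn _).
  have w0 : w ord0 = q by rewrite /w big_pred0 ?addr0 // => i; rewrite ltn0.
  have w1 : w 1 = w ord0 + v 0 ord0 *: evec ord0.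
    rewrite w0 /w big_mkcond !big_ord_recl big_ord0 /=.
    by rewrite !addr0.
  have w2 : w (lift ord0 (lift ord0 ord0)) = w 1 + v 0 1 *: evec 1.
    rewrite w1 w0 /w big_mkcond !big_ord_recl big_ord0 /= !addr0 addrA.
    by have -> : lift ord0 ord0 = 1 :> 'I_3 by apply/val_inj.
  have w3 : v + q = w (lift ord0 (lift ord0 ord0)) +
      v 0 (lift ord0 (lift ord0 ord0)) *: evec (lift ord0 (lift ord0 ord0)).
    rewrite w2 w1 w0 {1}[v]row_evecE !big_ord_recl big_ord0 addr0 addrC !addrA.
    by have -> : lift ord0 ord0 = 1 :> 'I_3 by apply/val_inj.
  rewrite w3.
  have -> : L v = v 0 ord0 * pd ord0 h q + v 0 1 * pd 1 h q +
      v 0 (lift ord0 (lift ord0 ord0)) * pd (lift ord0 (lift ord0 ord0)) h q.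
    rewrite /L /dotform !big_ord_recl big_ord0 addr0 addrA.
    by have -> : lift ord0 ord0 = 1 :> 'I_3 by apply/val_inj.
  move: s0 s1 s2; rewrite -w2 -w1 w0.
  set A := h (w 1); set B := h (w _); set C := h (_ + _).
  set a := v 0 ord0 * _; set b := v 0 1 * _; set c := v 0 _ * _.
  move=> s0 s1 s2.
  have -> : C + (- h q - (a + b + c)) = (A - h q - a) + (B - A - b) + (C - B - c) by ring.
  apply: le_trans (ler_normD _ _) _.
  apply: le_trans (lerD (ler_normD _ _) s2) _.
  apply: le_trans (lerD (lerD s0 s1) (lexx _)) _.
  by rewrite le_eqVlt; apply/orP; left; apply/eqP; field.
apply/diff_locallyP; rewrite (diff_unique _ E); last exact: continuous_dotform.
by split => //; exact: continuous_dotform.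
Unshelve. all: by end_near. Qed.

Lemma diff_eps f q : differentiable f q -> forall eps : R, 0 < eps ->
  \forall v \near (0 : V), `|f (q + v) - f q - 'd f q v| <= eps * `|v|.
Proof.
move=> /diff_locally /eqaddoP E eps e0; have := E eps e0; apply: filterS => v.
rewrite /= opprD -![(_ + _ : _ -> _) _]/(_ + _) -![(- _ : _ -> _) _]/(- _) /cst /=.
by rewrite addrA [v + q]addrC.
Qed.

(** Mean value theorem in direction [i] for [x |-> f (x + t e_j) - f x], followed by the
    differential of [pd i f] at [q]. No continuity of second derivatives is required, only one
    differential at one point. *)
Lemma second_difference f q i j :
  (\forall x \near q, differentiable f x) -> differentiable (pd i f) q ->
  forall eps : R, 0 < eps -> \forall t \near (0 : R)^'+,
   `|f (q + t *: evec i + t *: evec j) - f (q + t *: evec i)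
     - f (q + t *: evec j) + f q - t ^+ 2 * pd j (pd i f) q| <= eps * t ^+ 2.
Proof.
move=> df dF eps eps0.
have e3 : 0 < eps / 3 by rewrite divr_gt0.
move: df => /nbhs_ballP[d /= d0 Hd].
move: (diff_eps dF e3) => /nbhs_ballP[r /= r0 Hr].
near=> t.
have t0 : 0 < t by near: t; exact: nbhs_right_gt.
have td : t * 2 < d.
  by rewrite -ltr_pdivlMr//; near: t; apply: nbhs_right_lt; rewrite divr_gt0.
have tr : t * 2 < r.
  by rewrite -ltr_pdivlMr//; near: t; apply: nbhs_right_lt; rewrite divr_gt0.
have nle (s u : R) : 0 <= s <= 1 -> 0 <= u <= 1 ->
    `|(s * t) *: evec i + (u * t) *: evec j| <= t * 2.
  move=> /andP[s0 s1] /andP[u0 u1].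
  apply: le_trans (ler_normD _ _) _; rewrite !normrZ.
  rewrite (ger0_norm s0) (ger0_norm u0) (gtr0_norm t0).
  have := normr_basis i; have := normr_basis j.
  have := normr_ge0 (evec i); have := normr_ge0 (evec j).
  set x := `|evec i|; set y := `|evec j| => *.
  have : s * t * x <= t.
    rewrite mulrAC ler_piMl ?(ltW t0)//.
    by rewrite mulr_ile1.
  have : u * t * y <= t.
    rewrite mulrAC ler_piMl ?(ltW t0)//.
    by rewrite mulr_ile1.
  by move=> *; lra.
have B (s u : R) : 0 <= s <= 1 -> 0 <= u <= 1 ->
    differentiable f (q + (s * t) *: evec i + (u * t) *: evec j).
  move=> s01 u01; apply: Hd; rewrite -ball_normE /= -addrA opprD addNKr normrN.
  exact: le_lt_trans (nle _ _ s01 u01) td.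
have O0 : 0 <= (0 : R) <= 1 by rewrite lexx ler01.
have O1 : 0 <= (1 : R) <= 1 by rewrite lexx ler01.
pose phi x := f (x + t *: evec j) - f x.
have dphi s : 0 <= s <= 1 -> is_derive (q + (s * t) *: evec i) (evec i) phi
    (pd i f (q + (s * t) *: evec i + t *: evec j) - pd i f (q + (s * t) *: evec i)).
  move=> s01.
  have /diff_derivable -/(_ (evec i)) d1 := B s 1 s01 O1.
  have /diff_derivable -/(_ (evec i)) d2 := B s 0 s01 O0.
  rewrite mul1r in d1; rewrite mul0r scale0r addr0 in d2.
  apply: is_deriveB; last exact: derivableP.
  have E : (fun s0 : R => s0^-1 *: (((fun x => f (x + t *: evec j)) \o shift (q + (s * t) *: evec i)) (s0 *: evec i)
      - f (q + (s * t) *: evec i + t *: evec j))) =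
     (fun s0 : R => s0^-1 *: ((f \o shift (q + (s * t) *: evec i + t *: evec j)) (s0 *: evec i)
      - f (q + (s * t) *: evec i + t *: evec j))).
    by apply/funext => x /=; rewrite !addrA.
  split; [by rewrite /derivable E; exact: d1|by rewrite /pd /derive E].
have [s s01|s s01] := @mvt_line phi q (t *: evec i).
  by rewrite scalerA; have [] := is_derive_scale t (@ex_derive _ _ _ _ _ _ _ (dphi _ s01)).
rewrite scalerA; have [_ ->] := is_derive_scale t (@ex_derive _ _ _ _ _ _ _ (dphi _ s01)).
have [_ ->] := dphi _ s01; rewrite /phi => Ephi.
pose v1 := (s * t) *: evec i + t *: evec j.
pose v2 := (s * t) *: evec i.
have n1 : `|v1| <= t * 2 by have := nle s 1 s01 O1; rewrite mul1r.
have n2 : `|v2| <= t * 2 by have := nle s 0 s01 O0; rewrite mul0r scale0r addr0.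
have n2' : `|v2| <= t.
  rewrite normrZ normrM (gtr0_norm t0); case/andP: s01 => s0 s1.
  rewrite (ger0_norm s0) mulrAC ler_piMl ?(ltW t0)// mulr_ile1 //.
  exact: normr_basis.
have H1 := Hr v1; have H2 := Hr v2.
rewrite -ball_normE /= !sub0r !normrN in H1 H2.
have {}H1 := H1 (le_lt_trans n1 tr); have {}H2 := H2 (le_lt_trans n2 tr).
have dv : 'd (pd i f) q v1 - 'd (pd i f) q v2 = t * pd j (pd i f) q.
  by rewrite -linearB /v1 /v2 addrAC subrr add0r linearZ /= -deriveE.
have -> : f (q + t *: evec i + t *: evec j) - f (q + t *: evec i)
     - f (q + t *: evec j) + f q = t * (pd i f (q + v1) - pd i f (q + v2)).
  by rewrite /v1 /v2 addrA -Ephi; ring.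
have -> : t * (pd i f (q + v1) - pd i f (q + v2)) - t ^+ 2 * pd j (pd i f) q =
   t * ((pd i f (q + v1) - pd i f q - 'd (pd i f) q v1) -
        (pd i f (q + v2) - pd i f q - 'd (pd i f) q v2)).
  rewrite [RHS](_ : _ = t * (pd i f (q + v1) - pd i f (q + v2) - ('d (pd i f) q v1 - 'd (pd i f) q v2))).
    by rewrite dv; ring.
  by ring.
rewrite normrM (gtr0_norm t0).
have : `|pd i f (q + v1) - pd i f q - 'd (pd i f) q v1 -
        (pd i f (q + v2) - pd i f q - 'd (pd i f) q v2)| <= eps * t.
  apply: le_trans (ler_normB _ _) _.
  apply: le_trans (lerD H1 H2) _.
  rewrite -mulrDr (_ : eps * t = eps / 3 * (t * 3)); last by field.
  by rewrite ler_wpM2l ?(ltW e3)//; lra.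
by rewrite expr2 mulrCA -(ler_pM2l t0).
Unshelve. all: by end_near. Qed.

(** Young's theorem: the second difference is symmetric in [i] and [j], and both mixed derivatives
    are its limit after division by [t ^+ 2]. *)
Lemma pdC f q i j : (\forall x \near q, differentiable f x) ->
  differentiable (pd i f) q -> differentiable (pd j f) q ->
  pd j (pd i f) q = pd i (pd j f) q.
Proof.
move=> df di dj; apply/eqP; rewrite -subr_eq0 -normr_le0.
apply/ler_addgt0Pr => /= eps eps0; rewrite add0r.
have aux (A x y t e : R) : 0 < t -> `|A - t * x| <= e / 2 * t ->
    `|A - t * y| <= e / 2 * t -> `|x - y| <= e.
  move=> t0 H1 H2; rewrite -(ler_pM2r t0) -{1}(gtr0_norm t0) -normrM.
  have -> : (x - y) * t = (A - t * y) - (A - t * x) by ring.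
  apply: le_trans (ler_normB _ _) _; apply: le_trans (lerD H2 H1) _.
  by rewrite -mulrDl -splitr.
have e2 : 0 < eps / 2 by rewrite divr_gt0.
have D1 := second_difference j df di e2; have D2 := second_difference i df dj e2.
have [t [[H1 H2] t0]] := filter_ex (filterI (filterI D1 D2) (nbhs_right_gt 0)).
have t2 : 0 < t ^+ 2 by rewrite exprn_gt0.
rewrite [q + t *: evec j + _]addrAC [_ - f (q + t *: evec j) - _]addrAC in H2.
exact: aux t2 H1 H2.
Qed.

End PartialDerivatives.

(** * Smooth functions and ideals stable under differentiation *)

Section PdRules.
Context {R : realType}.
Local Notation V := 'rV[R]_3.
Implicit Types (f g h : V -> R) (q v : V) (i j : 'I_3) (U : set V) (F : V -> V).

Lemma near_eq_pd f g q i : (\forall x \near q, f x = g x) -> pd i f q = pd i g q.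
Proof. exact: near_eq_derive. Qed.

Lemma open_eq_pd U f g q i : open U -> (forall x, U x -> f x = g x) -> U q ->
  pd i f q = pd i g q.
Proof.
by move=> oU fg Uq; apply: near_eq_pd; apply: filterS fg _; exact: open_nbhs_nbhs.
Qed.

Lemma near_eq_differentiable f g q : (\forall x \near q, f x = g x) ->
  differentiable f q -> differentiable g q.
Proof.
move=> fg df.
have E : (g : V -> R^o) \o shift q = cst (g q : R^o) + ('d f q : V -> R^o) +o_ (0 : V) id.
  apply/eqaddoP => eps eps0.
  have fg0 : \forall v \near (0 : V), f (v + q) = g (v + q).
    by move: fg; rewrite (near_shift 0) /= subr0; apply: filterS => v /=.
  have := diff_eps df eps0; apply: filterS2 fg0 => v fgv.
  rewrite /= opprD -![(_ + _ : _ -> _) _]/(_ + _) -![(- _ : _ -> _) _]/(- _) /cst /=.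
  by rewrite addrA -fgv -(nbhs_singleton fg) addrC [v + q]addrC addrC.
apply/diff_locallyP; rewrite (diff_unique _ E); last exact: diff_continuous.
by split => //; exact: diff_continuous.
Qed.

Lemma pdD f g q i : differentiable f q -> differentiable g q ->
  pd i (fun x => f x + g x) q = pd i f q + pd i g q.
Proof. by move=> df dg; rewrite /pd deriveD//; exact: diff_derivable. Qed.

Lemma pdM f g q i : differentiable f q -> differentiable g q ->
  pd i (fun x => f x * g x) q = f q * pd i g q + g q * pd i f q.
Proof. by move=> df dg; rewrite /pd deriveM//; exact: diff_derivable. Qed.

Lemma pdV f q i : f q != 0 -> differentiable f q ->
  pd i (fun x => (f x)^-1) q = - (pd i f q * (f q)^-1 * (f q)^-1).
Proof.
move=> f0 df; rewrite /pd deriveV//; last exact: diff_derivable.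
by rewrite [LHS]mulNr -exprVn expr2 mulrC mulrA.
Qed.

Lemma pd_cst (c : R) q i : pd i (fun=> c) q = 0.
Proof. exact: derive_cst. Qed.

Lemma differentiable_coordinate q j : differentiable (fun x : V => x 0 j) q.
Proof. exact: differentiable_coord. Qed.

Lemma pd_coord q i j : pd i (fun x : V => x 0 j) q = (i == j)%:R.
Proof.
rewrite /pd.
have := @derive_mx R V 1 3 id q (evec i) (@derivable_id _ _ _ _).
by rewrite derive_id => /matrixP/(_ 0 j); rewrite !mxE eqxx /= eq_sym => ->.
Qed.

Lemma differentiable_rV F q : (forall j, differentiable (fun x => F x 0 j) q) ->
  differentiable F q.
Proof.
move=> dF.
have -> : F = \sum_j (fun x => F x 0 j *: evec j).
  by apply/funext => x; rewrite fct_sumE -row_evecE.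
apply: differentiable_sum => j; exact: differentiableZl.
Qed.

Lemma pd_comp h F q i : differentiable h (F q) ->
  (forall j, differentiable (fun x => F x 0 j) q) ->
  pd i (fun x => h (F x)) q = \sum_j pd j h (F q) * pd i (fun x => F x 0 j) q.
Proof.
move=> dh dF; have dFq := differentiable_rV dF.
rewrite /pd deriveE; last exact: (differentiable_comp dFq dh).
rewrite (diff_comp dFq dh) /= -deriveE // -deriveE // derive_basis //.
apply: eq_bigr => j _; rewrite mulrC derive_mx ?mxE //.
exact: diff_derivable.
Qed.

End PdRules.

(** * Classes of functions closed under iterated partial derivatives *)

Section Levels.
Context {R : realType}.
Local Notation V := 'rV[R]_3.
Implicit Types (f g h : V -> R) (q v : V) (i j : 'I_3) (U : set V) (F : V -> V).
Implicit Types (A I B : (V -> R) -> Prop) (k : nat).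

Definition dif U f : Prop := forall q, U q -> differentiable f q.

Fixpoint lvl B k h : Prop :=
  B h /\ if k is k'.+1 then forall i, lvl B k' (pd i h) else True.

Definition alv B h : Prop := forall k, lvl B k h.

(** Order-zero axioms making [I] a module over [A]; [ideal_ext] says that only values on the open
    set [U] count. The Leibniz rule lifts them to all orders. The pairs used are differentiable over
    differentiable, moderate over moderate and rapid over moderate functions. *)
Record ideal U A I : Prop := Ideal {
  ideal_open : open U;
  ideal_dif : forall f, I f -> dif U f;
  ideal_difA : forall f, A f -> dif U f;
  ideal_ext : forall f g, (forall q, U q -> f q = g q) -> I f -> I g;
  idealD : forall f g, I f -> I g -> I (fun q => f q + g q);
  idealM : forall f g, I f -> A g -> I (fun q => f q * g q) }.

Lemma lvl0 B k f : lvl B k f -> B f. Proof. by case: k => [|k] []. Qed.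

Lemma lvlS B k f : lvl B k.+1 f -> lvl B k f.
Proof. by elim: k f => [f []//|k IH f [Bf H]]; split => // i; exact/IH/H. Qed.

Lemma lvl_sub A B k f : (forall h, A h -> B h) -> lvl A k f -> lvl B k f.
Proof. by move=> AB; elim: k f => [f [/AB]//|k IH f [/AB Bf H]]; split => // i; exact/IH/H. Qed.

Lemma alv0 B f : alv B f -> B f. Proof. by move=> /(_ 0%N) []. Qed.

Lemma alv_sub A B f : (forall h, A h -> B h) -> alv A f -> alv B f.
Proof. by move=> AB H k; exact: lvl_sub (H k). Qed.

Lemma alv_pd B f i : alv B f -> alv B (pd i f).
Proof. by move=> H k; have [_] := H k.+1; exact. Qed.

Section IdealLevels.
Variables (U : set V) (A I : (V -> R) -> Prop).
Hypothesis AI : ideal U A I.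

Lemma lvl_ext k f g : (forall q, U q -> f q = g q) -> lvl I k f -> lvl I k g.
Proof.
elim: k f g => [|k IH] f g fg [If H]; split => //; try exact: ideal_ext AI _ _ fg If.
move=> i; apply: IH (H i) => q Uq.
exact: open_eq_pd (ideal_open AI) fg Uq.
Qed.

Lemma lvlD k f g : lvl I k f -> lvl I k g -> lvl I k (fun q => f q + g q).
Proof.
elim: k f g => [|k IH] f g [If Hf] [Ig Hg]; split => //; try exact: idealD AI _ _ If Ig.
move=> i; apply: lvl_ext (IH _ _ (Hf i) (Hg i)) => q Uq.
by rewrite pdD//; [exact: ideal_dif AI _ If _ Uq|exact: ideal_dif AI _ Ig _ Uq].
Qed.

Lemma lvlM k f g : lvl I k f -> lvl A k g -> lvl I k (fun q => f q * g q).
Proof.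
elim: k f g => [|k IH] f g Hf Hg; first by case: Hf => If _; case: Hg => Ag _; split => //; exact: (idealM AI).
have If := lvl0 Hf; have Ag := lvl0 Hg.
split; first exact: (idealM AI).
move=> i.
have H : lvl I k (fun q => f q * pd i g q + pd i f q * g q).
  apply: lvlD; apply: IH => //; try exact: lvlS.
  - by have [_] := Hg; exact.
  - by have [_] := Hf; exact.
apply: lvl_ext H => q Uq; rewrite pdM ?[g q * _]mulrC//.
  exact: ideal_dif AI _ If _ Uq.
exact: ideal_difA AI _ Ag _ Uq.
Qed.

Lemma lvl_sum3 k (f : 'I_3 -> V -> R) : (forall j, lvl I k (f j)) ->
  lvl I k (fun q => \sum_j f j q).
Proof.
move=> H.
have -> : (fun q => \sum_j f j q) =
    (fun q => f ord0 q + (f (lift ord0 ord0) q + f (lift ord0 (lift ord0 ord0)) q)).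
  by apply/funext => q; rewrite !big_ord_recl big_ord0 addr0.
by do ! apply: lvlD.
Qed.

Lemma alv_ext f g : (forall q, U q -> f q = g q) -> alv I f -> alv I g.
Proof. by move=> fg H k; exact: lvl_ext (H k). Qed.

Lemma alvD f g : alv I f -> alv I g -> alv I (fun q => f q + g q).
Proof. by move=> Hf Hg k; exact: lvlD. Qed.

Lemma alvM f g : alv I f -> alv A g -> alv I (fun q => f q * g q).
Proof. by move=> Hf Hg k; exact: lvlM. Qed.

(** By the chain rule the derivatives of [h o F] are sums of [(pd j h) o F] times derivatives of
    [F]. It is therefore enough that [O] be closed under differentiation and land in [I] at order
    zero. [O] will be the smooth functions, then the flat ones. *)
Lemma alv_comp (O : (V -> R) -> Prop) F :
  (forall h i, O h -> O (pd i h)) ->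
  (forall h q, O h -> U q -> differentiable h (F q)) ->
  (forall h, O h -> I (fun q => h (F q))) ->
  (forall j, alv A (fun q => F q 0 j)) ->
  forall h, O h -> alv I (fun q => h (F q)).
Proof.
move=> Opd Odif OI HF h Oh k.
elim: k h Oh => [|k IH] h Oh; split => //; try exact: OI.
move=> i.
have H : lvl I k (fun q => \sum_j pd j h (F q) * pd i (fun x => F x 0 j) q).
  apply: lvl_sum3 => j; apply: lvlM; first exact/IH/Opd.
  exact: alv_pd.
apply: lvl_ext H => q Uq; rewrite pd_comp//; first exact: Odif.
by move=> j; apply: (ideal_difA AI) Uq; exact: alv0.
Qed.

End IdealLevels.

Section AlgebraLevels.
Variables (U : set V) (A : (V -> R) -> Prop).
Hypotheses (AA : ideal U A A) (Acst : forall c : R, A (fun=> c)).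

Lemma alv_cst (c : R) : alv A (fun=> c).
Proof.
move=> k; elim: k c => [|k IH] c; split => // i.
by apply: (lvl_ext AA) (IH 0) => q _; rewrite pd_cst.
Qed.

Lemma alvN f : alv A f -> alv A (fun q => - f q).
Proof.
move=> H; apply: (alv_ext AA) (alvM AA H (alv_cst (-1))) => q _.
by rewrite mulrN1.
Qed.

Lemma alvB f g : alv A f -> alv A g -> alv A (fun q => f q - g q).
Proof. by move=> Hf Hg; apply: (alvD AA) => //; exact: alvN. Qed.

Lemma alvX f n : alv A f -> alv A (fun q => f q ^+ n).
Proof.
move=> H; elim: n => [|n IH].
  by apply: (alv_ext AA) (alv_cst 1) => q _; rewrite expr0.
by apply: (alv_ext AA) (alvM AA H IH) => q _; rewrite exprS.
Qed.

(** The derivative of [1/f] is [- f' (1/f)^2], so order [k] for [1/f] yields order [k + 1]. *)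
Lemma alvV f : (forall q, U q -> f q != 0) -> A (fun q => (f q)^-1) ->
  alv A f -> alv A (fun q => (f q)^-1).
Proof.
move=> f0 AV H k; elim: k => [|k IH]; split => // i.
have /(lvl_ext AA) : lvl A k (fun q => -1 * (pd i f q * (f q)^-1 * (f q)^-1)).
  apply: (lvlM AA); first exact: alv_cst.
  by apply: (lvlM AA) => //; apply: (lvlM AA) => //; exact: alv_pd.
apply => q Uq; rewrite pdV ?mulN1r//; first exact: f0.
by apply: (ideal_dif AA) Uq; exact: alv0.
Qed.

Lemma alv_coord j : A (fun q => q 0 j) -> alv A (fun q => q 0 j).
Proof.
move=> Aj [|k]; split => // i; apply: (lvl_ext AA) (alv_cst (i == j)%:R k) => q _.
by rewrite pd_coord.
Qed.

End AlgebraLevels.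

Definition smooth U h : Prop := alv (dif U) h.

Lemma dif_ideal U : open U -> ideal U (dif U) (dif U).
Proof.
move=> oU; split => //.
- move=> f g fg df q Uq; apply: near_eq_differentiable (df _ Uq).
  by apply: filterS fg _; exact: open_nbhs_nbhs.
- by move=> f g df dg q Uq; apply: differentiableD; [exact: df|exact: dg].
- by move=> f g df dg q Uq; apply: differentiableM; [exact: df|exact: dg].
Qed.

Lemma smooth_ext_open U f g : open U -> (forall q, U q -> f q = g q) ->
  smooth U f -> smooth U g.
Proof. by move=> oU fg; apply: alv_ext fg; exact: dif_ideal. Qed.

Lemma smooth_sub U U' f : U' `<=` U -> smooth U f -> smooth U' f.
Proof. by move=> sU; apply: alv_sub => h dh q /sU; exact: dh. Qed.

(** The sets [U'] may be arbitrary, since [smooth] is a condition on differentiability at points. *)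
Lemma smooth_local U f : (forall q, U q -> exists2 U' : set V, U' q & smooth U' f) ->
  smooth U f.
Proof.
move=> H k; elim: k f H => [|k IH] f H; split => //.
- by move=> q Uq; have [U' U'q sf] := H _ Uq; exact: (alv0 sf).
- by move=> q Uq; have [U' U'q sf] := H _ Uq; exact: (alv0 sf).
- move=> i; apply: IH => q Uq; have [U' U'q sf] := H _ Uq.
  by exists U' => //; exact: alv_pd.
Qed.

Lemma smooth_pd U f i : smooth U f -> smooth U (pd i f).
Proof. exact: alv_pd. Qed.

Lemma smooth_dif U f q : smooth U f -> U q -> differentiable f q.
Proof. by move=> /alv0; exact. Qed.

Lemma smooth_continuous U f q : smooth U f -> U q -> {for q, continuous f}.
Proof. by move=> sf Uq; apply: differentiable_continuous; exact: smooth_dif sf Uq. Qed.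

Section SmoothOpen.
Variable U : set V.
Hypothesis oU : open U.
Let AA := dif_ideal oU.

Lemma dif_cst (c : R) : dif U (fun=> c).
Proof. by move=> q _; exact: differentiable_cst. Qed.

Lemma smooth_cst (c : R) : smooth U (fun=> c).
Proof. exact: alv_cst AA dif_cst c. Qed.

Lemma smooth_coord j : smooth U (fun q => q 0 j).
Proof. apply: (alv_coord AA dif_cst) => q _; exact: differentiable_coordinate. Qed.

Lemma smoothD f g : smooth U f -> smooth U g -> smooth U (fun q => f q + g q).
Proof. exact: (alvD AA). Qed.

Lemma smoothM f g : smooth U f -> smooth U g -> smooth U (fun q => f q * g q).
Proof. exact: (alvM AA). Qed.

Lemma smoothN f : smooth U f -> smooth U (fun q => - f q).
Proof. exact: alvN AA dif_cst f. Qed.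

Lemma smoothB f g : smooth U f -> smooth U g -> smooth U (fun q => f q - g q).
Proof. exact: alvB AA dif_cst f g. Qed.

Lemma smoothX f n : smooth U f -> smooth U (fun q => f q ^+ n).
Proof. exact: alvX AA dif_cst f n. Qed.

Lemma smoothV f : (forall q, U q -> f q != 0) -> smooth U f ->
  smooth U (fun q => (f q)^-1).
Proof.
move=> f0 sf; apply: (alvV AA dif_cst) => // q Uq.
by apply: differentiableV; [exact: smooth_dif sf Uq|exact: f0].
Qed.

Lemma smooth_comp U' h F : (forall q, U q -> U' (F q)) ->
  (forall j, smooth U (fun q => F q 0 j)) -> smooth U' h ->
  smooth U (fun q => h (F q)).
Proof.
move=> UU' sF.
apply: (alv_comp AA (O := smooth U')) => //; first exact: smooth_pd.
- by move=> g q sg /UU'; exact: smooth_dif.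
- move=> g sg q Uq; apply: differentiable_comp.
    by apply: differentiable_rV => j; exact: smooth_dif Uq.
  exact: smooth_dif sg (UU' _ Uq).
Qed.

End SmoothOpen.

Lemma smooth_pdC U h q i j : open U -> smooth U h -> U q ->
  pd j (pd i h) q = pd i (pd j h) q.
Proof.
move=> oU sh Uq; apply: pdC.
- apply: filterS (open_nbhs_nbhs (conj oU Uq)) => x; exact: smooth_dif.
- exact: smooth_dif (smooth_pd i sh) Uq.
- exact: smooth_dif (smooth_pd j sh) Uq.
Qed.

End Levels.

Section SmoothOpenMaps.
Context {R : realType}.
Local Notation V := 'rV[R]_3.

Lemma Ck_derive1 k (U : set V) (G : V -> V) i j : open U -> Ck k.+1 U G ->
  Ck k U (fun x => 'D_(evec i) G x) /\
  forall q, U q -> derivable (fun x => G x 0 j) q (evec i) /\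
    pd i (fun x => G x 0 j) q = 'D_(evec i) G q 0 j.
Proof.
move=> oU [_ /(_ (evec i))[dG CG]]; split => // q Uq; have dGq := dG _ Uq.
by split; [exact/(derivable_mxP G q (evec i)).1|rewrite derive_mx// mxE].
Qed.

(** [Ck] speaks of directional derivatives; one order of it is spent to reach Fréchet
    differentiability through [C1_differentiable]. *)
Lemma Ck_dif k (U : set V) (G : V -> V) j : open U -> Ck k.+1 U G ->
  dif U (fun x => G x 0 j).
Proof.
move=> oU CG q Uq; apply: C1_differentiable => i.
  apply: filterS (open_nbhs_nbhs (conj oU Uq)) => x Ux.
  by have [_ /(_ x Ux)[]] := Ck_derive1 i j oU CG.
have [CdG H] := Ck_derive1 i j oU CG.
have cdG : {for q, continuous (fun x => 'D_(evec i) G x)} by case: k CG CdG H => [|k] _ [+ _] _; apply.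
have c := continuous_comp cdG (@coord_continuous R 1 3 0 j ('D_(evec i) G q)).
suff : pd i (fun x => G x 0 j) x @[x --> q] --> pd i (fun x => G x 0 j) q by [].
rewrite (H _ Uq).2; apply: cvg_trans c.
have N : {near nbhs q, (fun x => 'D_(evec i) G x 0 j) =1 pd i (fun x => G x 0 j)}.
  by apply: filterS (open_nbhs_nbhs (conj oU Uq)) => x Ux /=; rewrite (H _ Ux).2.
exact: (near_eq_cvg N).
Qed.

Lemma smooth_open_smooth (U : set V) (G : V -> V) : open U -> smooth_open U G ->
  forall j, smooth U (fun x => G x 0 j).
Proof.
move=> oU sG j k; have := sG k.+1; elim: k G {sG} => [|k IH] G CG.
  by split => //; exact: Ck_dif CG.
split; first exact: Ck_dif CG.
move=> i; have [CdG H] := Ck_derive1 i j oU CG.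
by apply: (lvl_ext (dif_ideal oU)) (IH _ CdG) => q Uq; rewrite (H _ Uq).2.
Qed.

End SmoothOpenMaps.

(** * Taylor estimates and Hadamard's lemma *)

Section Row3.
Context {R : realType}.
Local Notation V := 'rV[R]_3.

Lemma ord3P (P : 'I_3 -> Prop) : P 0 -> P 1 -> P 2%:R -> forall i, P i.
Proof.
move=> P0 P1 P2 [[|[|[|//]]] i3].
- by rewrite (_ : Ordinal i3 = 0) //; exact/val_inj.
- by rewrite (_ : Ordinal i3 = 1) //; exact/val_inj.
- by rewrite (_ : Ordinal i3 = 2%:R) //; exact/val_inj.
Qed.

Lemma sum_ord3 (M : nmodType) (f : 'I_3 -> M) : \sum_i f i = f 0 + f 1 + f 2%:R.
Proof.
rewrite !big_ord_recl big_ord0 addr0 addrA.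
by congr (f _ + f _ + f _); exact/val_inj.
Qed.

Lemma row3_0 (a b c : R) : row3 a b c 0 0 = a. Proof. by rewrite mxE. Qed.
Lemma row3_1 (a b c : R) : row3 a b c 0 1 = b. Proof. by rewrite mxE. Qed.
Lemma row3_2 (a b c : R) : row3 a b c 0 2%:R = c. Proof. by rewrite mxE. Qed.
Definition row3E := (row3_0, row3_1, row3_2).

Lemma row3P (u v : V) : u 0 0 = v 0 0 -> u 0 1 = v 0 1 -> u 0 2%:R = v 0 2%:R -> u = v.
Proof. by move=> *; apply/rowP; apply: ord3P. Qed.

Lemma normr_rV_le (v : V) (e : R) : 0 <= e -> (forall i, `|v 0 i| <= e) -> `|v| <= e.
Proof.
move=> e0 ve; rewrite /Num.Def.normr/= mx_normrE; apply: bigmax_le => // -[a b] _ /=.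
by rewrite [a]ord1.
Qed.

Lemma ler_norm_sum3 (f : 'I_3 -> R) (c : R) : (forall i, `|f i| <= c) ->
  `|\sum_i f i| <= 3 * c.
Proof.
move=> H; apply: le_trans (ler_norm_sum _ _ _) _.
rewrite sum_ord3; move: (H 0) (H 1) (H 2%:R).
by move: `|f 0| `|f 1| `|f 2%:R| => x y z *; lra.
Qed.

End Row3.

Section Box.
Context {R : realType}.
Local Notation V := 'rV[R]_3.
Implicit Types (f h : V -> R) (q v : V) (U K : set V).

Definition box (a b : V) : set V := [set q | forall i, a 0 i <= q 0 i <= b 0 i].

Lemma compact_box (a b : V) : compact (box a b).
Proof.
have := @rV_compact R 3 (fun i => [set` `[a 0 i, b 0 i]%R]) (fun i => @segment_compact _ _ _).
congr compact; apply/seteqP; split => q /= H i; have := H i; by rewrite in_itv.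
Qed.

Lemma smooth_within U K h : K `<=` U -> smooth U h -> {within K, continuous h}.
Proof.
move=> KU sh; apply: continuous_in_subspaceT => q /set_mem /KU; exact: smooth_continuous.
Qed.

Lemma smooth_bounded U K h : compact K -> K `<=` U -> smooth U h ->
  exists M : R, forall q, K q -> `|h q| <= M.
Proof.
move=> cK KU sh; have := continuous_compact (smooth_within KU sh) cK.
move=> /compact_bounded[M [_ HM]]; exists (M + 1) => q Kq.
by apply: HM; [rewrite ltrDl|exists q].
Qed.

Lemma bound_fin3 (P : 'I_3 -> R -> Prop) :
  (forall i x y, x <= y -> P i x -> P i y) ->
  (forall i, exists x, P i x) -> exists x, forall i, P i x.
Proof.
move=> Pm H; have [x Hx] := H 0; have [y Hy] := H 1; have [z Hz] := H 2%:R.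
exists (`|x| + `|y| + `|z|).
have := ler_norm x; have := ler_norm y; have := ler_norm z => *.
have := normr_ge0 x; have := normr_ge0 y; have := normr_ge0 z => *.
apply: (@ord3P (fun i => P i _)); [apply: Pm Hx|apply: Pm Hy|apply: Pm Hz]; lra.
Qed.

Lemma smooth_bounded_pd2 U K h : compact K -> K `<=` U -> smooth U h ->
  exists2 M : R, 0 <= M & forall i j q, K q -> `|pd j (pd i h) q| <= M.
Proof.
move=> cK KU sh.
have [M HM] : exists M : R, forall i j q, K q -> `|pd j (pd i h) q| <= M.
  apply: bound_fin3 => [i x y xy H j q Kq|i]; first exact: le_trans (H j q Kq) xy.
  apply: bound_fin3 => [j x y xy H q Kq|j]; first exact: le_trans (H q Kq) xy.
  by apply: smooth_bounded cK KU _; do 2 apply: smooth_pd.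
by exists `|M| => // i j q Kq; apply: le_trans (HM _ _ _ Kq) (ler_norm _).
Qed.

(** Two nested applications of the mean value theorem, each a sum over three coordinates bounded in
    the sup norm, whence 9 = 3 * 3. *)
Lemma taylor2 U h a v (M : R) : 0 <= M -> smooth U h ->
  (forall t : R, 0 <= t <= 1 -> U (a + t *: v)) ->
  (forall i j (t : R), 0 <= t <= 1 -> `|pd j (pd i h) (a + t *: v)| <= M) ->
  `|h (a + v) - h a - \sum_i v 0 i * pd i h a| <= 9 * M * `|v| ^+ 2.
Proof.
move=> M0 sh Uv HM.
have [t t01|t t01 ->] := @mvt_line R h a v.
  by apply: diff_derivable; exact: smooth_dif sh (Uv _ t01).
rewrite derive_basis; last exact: smooth_dif sh (Uv _ t01).
rewrite -sumrB.
have H i : `|v 0 i * pd i h (a + t *: v) - v 0 i * pd i h a| <= `|v| * (3 * M * `|v|).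
  rewrite -mulrBr normrM; apply: ler_pM => //; first exact: normr_coord.
  have st (s : R) : 0 <= s <= 1 -> 0 <= s * t <= 1.
    by move=> /andP[s0 s1]; case/andP: t01 => t0 t1; rewrite mulr_ge0//= mulr_ile1.
  have [s s01|s s01 ->] := @mvt_line R (pd i h) a (t *: v).
    by rewrite scalerA; apply: diff_derivable; exact: smooth_dif (smooth_pd i sh) (Uv _ (st _ s01)).
  rewrite scalerA derive_basis; last exact: smooth_dif (smooth_pd i sh) (Uv _ (st _ s01)).
  rewrite -mulrA [M * _]mulrC; apply: ler_norm_sum3 => j.
  rewrite normrM; apply: ler_pM => //; last exact/HM/st.
    rewrite mxE normrM; case/andP: t01 => t0 t1; rewrite (ger0_norm t0).
    by apply: le_trans (normr_coord v j); rewrite ler_piMl.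
apply: le_trans (ler_norm_sum3 H) _.
by rewrite le_eqVlt; apply/orP; left; apply/eqP; ring.
Qed.

(** A quadratic remainder gives differentiability and the values of the partial derivatives at once.
    It serves for integrals with a parameter and for [circ]. *)
Lemma differentiable_quadratic h q (c : 'I_3 -> R) (C : R) :
  (\forall v \near (0 : V), `|h (q + v) - h q - \sum_i v 0 i * c i| <= C * `|v| ^+ 2) ->
  differentiable h q /\ forall i, pd i h q = c i.
Proof.
move=> H.
have E : (h : V -> R^o) \o shift q = cst (h q : R^o) + (dotform c : V -> R^o) +o_ (0 : V) id.
  apply/eqaddoP => eps eps0.
  have C1 : 0 < `|C| + 1 by rewrite ltr_wpDl.
  have N : \forall v \near (0 : V), `|v| <= eps / (`|C| + 1).
    by apply: nbhs0_le; rewrite divr_gt0.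
  apply: filterS2 N H => v vN.
  rewrite /= opprD -![(_ + _ : _ -> _) _]/(_ + _) -![(- _ : _ -> _) _]/(- _) /cst /=.
  rewrite addrA [v + q]addrC => /le_trans; apply.
  rewrite expr2 mulrA ler_wpM2r //.
  rewrite ler_pdivlMr // in vN.
  apply: le_trans vN; rewrite mulrC ler_wpM2l //.
  by rewrite (le_trans (ler_norm _)) // lerDl.
have dh : 'd h q = dotform c :> (V -> R) by apply: (diff_unique _ E); exact: continuous_dotform.
have dfh : differentiable h q.
  apply/diff_locallyP; rewrite dh; split => //; exact: continuous_dotform.
split => // i; rewrite /pd deriveE// dh /dotform (bigD1 i) //= big1 ?addr0.
  by rewrite mxE !eqxx mul1r.
by move=> j ji; rewrite mxE (negbTE ji) andbF mul0r.
Qed.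

End Box.

(** * Hadamard's lemma in the radial variable *)

Section Hadamard.
Context {R : realType}.
Local Notation V := 'rV[R]_3.
Implicit Types (h : V -> R) (q v : V).
Local Notation mu := (@lebesgue_measure R).

Definition slab : set V := [set q | -1 < q 0 0 < 1].

Definition squeeze (s : R) q : V := \row_i ((if i == 0 then s else 1) * q 0 i).

(* [fibre_mean 0 (pd 0 h)] is [h / q 0 0], smoothly extended across [q 0 0 = 0]. *)
Definition fibre_mean (m : nat) h q : R :=
  \int[mu]_(s in `[0, 1]) (s ^+ m * h (squeeze s q)).

Lemma mu01 : fine (mu `[0, 1]) = 1.
Proof. by rewrite [mu _](@lebesgue_measure_itv R `[0%R, 1%R]) /= lte_fin ltr01 oppr0 adde0. Qed.

Lemma open_slab : open slab.
Proof.
rewrite openE => q /= qs.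
have c := @coord_continuous R 1 3 0 0 q.
have H1 : nbhs (q 0 0) [set x | -1 < x < 1].
  have : open (`](-1 : R), (1 : R)[%classic : set R) by exact: interval_open.
  rewrite openE => /(_ (q 0 0)); rewrite /= in_itv /= => /(_ qs).
  by apply: filterS => x /=; rewrite in_itv.
exact: (c _ H1).
Qed.

Lemma squeezeD s q v : squeeze s (q + v) = squeeze s q + squeeze s v.
Proof. by apply/rowP => i; rewrite !mxE mulrDr. Qed.

Lemma squeezeZ s t q : squeeze s (t *: q) = t *: squeeze s q.
Proof. by apply/rowP => i; rewrite !mxE mulrCA. Qed.

Lemma squeeze1 q : squeeze 1 q = q.
Proof. by apply/rowP => i; rewrite !mxE if_same mul1r. Qed.

Lemma normr_squeeze s v : 0 <= s <= 1 -> `|squeeze s v| <= `|v|.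
Proof.
move=> /andP[s0 s1]; apply: normr_rV_le => // i; rewrite mxE normrM.
apply: le_trans (normr_coord v i); apply: ler_piMl => //.
by case: ifP => _; rewrite ?normr1 // ger0_norm.
Qed.

Lemma slab_squeeze s q : 0 <= s <= 1 -> slab q -> slab (squeeze s q).
Proof.
move=> /andP[s0 s1]; rewrite /slab /= mxE eqxx => H; rewrite -ltr_norml normrM ger0_norm//.
by rewrite -ltr_norml in H; apply: le_lt_trans H; rewrite ler_piMl.
Qed.

Lemma continuous_squeeze q : continuous (fun s : R => squeeze s q).
Proof.
move=> s.
have -> : (fun s : R => squeeze s q) = (fun s => squeeze 0 q + s *: (q - squeeze 0 q)).
  apply/funext => t; apply/rowP => i; rewrite !mxE; case: ifP => _; ring.
by apply: cvgD; [exact: cvg_cst|apply: cvgZr_tmp].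
Qed.

Lemma fibre_integrable (m : nat) h q : smooth slab h -> slab q ->
  mu.-integrable `[0, 1] (EFin \o (fun s => s ^+ m * h (squeeze s q))).
Proof.
move=> sh sq; apply: continuous_compact_integrable; first exact: segment_compact.
apply: continuous_in_subspaceT => s /set_mem; rewrite /= in_itv /= => s01.
have c1 : {for s, continuous (fun s : R => h (squeeze s q))}.
  apply: (@continuous_comp _ _ _ (fun s => squeeze s q) h); first exact: continuous_squeeze.
  exact: smooth_continuous sh (slab_squeeze s01 sq).
exact: (cvgM (@exprn_continuous R m s) c1).
Qed.

(** Differentiation under the integral: the Taylor remainder of the integrand is quadratic in [v]
    uniformly in [s]. A radial derivative brings out one factor [s], which is why the weight
    [s ^+ m] is carried along. *)
Lemma fibre_mean_diff (m : nat) h q : smooth slab h -> slab q ->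
  differentiable (fibre_mean m h) q /\
  forall i, pd i (fibre_mean m h) q = fibre_mean (m + (i == 0)) (pd i h) q.
Proof.
move=> sh sq.
(* Half the distance from [q] to the boundary of the slab: for [|v| <= d] all points
   [squeeze s (q + v)] stay in the compact set [B] below. *)
pose d := (1 - `|q 0 0|) / 2.
have q1 : `|q 0 0| < 1 by move: sq; rewrite /slab /= -ltr_norml.
have d0 : 0 < d by rewrite divr_gt0// subr_gt0.
have d1 : d <= 1 by rewrite /d; have := normr_ge0 (q 0 0); lra.
pose B := box (- const_mx (`|q| + 1) : V) (const_mx (`|q| + 1)) `&`
   [set v | `|v 0 0| <= 1 - d].
have clB : compact B.
  have -> : B = box (row3 (- (1 - d)) (-(`|q| + 1)) (-(`|q| + 1)))
                   (row3 (1 - d) (`|q| + 1) (`|q| + 1)).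
    apply/seteqP; split => [v [H1 H2]|v H].
      apply: ord3P; rewrite !row3E; first by rewrite -ler_norml.
        by have := H1 1; rewrite !mxE.
      by have := H1 2%:R; rewrite !mxE.
    have H0 := H 0; have H1 := H 1; have H2 := H 2%:R; rewrite !row3E in H0 H1 H2.
    split; last by rewrite /= ler_norml.
    apply: ord3P; rewrite !mxE //.
    have := normr_ge0 q; move: H0 => /andP[] *; apply/andP; split; lra.
  exact: compact_box.
have BU : B `<=` slab.
  move=> v [_ /= vd]; rewrite /slab /= -ltr_norml; lra.
have SB s v : 0 <= s <= 1 -> `|v| <= d -> B (squeeze s (q + v)).
  move=> s01 vd; split.
    move=> i; rewrite !mxE -ler_norml normrM.
    apply: le_trans (_ : 1 * `|q 0 i + v 0 i| <= _).
      by apply: ler_wpM2r => //; case: ifP => _; rewrite ?normr1//; case/andP: s01 => s0 s1; rewrite ger0_norm.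
    rewrite mul1r; apply: le_trans (ler_normD _ _) _.
    by have := normr_coord q i; have := normr_coord v i; lra.
  rewrite /= !mxE eqxx normrM; case/andP: s01 => s0 s1; rewrite ger0_norm//.
  apply: le_trans (_ : `|q 0 0 + v 0 0| <= _); first by rewrite ler_piMl.
  apply: le_trans (ler_normD _ _) _.
  by have := normr_coord v 0; rewrite /d in vd *; lra.
have [M M0 HM] := smooth_bounded_pd2 clB BU sh.
have slv v : `|v| <= d -> slab (q + v).
  by move=> vd; apply: BU; rewrite -(squeeze1 (q + v)); apply: SB => //; rewrite lexx ler01.
apply: (@differentiable_quadratic R _ _ _ (9 * M)).
have : \forall v \near (0 : V), `|v| <= d by exact: nbhs0_le.
apply: filterS => v vd.
have intq := fun k g (sg : smooth slab g) => fibre_integrable k sg sq.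
have mI : measurable (`[0, 1] : set R) by [].
have intB (f g : R -> R) : mu.-integrable `[0, 1] (EFin \o f) ->
    mu.-integrable `[0, 1] (EFin \o g) -> mu.-integrable `[0, 1] (EFin \o (fun s => f s - g s)).
  by move=> F G; apply: (integrableB _ F G).
have intD (f g : R -> R) : mu.-integrable `[0, 1] (EFin \o f) ->
    mu.-integrable `[0, 1] (EFin \o g) -> mu.-integrable `[0, 1] (EFin \o (fun s => f s + g s)).
  by move=> F G; apply: (integrableD _ F G).
have intZ (c : R) (f : R -> R) : mu.-integrable `[0, 1] (EFin \o f) ->
    mu.-integrable `[0, 1] (EFin \o (fun s => c * f s)).
  by move=> F; apply: (integrableZl _ _ F).
have ig (i : 'I_3) := intq (m + (i == 0%R))%N _ (smooth_pd i sh).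
have i0 := intq m _ sh.
have iv := fibre_integrable m sh (slv _ vd).
pose rem s := h (squeeze s q + squeeze s v) - h (squeeze s q)
       - \sum_i squeeze s v 0 i * pd i h (squeeze s q).
have Erem : (fun s => s ^+ m * rem s) = fun s => s ^+ m * h (squeeze s (q + v)) - s ^+ m * h (squeeze s q)
   - (v 0 0 * (s ^+ (m + (0 == 0 :> 'I_3)) * pd 0 h (squeeze s q)) +
      v 0 1 * (s ^+ (m + (1 == 0 :> 'I_3)) * pd 1 h (squeeze s q)) +
      v 0 2%:R * (s ^+ (m + (2%:R == 0 :> 'I_3)) * pd 2%:R h (squeeze s q))).
  apply/funext => s; rewrite /rem squeezeD sum_ord3 !mxE /= addn1 addn0 exprS.
  move: (h _) (h _) (pd 0 h _) (pd 1 h _) (pd 2%:R h _) => *; ring.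
have irem : mu.-integrable `[0, 1] (EFin \o (fun s => s ^+ m * rem s)).
  by rewrite Erem; apply: (intB); [apply: (intB)|apply: (intD); [apply: (intD)|]; apply: (intZ)].
have -> : fibre_mean m h (q + v) - fibre_mean m h q
     - \sum_i v 0 i * fibre_mean (m + (i == 0)) (pd i h) q =
   \int[mu]_(s in `[0, 1]) (s ^+ m * rem s).
  rewrite [in RHS]Erem.
  rewrite RintegralB//; [|exact: (intB)|by apply: (intD); [apply: (intD)|]; apply: (intZ)].
  rewrite RintegralB// RintegralD//; [|by apply: (intD); apply: (intZ)|by apply: (intZ)].
  rewrite RintegralD//; [|by apply: (intZ)|by apply: (intZ)].
  by rewrite !RintegralZl// sum_ord3.
have H := @le_normr_Rintegral _ _ R mu `[0, 1]%classic (fun s => s ^+ m * rem s) mI irem.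
apply: (le_trans H) => {H}.
apply: le_trans (_ : \int[mu]_(s in `[0, 1]) (9 * M * `|v| ^+ 2) <= _); last first.
  by rewrite Rintegral_cst// mu01 mulr1.
apply: le_Rintegral => //.
- exact: (integrable_norm irem).
- apply: continuous_compact_integrable; first exact: segment_compact.
  by apply: continuous_subspaceT => ?; exact: cvg_cst.
- move=> s; rewrite /= in_itv /= => s01; rewrite normrM.
  apply: le_trans (_ : `|rem s| <= _).
    by apply: ler_piMl => //; case/andP: s01 => s0 s1; rewrite normrX ger0_norm// exprn_ile1.
  have lin t : squeeze s q + t *: squeeze s v = squeeze s (q + t *: v).
    by rewrite squeezeD squeezeZ.
  apply: le_trans (_ : 9 * M * `|squeeze s v| ^+ 2 <= _).
    have tv (t : R) : 0 <= t <= 1 -> `|t *: v| <= d.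
      move=> /andP[t0 t1]; apply: le_trans vd; rewrite normrZ ger0_norm //.
      by rewrite ler_piMl.
    apply: (@taylor2 R slab) => //.
    - by move=> t t01; rewrite lin; apply/BU/SB => //; exact: tv.
    - by move=> i j t t01; rewrite lin; apply/HM/SB => //; exact: tv.
  rewrite ler_wpM2l ?mulr_ge0//.
  by rewrite lerXn2r ?nnegrE// normr_squeeze.
Qed.

Lemma smooth_fibre_mean m h : smooth slab h -> smooth slab (fibre_mean m h).
Proof.
move=> sh k; elim: k m h sh => [|k IH] m h sh; split => //;
  try by move=> q sq; have [] := fibre_mean_diff m sh sq.
move=> i; apply: (lvl_ext (dif_ideal open_slab)) (IH (m + (i == 0%R))%N (pd i h) (smooth_pd i sh)).
by move=> q sq; have [_ ->] := fibre_mean_diff m sh sq.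
Qed.

(** Fundamental theorem of calculus along the segment from [squeeze 0 q] to [q]. *)
Lemma fibre_mean_pd0 h q : smooth slab h -> slab q -> h (squeeze 0 q) = 0 ->
  h q = q 0 0 * fibre_mean 0 (pd 0 h) q.
Proof.
move=> sh sq h0.
have sp := smooth_pd 0 sh.
pose F (s : R) := h (squeeze s q).
pose f (s : R) := q 0 0 * pd 0 h (squeeze s q).
have E : squeeze 0 q + (q - squeeze 0 q) = q by rewrite addrC subrK.
have lin s : squeeze s q = squeeze 0 q + s *: (q - squeeze 0 q).
  by apply/rowP => i; rewrite !mxE; case: ifP => _; ring.
have dF (s : R) : 0 <= s <= 1 -> is_derive s 1 F (f s).
  move=> s01; have ss := slab_squeeze s01 sq.
  have -> : F = (fun s => h (squeeze 0 q + s *: (q - squeeze 0 q))).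
    by apply/funext => t; rewrite /F lin.
  have dh := smooth_dif sh ss.
  have -> : f s = 'D_(q - squeeze 0 q) h (squeeze s q).
    rewrite derive_basis // sum_ord3 !mxE /= mul0r subr0 mul1r mul1r !subrr !mul0r.
    by rewrite !addr0.
  have := @is_derive_line R h (squeeze 0 q) (q - squeeze 0 q) s.
  by rewrite -lin; apply; exact: diff_derivable.
have cf (s : R) : 0 <= s <= 1 -> {for s, continuous f}.
  move=> s01.
  have c1 : {for s, continuous (fun s : R => pd 0 h (squeeze s q))}.
    apply: (@continuous_comp _ _ _ (fun s => squeeze s q) (pd 0 h)); first exact: continuous_squeeze.
    exact: smooth_continuous sp (slab_squeeze s01 sq).
  exact: (cvgM (cvg_cst _) c1).
have I0 : 0 <= (0 : R) <= 1 by rewrite lexx ler01.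
have I1 : 0 <= (1 : R) <= 1 by rewrite lexx ler01.
have cF (s : R) : 0 <= s <= 1 -> {for s, continuous F}.
  move=> s01; apply: differentiable_continuous; apply/derivable1_diffP.
  by have [] := dF _ s01.
have := @continuous_FTC2 R f F 0 1 ltr01.
have -> : F 1 = h q by rewrite /F squeeze1.
have -> : F 0 = 0 by rewrite /F h0.
rewrite sube0 => FTC.
rewrite /fibre_mean -RintegralZl //; last first.
  by apply: fibre_integrable.
rewrite /Rintegral.
rewrite (_ : (fun x : R => (q 0 0 * (x ^+ 0 * pd 0 h (squeeze x q)))%:E) = (fun x => (f x)%:E)); last first.
  by apply/funext => s; rewrite expr0 mul1r.
rewrite FTC //.
- apply: continuous_in_subspaceT => s /set_mem; rewrite /= in_itv; exact: cf.
- split.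
  + move=> s; rewrite in_itv /= => /andP[s0 s1].
    by have [] := dF s; rewrite ?ltW.
  + by apply: cvg_at_right_filter; exact: cF.
  + by apply: cvg_at_left_filter; exact: cF.
- move=> s; rewrite in_itv /= => /andP[s0 s1]; rewrite derive1E.
  by have [] := dF s; rewrite ?ltW.
Qed.

Lemma fibre_mean_0 h q : q 0 0 = 0 -> fibre_mean 0 h q = h q.
Proof.
move=> q0; rewrite /fibre_mean.
have E (s : R) : s ^+ 0 * h (squeeze s q) = h q.
  rewrite expr0 mul1r; congr h; apply/rowP; apply: ord3P; rewrite !mxE /= ?mul1r//.
  by rewrite q0 mulr0.
under eq_Rintegral => s _ do rewrite E.
by rewrite Rintegral_cst// mu01 mulr1.
Qed.

End Hadamard.

(** * Flatness and rapid decrease *)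

Section Decay.
Context {R : realType}.
Local Notation V := 'rV[R]_3.
Implicit Types (f g h : V -> R) (q v : V) (U Om : set V) (i j : 'I_3).

Definition nrm2 q : R := q 0 1 ^+ 2 + q 0 2%:R ^+ 2.
Definition wgt q : R := 1 + nrm2 q.

Lemma nrm2_ge0 q : 0 <= nrm2 q. Proof. by rewrite addr_ge0// sqr_ge0. Qed.
Lemma wgt_ge1 q : 1 <= wgt q. Proof. by rewrite lerDl nrm2_ge0. Qed.
Lemma wgt_gt0 q : 0 < wgt q. Proof. by rewrite (lt_le_trans _ (wgt_ge1 q)). Qed.
Hint Resolve nrm2_ge0 wgt_ge1 wgt_gt0 : core.

(** Differentiability is asked on an open [U], growth is measured on a smaller set [Om]: bounds are
    needed on a tube that is not open. *)
Definition moderate U Om h : Prop :=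
  dif U h /\ exists (N : nat) (C : R), forall q, Om q -> `|h q| <= C * wgt q ^+ N.

Definition rapid U Om h : Prop :=
  dif U h /\ forall N : nat, exists C : R, forall q, Om q -> `|h q| * wgt q ^+ N <= C.

Lemma rapid_moderate U Om h : rapid U Om h -> moderate U Om h.
Proof.
move=> [dh /(_ 0%N)[C HC]]; split => //; exists 0%N, C => q /HC.
by rewrite expr0 !mulr1.
Qed.

Lemma moderate_ideal U Om : open U -> Om `<=` U ->
  ideal U (moderate U Om) (moderate U Om).
Proof.
move=> oU OU; have D := dif_ideal oU; split => //.
- by move=> f [].
- by move=> f [].
- move=> f g fg [df [N [C H]]]; split; first exact: ideal_ext D _ _ fg df.
  by exists N, C => q Oq; rewrite -fg; [exact: H|exact: OU].
- move=> f g [df [N [C Hf]]] [dg [N' [C' Hg]]]; split; first exact: idealD D _ _ df dg.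
  exists (N + N')%N, (`|C| + `|C'|) => q Oq.
  have B (x : R) (n m : nat) : x * wgt q ^+ n <= `|x| * wgt q ^+ (n + m).
    apply: le_trans (_ : `|x| * wgt q ^+ n <= _).
      by rewrite ler_wpM2r ?ler_norm// exprn_ge0// ltW.
    by rewrite ler_wpM2l// ler_weXn2l// leq_addr.
  apply: le_trans (ler_normD _ _) _; rewrite mulrDl; apply: lerD.
    by apply: le_trans (Hf _ Oq) (B _ _ _).
  by rewrite addnC; apply: le_trans (Hg _ Oq) (B _ _ _).
- move=> f g [df [N [C Hf]]] [dg [N' [C' Hg]]]; split; first exact: idealM D _ _ df dg.
  exists (N + N')%N, (C * C') => q Oq.
  rewrite normrM exprD mulrACA; apply: ler_pM => //; [exact: Hf|exact: Hg].
Qed.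

Lemma rapid_ideal U Om : open U -> Om `<=` U ->
  ideal U (moderate U Om) (rapid U Om).
Proof.
move=> oU OU; have D := dif_ideal oU; split => //.
- by move=> f [].
- by move=> f [].
- move=> f g fg [df H]; split; first exact: ideal_ext D _ _ fg df.
  by move=> N; have [C HC] := H N; exists C => q Oq; rewrite -fg; [exact: HC|exact: OU].
- move=> f g [df Hf] [dg Hg]; split; first exact: idealD D _ _ df dg.
  move=> N; have [C HC] := Hf N; have [C' HC'] := Hg N; exists (C + C') => q Oq.
  apply: le_trans (lerD (HC _ Oq) (HC' _ Oq)).
  by rewrite -mulrDl ler_wpM2r ?exprn_ge0 ?ler_normD// ltW.
- move=> f g [df Hf] [dg [N' [C' Hg]]]; split; first exact: idealM D _ _ df dg.
  move=> N; have [C HC] := Hf (N + N')%N; exists (C * C') => q Oq.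
  rewrite normrM.
  apply: le_trans (_ : `|f q| * (C' * wgt q ^+ N') * wgt q ^+ N <= _).
    apply: ler_wpM2r; first by rewrite exprn_ge0// ltW.
    by apply: ler_wpM2l => //; exact: Hg.
  have C'0 : 0 <= C'.
    have := le_trans (normr_ge0 _) (Hg _ Oq); rewrite pmulr_lge0//.
    by rewrite exprn_gt0.
  rewrite mulrCA -mulrA [C * _]mulrC ler_wpM2l//.
  by apply: le_trans (HC _ Oq); rewrite exprD mulrA mulrAC.
Qed.

Lemma moderate_cst U Om (c : R) : moderate U Om (fun=> c).
Proof. by split; [exact: dif_cst|exists 0%N, `|c| => q _; rewrite expr0 mulr1]. Qed.

Lemma alv_moderate_cst U Om (c : R) : open U -> Om `<=` U -> alv (moderate U Om) (fun=> c).
Proof. by move=> oU OU; apply: (alv_cst (moderate_ideal oU OU)); exact: moderate_cst. Qed.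

Lemma alv_moderate_coord U Om j : open U -> Om `<=` U ->
  (exists C : R, forall q, Om q -> `|q 0 0| <= C) ->
  alv (moderate U Om) (fun q => q 0 j).
Proof.
move=> oU OU [C HC]; apply: (alv_coord (moderate_ideal oU OU)); first exact: moderate_cst.
split; first by move=> q _; exact: differentiable_coordinate.
have le1 (x y : R) : 0 <= y -> `|x| <= 1 + (x ^+ 2 + y).
  move=> y0; have : (`|x| - 1) ^+ 2 >= 0 by exact: sqr_ge0.
  have : x ^+ 2 = `|x| ^+ 2 by rewrite real_normK// num_real.
  by move=> -> ; move: `|x| (normr_ge0 x) => z z0 *; nra.
move: j; apply: ord3P.
- by exists 0%N, C => q /HC; rewrite expr0 mulr1.
- by exists 1%N, 1 => q _; rewrite expr1 mul1r; apply: le1; exact: sqr_ge0.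
- by exists 1%N, 1 => q _; rewrite expr1 mul1r /wgt /nrm2 [q 0 1 ^+ 2 + _]addrC; apply: le1; exact: sqr_ge0.
Qed.

Lemma alv_moderateV U Om f (c : R) : open U -> Om `<=` U -> 0 < c ->
  (forall q, U q -> f q != 0) -> (forall q, Om q -> c <= `|f q|) ->
  alv (moderate U Om) f -> alv (moderate U Om) (fun q => (f q)^-1).
Proof.
move=> oU OU c0 f0 fc H; apply: (alvV (moderate_ideal oU OU)) => //.
  exact: moderate_cst.
split.
  by move=> q Uq; apply: differentiableV; [exact: (alv0 H).1|exact: f0].
exists 0%N, c^-1 => q Oq; rewrite expr0 mulr1 normfV lef_pV2 ?posrE//; first exact: fc.
by rewrite (lt_le_trans c0)// fc.
Qed.


Lemma pd_line0 h q i : (\forall s \near (0 : R), h (s *: evec i + q) = 0) -> pd i h q = 0.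
Proof.
move=> H; rewrite /pd /derive; apply: lim_near_cst => //=.
have h0 : h q = 0 by have := nbhs_singleton H; rewrite scale0r add0r.
apply: cvg_within; apply: filterS H => s /= ->; by rewrite h0 subrr scaler0.
Qed.

Definition axis_pt q : Prop := [/\ 0 < q 0 0 < 1, q 0 1 = 0 & q 0 2%:R = 0].

(** Only transverse directions are differentiated, because information on each slice of constant
    radius, without uniformity in the radius, controls exactly these. *)
Fixpoint van k h : Prop := (forall q, axis_pt q -> h q = 0) /\
  if k is k'.+1 then forall i, i != 0 -> van k' (pd i h) else True.

Lemma van_ext k f g : (forall q, slab q -> f q = g q) -> van k f -> van k g.
Proof.
have axs q : axis_pt q -> slab q.
  by case=> /andP[q0 q1] _ _; rewrite /slab /= q1 andbT (lt_trans _ q0)// oppr_lt0.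
elim: k f g => [|k IH] f g fg [f0 H]; split=> //; try by move=> q aq; rewrite -fg; [exact: f0|exact: axs].
move=> i i0; apply: IH (H i i0) => q sq; exact: open_eq_pd open_slab fg sq.
Qed.

(** The axis runs in direction 0, so a function vanishing on it has zero radial derivative there;
    commuting partial derivatives carries this to the transverse derivatives. *)
Lemma van_pd0 k h : smooth slab h -> van k h -> van k (pd 0 h).
Proof.
have ax0 g : (forall q, axis_pt q -> g q = 0) -> forall q, axis_pt q -> pd 0 g q = 0.
  move=> g0 q [q01 q1 q2]; apply: pd_line0.
  have : \forall s \near (0 : R), 0 < s + q 0 0 < 1.
    have c : (s + q 0 0) @[s --> (0 : R)] --> q 0 0.
      by rewrite -[X in _ --> X]add0r; apply: cvgD; [exact: cvg_id|exact: cvg_cst].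
    have H1 : nbhs (q 0 0) [set x | 0 < x < 1].
      have : open (`](0 : R), (1 : R)[%classic : set R) by exact: interval_open.
      rewrite openE => /(_ (q 0 0)); rewrite /= in_itv /= => /(_ q01).
      by apply: filterS => x /=; rewrite in_itv.
    exact: (c _ H1).
  apply: filterS => s s01; apply: g0; split; rewrite !mxE /= ?mulr1 ?mulr0 ?add0r//.
elim: k h => [|k IH] h sh [h0 H]; split=> //; try exact: ax0.
move=> i i0; apply: van_ext (IH _ (smooth_pd i sh) (H i i0)) => q sq.
exact: smooth_pdC open_slab sh sq.
Qed.

Definition flat h : Prop := smooth slab h /\ forall k, van k h.

Lemma flat_pd h i : flat h -> flat (pd i h).
Proof.
move=> [sh vh]; split; first exact: smooth_pd.
case: (eqVneq i 0) => [->|i0] k; first exact: van_pd0.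
by have [_] := vh k.+1; exact.
Qed.

(** Transverse derivatives at an axis point only see the slice through it, so [r] may shrink with
    [rho]. *)
Lemma flat_of_germ h : smooth slab h ->
  (forall rho : R, 0 < rho < 1 -> exists2 r : R, 0 < r & forall q, q 0 0 = rho ->
     `|q 0 1| < r -> `|q 0 2%:R| < r -> h q = 0) -> flat h.
Proof.
move=> sh gh; split => // k.
elim: k h {sh} gh => [|k IH] h gh; split=> //;
  try by move=> q [q0 q1 q2]; have [r r0] := gh _ q0; apply => //; rewrite ?q1 ?q2 normr0.
move=> i i0; apply: IH => rho rho01; have [r r0 H] := gh _ rho01.
exists r => // q q0 q1 q2; apply: pd_line0.
have d1 : 0 < r - `|q 0 1| by rewrite subr_gt0.
have d2 : 0 < r - `|q 0 2%:R| by rewrite subr_gt0.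
have N1 := @nbhs0_lt R R^o _ d1; have N2 := @nbhs0_lt R R^o _ d2.
apply: filterS2 N1 N2 => s s1 s2.
apply: H.
- by rewrite !mxE /= eq_sym (negbTE i0) mulr0 add0r.
- rewrite !mxE /=; apply: le_lt_trans (ler_normD _ _) _; rewrite -ltrBrDr.
  apply: le_lt_trans s1; rewrite normrM; apply: ler_piMr => //.
  by case: (_ == _); rewrite ?normr1 ?normr0.
- rewrite !mxE /=; apply: le_lt_trans (ler_normD _ _) _; rewrite -ltrBrDr.
  apply: le_lt_trans s2; rewrite normrM; apply: ler_piMr => //.
  by case: (_ == _); rewrite ?normr1 ?normr0.
Qed.

Definition nrm1 q : R := `|q 0 1| + `|q 0 2%:R|.

(** Each power of [nrm1] is gained by the mean value theorem from the axis, applied to a function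
    whose transverse derivatives are flat again. The constant is uniform down to radius 0 because
    the base case uses a compact box that contains radius 0. *)
Lemma flat_bound (r1 : R) (N : nat) h : 0 < r1 < 1 -> flat h ->
  exists2 C : R, 0 <= C & forall q, 0 < q 0 0 <= r1 -> `|q 0 1| <= 1 -> `|q 0 2%:R| <= 1 ->
    `|h q| <= C * nrm1 q ^+ N.
Proof.
move=> /andP[r0 r11]; elim: N h => [|N IH] h fh.
  have [sh _] := fh.
  have KU : box (row3 0 (-1) (-1)) (row3 r1 1 1) `<=` slab.
    move=> q /(_ 0); rewrite !row3E => /andP[q0 q1].
    by rewrite /slab /= (le_lt_trans q1 r11) andbT (lt_le_trans _ q0)// oppr_lt0.
  have [M HM] := smooth_bounded (@compact_box _ _ _) KU sh.
  exists `|M| => // q /andP[q0 q0r] q1 q2; rewrite expr0 mulr1.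
  apply: le_trans (ler_norm M); apply: HM; apply: ord3P; rewrite !row3E -?ler_norml//.
  by rewrite q0r ltW.
have [C1 C10 H1] := IH _ (flat_pd 1 fh); have [C2 C20 H2] := IH _ (flat_pd 2%:R fh).
have [sh vh] := fh.
exists (C1 + C2); first exact: addr_ge0.
move=> q q0 q1 q2.
have q00 : 0 < q 0 0 by case/andP: q0.
have q0r : q 0 0 <= r1 by case/andP: q0.
(* [a] is the foot of [q] on the axis, at the same positive radius, so flatness applies there. *)
pose a : V := row3 (q 0 0) 0 0.
pose v : V := row3 0 (q 0 1) (q 0 2%:R).
have av : q = a + v by apply: row3P; rewrite !mxE /= ?addr0 ?add0r.
have ha : h a = 0.
  by have [+ _] := vh 0%N; apply; split; rewrite !row3E // q00 (le_lt_trans q0r).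
have sl (t : R) : slab (a + t *: v).
  rewrite /slab /= !mxE /= mulr0 addr0 (le_lt_trans q0r)// andbT.
  by rewrite (lt_trans _ q00)// oppr_lt0.
have [t t01|t t01] := @mvt_line R h a v.
  by apply: diff_derivable; exact: smooth_dif sh (sl t).
rewrite -av ha subr0 derive_basis; last exact: smooth_dif sh (sl t).
rewrite sum_ord3 !row3E mul0r add0r => ->.
have /andP[t0 t1] := t01.
have sc (x : R) : `|t * x| <= `|x| by rewrite normrM ger0_norm// ler_piMl.
have n1 : nrm1 (a + t *: v) <= nrm1 q.
  by rewrite /nrm1 !mxE /= !add0r lerD.
have n10 (u : V) : 0 <= nrm1 u by rewrite addr_ge0.
have P (x C : R) g : 0 <= C -> (forall q, 0 < q 0 0 <= r1 -> `|q 0 1| <= 1 -> `|q 0 2%:R| <= 1 ->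
    `|g q| <= C * nrm1 q ^+ N) -> `|x| <= nrm1 q -> `|x * g (a + t *: v)| <= C * nrm1 q ^+ N.+1.
  move=> C0 H xq; rewrite normrM exprS mulrCA; apply: ler_pM => //.
  apply: le_trans (H _ _ _ _) _; rewrite ?mxE /= ?mulr0 ?addr0 ?add0r//.
  - exact: le_trans (sc _) q1.
  - exact: le_trans (sc _) q2.
  - by rewrite ler_wpM2l// lerXn2r// nnegrE.
apply: le_trans (ler_normD _ _) _; rewrite mulrDl; apply: lerD; apply: P => //.
  by rewrite lerDl.
by rewrite lerDr.
Qed.

(** Inversion in the unit circle of each slice: the transition between the stereographic charts from
    the two poles ([sig_invert]). *)
Definition invert q : V := row3 (q 0 0) (q 0 1 / nrm2 q) (q 0 2%:R / nrm2 q).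

(** An open set containing [far r1] for [r1 < 1], on which the inversion is smooth. *)
Definition outer : set V := [set q | slab q /\ 2^-1 < nrm2 q].

Lemma smooth_nrm2 U : open U -> smooth U nrm2.
Proof. by move=> oU; apply: smoothD => //; apply: smoothX => //; exact: smooth_coord. Qed.

Lemma open_outer : open outer.
Proof.
rewrite openE => q [sq nq]; apply: filterI; first exact: (open_nbhs_nbhs (conj open_slab sq)).
have c : {for q, continuous nrm2} := smooth_continuous (smooth_nrm2 openT) I.
exact: (cvgr_gt (nrm2 q) c _ nq).
Qed.

Definition far (r1 : R) : set V := [set q : V | 0 < q 0 0 <= r1 /\ 1 <= nrm2 q].

(** The inversion has moderate derivatives of all orders and sends distant points to points close to
    the axis, where a flat function is smaller than any power of the distance. Since flatness
    survives differentiation, [alv_comp] gives all orders. *)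
Lemma flat_invert_rapid (r1 : R) h : 0 < r1 < 1 -> flat h ->
  alv (rapid outer (far r1)) (fun q => h (invert q)).
Proof.
move=> r01; set Om := far r1.
have r11 : r1 < 1 by case/andP: r01.
have OU : Om `<=` outer.
  move=> q [/andP[q0 q1] nq]; split.
    by rewrite /slab /= (le_lt_trans q1 r11) andbT (lt_trans _ q0)// oppr_lt0.
  by rewrite (lt_le_trans _ nq)// invf_lt1 // ltr1n.
have sl q : outer q -> slab (invert q).
  by move=> [sq _]; rewrite /slab /= row3E.
have MI := moderate_ideal open_outer OU.
have coordM j : alv (moderate outer Om) (fun q => q 0 j).
  apply: alv_moderate_coord => //; first exact: open_outer.
  by exists r1 => q [/andP[q0 q1] _]; rewrite gtr0_norm.
have n2M : alv (moderate outer Om) nrm2.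
  by apply: (alvD MI); apply: (alvX MI) => //; exact: moderate_cst.
have n20 q : outer q -> nrm2 q != 0.
  by move=> [_ nq]; rewrite gt_eqF// (lt_trans _ nq)// invr_gt0.
have n2V : alv (moderate outer Om) (fun q => (nrm2 q)^-1).
  apply: (alv_moderateV (c := 1)) => //; first exact: open_outer.
  by move=> q [_ nq]; rewrite ger0_norm.
have TM j : alv (moderate outer Om) (fun q => invert q 0 j).
  move: j; apply: ord3P.
  - by apply: (alv_ext MI) (coordM 0) => q _; rewrite row3E.
  - by apply: (alv_ext MI) (alvM MI (coordM 1) n2V) => q _; rewrite row3E.
  - by apply: (alv_ext MI) (alvM MI (coordM 2%:R) n2V) => q _; rewrite row3E.
have dT q j : outer q -> differentiable (fun x => invert x 0 j) q.
  by move=> Uq; have [/(_ q Uq)] := alv0 (TM j).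
move: h; apply: (alv_comp (rapid_ideal open_outer OU)) TM.
- by move=> g i; exact: flat_pd.
- by move=> g q [sg _] /sl; exact: smooth_dif.
move=> g fg; split.
  move=> q Uq; apply: differentiable_comp.
    by apply: differentiable_rV => j; exact: dT.
  by have [sg _] := fg; exact: smooth_dif sg (sl _ Uq).
(* [nrm1] has degree one and [wgt] degree two, hence [N + N]. The 4 is the product of the constants
   in [nrm1 (invert q) ^+ 2 <= 2 / nrm2 q] and [wgt q <= 2 * nrm2 q]. *)
move=> N; have [C C0 HC] := flat_bound (N + N) r01 fg.
exists (C * 4 ^+ N) => q [q0 nq].
have nq0 : 0 < nrm2 q by rewrite (lt_le_trans _ nq).
have le1 (x y : R) : x ^+ 2 + y ^+ 2 = nrm2 q -> `|x / nrm2 q| <= 1.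
  move=> E; rewrite -(@ler_pXn2r _ 2)// ?nnegrE// expr1n real_normK ?num_real//.
  rewrite exprMn exprVn ler_pdivrMr ?exprn_gt0// mul1r.
  apply: le_trans (_ : nrm2 q <= _); first by rewrite -E lerDl sqr_ge0.
  by rewrite expr2 ler_peMl// ltW.
have B1 := le1 _ _ (erefl (nrm2 q)).
have B2 := le1 (q 0 2%:R) (q 0 1).
rewrite addrC in B2; have {}B2 := B2 erefl.
have := HC (invert q); rewrite !row3E => /(_ q0 B1 B2) H.
apply: le_trans (ler_wpM2r _ H) _; first by rewrite exprn_ge0// ltW.
rewrite -mulrA; apply: ler_wpM2l => //.
rewrite addnn -mul2n exprM -exprMn.
have n1 : nrm1 (invert q) ^+ 2 <= 2 / nrm2 q.
  rewrite /nrm1 !row3E !normrM (ger0_norm (x := (nrm2 q)^-1)) ?invr_ge0//.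
  rewrite -mulrDl exprMn expr2 [(nrm2 q)^-1 ^+ 2]expr2 mulrA ler_wpM2r ?invr_ge0//.
  rewrite ler_pdivrMr//.
  have : (`|q 0 1| - `|q 0 2%:R|) ^+ 2 >= 0 by exact: sqr_ge0.
  have : nrm2 q = `|q 0 1| ^+ 2 + `|q 0 2%:R| ^+ 2 by rewrite !real_normK ?num_real.
  by move=> ->; move: `|q 0 1| `|q 0 2%:R| => x y; nra.
have n2 : wgt q <= 2 * nrm2 q by rewrite /wgt; lra.
have w0 : 0 <= wgt q by rewrite ltW.
have N0 : 0 <= nrm1 (invert q) by rewrite addr_ge0.
apply: lerXn2r; rewrite ?nnegrE ?mulr_ge0 ?sqr_ge0//.
have -> : 4 = (2 / nrm2 q) * (2 * nrm2 q) by field; rewrite gt_eqF.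
by apply: ler_pM => //; rewrite sqr_ge0.
Qed.

(** Decay is measured on [tube], at positive radii; [ctube] adds radius 0 and supplies
    compactness. *)
Definition tube (r1 : R) : set V := [set q | 0 < q 0 0 <= r1].
Definition ctube (r1 : R) : set V := [set q | 0 <= q 0 0 <= r1].

Lemma tube_sub (r1 : R) : tube r1 `<=` ctube r1.
Proof. by move=> q /andP[q0 q1]; rewrite /ctube /= q1 ltW. Qed.

Lemma ctube_bounded U (r1 M : R) h : ctube r1 `<=` U -> smooth U h ->
  exists C : R, forall q, ctube r1 q -> nrm2 q <= M -> `|h q| <= C.
Proof.
(* Comes from [|x| <= 1 + x ^+ 2]. *)
move=> cU sh; pose L := 1 + M.
have bU : box (row3 0 (- L) (- L)) (row3 r1 L L) `<=` U.
  by move=> q /(_ 0); rewrite !row3E => H; exact: cU.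
have [C HC] := @smooth_bounded R U (box (row3 0 (- L) (- L)) (row3 r1 L L)) h (@compact_box _ _ _)
  bU sh.
exists C => q q0 nM; apply: HC.
have le1 (x y : R) : x ^+ 2 + y ^+ 2 <= M -> `|x| <= L.
  move=> H; have : (`|x| - 1) ^+ 2 >= 0 by exact: sqr_ge0.
  have := sqr_ge0 y; have : x ^+ 2 = `|x| ^+ 2 by rewrite real_normK// num_real.
  rewrite /L; move: H; move: (x ^+ 2) (y ^+ 2) `|x| (normr_ge0 x) => x2 y2 z z0 *; nra.
apply: ord3P; rewrite !row3E // -ler_norml.
  exact: le1 nM.
by apply: (le1 _ (q 0 1)); rewrite addrC.
Qed.

(** Where [nrm2 q <= 1] every derivative is bounded by compactness, so decay matters only far
    out. *)
Lemma rapid_glue (r1 : R) h : 0 < r1 < 1 -> smooth slab h ->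
  alv (rapid outer (far r1)) h ->
  alv (rapid slab (tube r1)) h.
Proof.
move=> /andP[r0 r11] sh rh k.
have cU : ctube r1 `<=` slab.
  move=> q /andP[q0 q1]; rewrite /slab /= (le_lt_trans q1 r11) andbT.
  by rewrite (lt_le_trans _ q0)// oppr_lt0.
have B g : smooth slab g -> rapid outer (far r1) g ->
    rapid slab (tube r1) g.
  move=> sg [_ Hg]; split; first by move=> q sq; exact: smooth_dif sg sq.
  move=> N; have [C HC] := Hg N.
  have sgw : smooth slab (fun q => g q * wgt q ^+ N).
    apply: smoothM => //; first exact: open_slab.
    apply: smoothX; first exact: open_slab.
    apply: smoothD; [exact: open_slab|exact: smooth_cst open_slab 1|exact: smooth_nrm2 open_slab].
  have [C' HC'] := ctube_bounded 1 cU sgw.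
  exists (`|C| + `|C'|) => q tq.
  have [n1|n1] := leP 1 (nrm2 q).
    by apply: le_trans (HC q _) _ => //; rewrite (le_trans (ler_norm C))// lerDl.
  have := HC' q (tube_sub tq) (ltW n1).
  rewrite normrM (ger0_norm (x := wgt q ^+ N)); last by rewrite exprn_ge0// ltW.
  move=> /le_trans; apply.
  by rewrite (le_trans (ler_norm C'))// lerDr.
elim: k h sh rh => [|k IH] h sh rh; split => //; try by apply: B => //; exact: alv0.
by move=> i; apply: IH; [exact: smooth_pd|exact: alv_pd].
Qed.

Lemma lower_bound U (r1 c0 : R) f : open U -> ctube r1 `<=` U -> smooth U f -> 0 < c0 ->
  (forall q, ctube r1 q -> f q != 0) -> rapid U (tube r1) (fun q => f q - c0) ->
  exists2 c : R, 0 < c & forall q, tube r1 q -> c <= `|f q|.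
Proof.
move=> oU cU sf c00 f0 [_ /(_ 1%N)[C HC]].
pose U' := U `&` [set q | f q != 0].
have oU' : open U'.
  rewrite openE => q [Uq fq].
  have := smooth_continuous sf Uq; move=> cf.
  apply: filterI; first exact: open_nbhs_nbhs.
  exact: (cvgr_neq0 (f q) cf fq).
have sV : smooth U' (fun q => (f q)^-1).
  by apply: smoothV => //; [move=> q []|apply: smooth_sub sf => q []].
have cU' : ctube r1 `<=` U' by move=> q cq; split; [exact: cU|exact: f0].
have [K HK] := ctube_bounded (2 * C / c0) cU' sV.
have cm : 0 < Num.min (c0 / 2) (`|K| + 1)^-1.
  by rewrite lt_min divr_gt0//= invr_gt0 ltr_wpDl.
exists (Num.min (c0 / 2) (`|K| + 1)^-1) => // q tq.
rewrite ge_min; apply/orP.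
have [n1|n1] := leP (nrm2 q) (2 * C / c0); [right|left].
  have := HK q (tube_sub tq) n1; rewrite normfV => H.
  have fq0 : 0 < `|f q| by rewrite normr_gt0 f0//; exact: tube_sub.
  rewrite -[leRHS]invrK lef_pV2 ?posrE ?invr_gt0//; try by rewrite ltr_wpDl.
  by apply: le_trans H _; rewrite (le_trans (ler_norm K))// lerDl.
have := HC _ tq; rewrite expr1 => H.
have D : `|f q - c0| <= c0 / 2.
  have w0 := wgt_gt0 q.
  rewrite -(ler_pM2r w0); apply: le_trans H _.
  rewrite ltr_pdivrMr// in n1.
  by rewrite /wgt; move: (nrm2 q) n1 => n n1; nra.
have := ler_normB (f q) (f q - c0); rewrite opprB addrC subrK (gtr0_norm c00).
by move: `|f q| `|f q - c0| D => x y; lra.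
Qed.

End Decay.

(** * The sphere and fibred diffeomorphisms of the ball *)

Section SmoothOn.
Context {R : realType}.
Local Notation V := 'rV[R]_3.
Implicit Types (q v : V) (U A : set V).

Lemma rV_continuous (c : V -> V) q : (forall j, {for q, continuous (fun x => c x 0 j)}) ->
  {for q, continuous c}.
Proof.
move=> H.
have -> : c = (fun x => \sum_j c x 0 j *: evec j) by apply/funext => x; exact: row_evecE.
apply: (@cvg_big V 'I_3 +%R 0 xpredT (@add_continuous _) V (nbhs q) (index_enum _)
  (fun j x => c x 0 j *: evec j) (fun j => c q 0 j *: evec j)) => j _.
by apply: cvgZr_tmp; exact: H.
Qed.

(** Passes from smoothness by local extensions on an arbitrary set, such as the sphere or the closed
    ball, to [smooth] on an open set of parameters. *)
Lemma smooth_on_comp A U (f c : V -> V) j : open U -> smooth_on A f ->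
  (forall q, U q -> A (c q)) -> (forall i, smooth U (fun q => c q 0 i)) ->
  smooth U (fun q => f (c q) 0 j).
Proof.
move=> oU sf cA sc; apply: smooth_local => q Uq.
have [G [U' [oU' U'q sG GE]]] := sf _ (cA _ Uq).
have cc : {for q, continuous c} by apply: rV_continuous => i; exact: smooth_continuous (sc i) Uq.
have nW : nbhs q (U `&` c @^-1` U').
  by apply: filterI; [exact: open_nbhs_nbhs|exact: (cc _ (open_nbhs_nbhs (conj oU' U'q)))].
have oW : open ((U `&` c @^-1` U')°) := open_interior _.
exists ((U `&` c @^-1` U')°) => //.
have subW x : (U `&` c @^-1` U')° x -> U x /\ U' (c x) by move=> /interior_subset[].
apply: (smooth_ext_open oW (f := fun x => G (c x) 0 j)).
  by move=> x /subW[Ux U'x]; rewrite GE//; exact: cA.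
apply: (smooth_comp oW (U' := U') (h := fun x => G x 0 j)).
- by move=> x /subW[].
- by move=> i; apply: smooth_sub (sc i) => x /subW[].
- exact: smooth_open_smooth.
Qed.

Lemma derive_line0 (h : V -> R) q v :
  (\forall s \near (0 : R), h (s *: v + q) = 0) -> 'D_v h q = 0.
Proof.
move=> H; rewrite /derive; apply: lim_near_cst => //=.
have h0 : h q = 0 by have := nbhs_singleton H; rewrite scale0r add0r.
apply: cvg_within; apply: filterS H => s /= ->; by rewrite h0 subrr scaler0.
Qed.

End SmoothOn.

(** * The unit sphere and its two stereographic parametrisations *)

Section SphereFacts.
Context {R : realType}.
Local Notation V := 'rV[R]_3.
Implicit Types (p u v q : V).

Lemma dotE u v : dot u v = u 0 0 * v 0 0 + u 0 1 * v 0 1 + u 0 2%:R * v 0 2%:R.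
Proof. by rewrite /dot sum_ord3. Qed.

Lemma dotvv_ge0 v : 0 <= dot v v.
Proof. by rewrite dotE !addr_ge0// -expr2 sqr_ge0. Qed.

Lemma dotZ (a : R) u v : dot (a *: u) v = a * dot u v.
Proof. by rewrite !dotE !mxE; ring. Qed.

Lemma dotC u v : dot u v = dot v u.
Proof. by rewrite !dotE; ring. Qed.

Lemma dotDl u v w : dot (u + v) w = dot u w + dot v w.
Proof. by rewrite !dotE !mxE; ring. Qed.

Lemma sphereP p : sphere p <-> dot p p = 1.
Proof.
rewrite /sphere /enorm /=; split => [H|->]; last by rewrite sqrtr1.
by rewrite -[LHS]sqr_sqrtr ?dotvv_ge0// H expr1n.
Qed.

Lemma enormZ (a : R) v : enorm (a *: v) = `|a| * enorm v.
Proof. by rewrite /enorm dotZ dotC dotZ mulrA -expr2 sqrtrM ?sqr_ge0// sqrtr_sqr. Qed.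

Lemma cball_scale (a : R) p : sphere p -> `|a| <= 1 -> cball (a *: p).
Proof. by move=> sp a1; rewrite /cball /= enormZ sp mulr1. Qed.

Lemma sphereN p : sphere p -> sphere (- p).
Proof. by move=> /sphereP H; apply/sphereP; rewrite -H !dotE !mxE !mulrNN. Qed.

Lemma north_sphere : sphere (north : V).
Proof. by apply/sphereP; rewrite dotE !row3E !mul0r !add0r mulr1. Qed.

Lemma smooth_dot (U : set V) : open U -> smooth U (fun v => dot v v).
Proof.
move=> oU.
have -> : (fun v : V => dot v v) = (fun v => v 0 0 * v 0 0 + v 0 1 * v 0 1 + v 0 2%:R * v 0 2%:R).
  by apply/funext => v; rewrite dotE.
by apply: smoothD => //; [apply: smoothD => //|]; apply: smoothM => //; exact: smooth_coord.
Qed.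

Lemma oballP v : oball v <-> dot v v < 1.
Proof.
rewrite /oball /enorm /= -[X in _ < X]sqrtr1; split => H; last by rewrite ltr_sqrt.
by rewrite -ltr_sqrt.
Qed.

Lemma open_oball : open (oball : set V).
Proof.
rewrite openE => v /oballP vv.
have c : {for v, continuous (fun v => dot v v)} := smooth_continuous (smooth_dot openT) I.
have H : \forall x \near v, dot x x < 1 by exact: (cvgr_lt (dot v v) c _ vv).
by apply: filterS H => x /oballP.
Qed.

Lemma oball_sub_cball : (oball : set V) `<=` cball.
Proof. by move=> v; rewrite /oball /cball /= => /ltW. Qed.

Definition sig q : V := stereo_inv (q 0 1) (q 0 2%:R).

(* The stereographic parametrisation from the south pole: it sends the axis [q 0 1 = q 0 2 = 0] to [north]. *)
Definition tau q : V :=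
  row3 (q 0 1 *+ 2 / wgt q) (q 0 2%:R *+ 2 / wgt q) ((1 - nrm2 q) / wgt q).

Lemma wgt_neq0 q : wgt q != 0. Proof. by rewrite gt_eqF// wgt_gt0. Qed.

Lemma sigE q : sig q = row3 (q 0 1 *+ 2 / wgt q) (q 0 2%:R *+ 2 / wgt q) ((nrm2 q - 1) / wgt q).
Proof. by rewrite /sig /stereo_inv /wgt -/(nrm2 q) addrC. Qed.

Lemma sig_sphere q : sphere (sig q).
Proof.
apply/sphereP; rewrite dotE sigE !row3E.
have := wgt_neq0 q; rewrite /wgt /nrm2 => w0; field; exact: w0.
Qed.

Lemma tau_sphere q : sphere (tau q).
Proof.
apply/sphereP; rewrite dotE /tau !row3E.
have := wgt_neq0 q; rewrite /wgt /nrm2 => w0; field; exact: w0.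
Qed.

Lemma sig_third q : 1 - sig q 0 2%:R = 2 / wgt q.
Proof. by rewrite sigE row3E /wgt; field; have := wgt_neq0 q; rewrite /wgt. Qed.

Lemma sig_neq_north q : sig q <> north.
Proof.
move=> H; have := sig_third q; rewrite H !row3E subrr => /esym/eqP.
by rewrite mulf_eq0 invr_eq0 (negbTE (wgt_neq0 q)) orbF pnatr_eq0.
Qed.

Lemma stereo_sig q : stereo (sig q) = (q 0 1, q 0 2%:R).
Proof.
rewrite /stereo sig_third sigE !row3E; have w0 := wgt_neq0 q.
by congr pair; field.
Qed.

Lemma sphere_north p : sphere p -> p 0 2%:R = 1 -> p = north.
Proof.
move=> /sphereP; rewrite dotE => H p2; rewrite p2 mulr1 in H.
have {}H : p 0 0 ^+ 2 + p 0 1 ^+ 2 = 0 by move: H; rewrite !expr2 => ?; lra.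
have := sqr_ge0 (p 0 0); have := sqr_ge0 (p 0 1) => h1 h0.
have e0 : p 0 0 ^+ 2 = 0 by lra.
have e1 : p 0 1 ^+ 2 = 0 by lra.
apply: row3P; rewrite !row3E //; apply/eqP; rewrite -sqrf_eq0; exact/eqP.
Qed.

Lemma stereo_invK p : sphere p -> p <> north ->
  stereo_inv (stereo p).1 (stereo p).2 = p.
Proof.
move=> sp pn; have d0 : 1 - p 0 2%:R != 0.
  by rewrite subr_eq0; apply/eqP => /esym /(sphere_north sp).
have /sphereP := sp; rewrite dotE => H.
pose a := p 0 0; pose b := p 0 1; pose c := p 0 2%:R.
have E : (a / (1 - c)) ^+ 2 + (b / (1 - c)) ^+ 2 = (1 + c) / (1 - c).
  have -> : (1 + c) / (1 - c) = (1 - c * c) / (1 - c) ^+ 2 by field.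
  have -> : 1 - c * c = a * a + b * b by rewrite -H /a /b /c; ring.
  by field.
rewrite /stereo /stereo_inv /= -/a -/b -/c E.
have s2 : (1 + c) / (1 - c) + 1 = 2 / (1 - c) by field.
rewrite s2.
apply: row3P; rewrite !row3E -/a -/b -/c; by field.
Qed.

Lemma sig_invert q : nrm2 q != 0 -> sig q = tau (invert q).
Proof.
move=> n0; rewrite sigE /tau /invert.
have w0 := wgt_neq0 q.
have nE : nrm2 (row3 (q 0 0) (q 0 1 / nrm2 q) (q 0 2%:R / nrm2 q)) = (nrm2 q)^-1.
  rewrite {1}/nrm2 !row3E; move: n0; rewrite /nrm2 => n0; by field.
rewrite /wgt nE; rewrite /wgt in w0.
apply: row3P; rewrite !row3E; move: (nrm2 q) n0 w0 (q 0 1) (q 0 2%:R) => n n0 w0 x y; field.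
all: by rewrite n0 addrC.
Qed.

Lemma tau_axis q : q 0 1 = 0 -> q 0 2%:R = 0 -> tau q = north.
Proof.
move=> q1 q2; rewrite /tau /wgt /nrm2 q1 q2 expr0n /= addr0 subr0 addr0 mul0rn !mul0r divr1.
by [].
Qed.

Lemma smooth_wgt (U : set V) : open U -> smooth U wgt.
Proof. by move=> oU; apply: smoothD => //; [exact: smooth_cst|exact: smooth_nrm2]. Qed.

Lemma smooth_sig (U : set V) j : open U -> smooth U (fun q => sig q 0 j).
Proof.
move=> oU; have sV : smooth U (fun q => (wgt q)^-1).
  by apply: smoothV => //; [move=> q _; exact: wgt_neq0|exact: smooth_wgt].
have sc i : smooth U (fun q => q 0 i *+ 2).
  have -> : (fun q : V => q 0 i *+ 2) = (fun q => q 0 i + q 0 i) by apply/funext => q; rewrite mulr2n.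
  by apply: smoothD => //; exact: smooth_coord.
move: j; apply: ord3P.
- apply: (smooth_ext_open oU _ (smoothM oU (sc 1) sV)) => q _; by rewrite sigE row3E.
- apply: (smooth_ext_open oU _ (smoothM oU (sc 2%:R) sV)) => q _; by rewrite sigE row3E.
- apply: (smooth_ext_open oU _ (smoothM oU (smoothB oU (smooth_nrm2 oU) (smooth_cst oU 1)) sV)) => q _.
  by rewrite sigE row3E.
Qed.

Lemma smooth_tau (U : set V) j : open U -> smooth U (fun q => tau q 0 j).
Proof.
move=> oU; move: j; apply: ord3P.
- by apply: (smooth_ext_open oU _ (smooth_sig 0 oU)) => q _; rewrite sigE !row3E.
- by apply: (smooth_ext_open oU _ (smooth_sig 1 oU)) => q _; rewrite sigE !row3E.
- apply: (smooth_ext_open oU _ (smoothN oU (smooth_sig 2%:R oU))) => q _.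
  by rewrite sigE !row3E -mulNr opprB.
Qed.

End SphereFacts.

(** * Rescaled maps up to radius 0 and their behaviour at infinity *)

Section FibredDiffeo.
Context {R : realType}.
Local Notation V := 'rV[R]_3.
Implicit Types (p u v q s : V).
Variables (psi psi' g : V -> V).
Hypothesis hpsi : diffeo_pair sphere psi psi'.

Lemma psi_sphere p : sphere p -> sphere (psi p).
Proof. by case: hpsi => _ [H _] _ _; exact: H. Qed.

Lemma psi'_sphere p : sphere p -> sphere (psi' p).
Proof. by case: hpsi => _ [_ H] _ _; exact: H. Qed.

Lemma psiK p : sphere p -> psi' (psi p) = p.
Proof. by case: hpsi => _ _ H _; exact: H. Qed.

Lemma psi'K p : sphere p -> psi (psi' p) = p.
Proof. by case: hpsi => _ _ _ H; exact: H. Qed.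

Lemma infty_sphere : sphere (infty psi).
Proof. exact/psi_sphere/north_sphere. Qed.

(** [psi] is controlled only along the sphere, through its local extensions, whence the condition
    [sphere s]. *)
Lemma psi_nbhs p (B : set V) : sphere p -> nbhs (psi p) B ->
  \forall s \near p, sphere s -> B (psi s).
Proof.
move=> sp nB; have [[sm _] _ _ _] := hpsi.
have [G [U [oU Up sG GE]]] := sm p sp.
have cG : {for p, continuous G}.
  by apply: rV_continuous => j; exact: smooth_continuous (smooth_open_smooth oU sG j) Up.
have nU : nbhs p U by exact: open_nbhs_nbhs.
rewrite -(GE p sp Up) in nB.
have nG : nbhs p (G @^-1` B) := cG _ nB.
by apply: filterS2 nU nG => s Us Bs ss; rewrite -GE.
Qed.

Variable b : R -> V -> V.
Hypothesis gsmooth : smooth_on cball g.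
Hypothesis bci : forall rho : R, 0 <= rho <= 1 -> Diff_ci psi (b rho).
Hypothesis gb : forall (rho : R) p, 0 <= rho <= 1 -> sphere p ->
  g (rho *: p) = rho *: b rho p.

Lemma b_sphere (rho : R) p : 0 <= rho <= 1 -> sphere p -> sphere (b rho p).
Proof. by move=> /bci[[[f' [_ [H _] _ _]] _] _]; exact: H. Qed.

Lemma b_inj (rho : R) p q : 0 <= rho <= 1 -> sphere p -> sphere q ->
  b rho p = b rho q -> p = q.
Proof.
by move=> /bci[[[f' [_ _ H _]] _] _] sp sq e; rewrite -(H p sp) e H.
Qed.

Lemma b_surj (rho : R) p : 0 <= rho <= 1 -> sphere p ->
  exists2 p0, sphere p0 & b rho p0 = p.
Proof. by move=> /bci[[[f' [_ [_ H] _ K]] _] _] sp; exists (f' p); [exact: H|exact: K]. Qed.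

Lemma b_near (rho : R) : 0 <= rho <= 1 ->
  \forall p \near infty psi, sphere p -> b rho p = p.
Proof.
move=> /bci[_ /existsNP[B /not_implyP[nB H]]].
apply: filterS nB => p Bp sp; apply: contrapT => bp; apply: H.
by exists p.
Qed.

Lemma b_infty (rho : R) : 0 <= rho <= 1 -> b rho (infty psi) = infty psi.
Proof. by move=> /b_near /nbhs_singleton; apply; exact: infty_sphere. Qed.

Lemma g_0 : g 0 = 0.
Proof.
have := gb (rho := 0) (p := north) _ north_sphere.
by rewrite !scale0r; apply; rewrite lexx ler01.
Qed.

Definition gdev j v : R := g v 0 j - v 0 j.

Lemma smooth_gdev j : smooth oball (gdev j).
Proof.
apply: smoothB; [exact: open_oball| |exact: smooth_coord open_oball j].
apply: (smooth_on_comp (A := cball) (c := id)) => //; first exact: open_oball.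
  exact: oball_sub_cball.
by move=> i; exact: smooth_coord open_oball i.
Qed.

Lemma oball_scale (rho : R) p : `|rho| < 1 -> sphere p -> oball (rho *: p).
Proof. by move=> r1 sp; rewrite /oball /= enormZ sp mulr1. Qed.

(** For [v] tangent at [infty psi] and [m = dot v v], this is the rational parametrisation, by
    [q 0 0], of the great circle leaving [infty psi] with velocity [2 *: v]. It probes tangent
    directions without leaving the sphere, and is a function on [V] so that the calculus above
    applies. *)
Definition circ (m : R) (v : V) (q : V) : V := \row_i
  (((1 - m * q 0 0 ^+ 2) * infty psi 0 i + 2 * q 0 0 * v 0 i) * (1 + m * q 0 0 ^+ 2)^-1).

Lemma circ_den (m : R) q : 0 <= m -> 1 + m * q 0 0 ^+ 2 != 0 :> R.
Proof. by move=> m0; rewrite gt_eqF// ltr_pwDl// mulr_ge0// sqr_ge0. Qed.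

Lemma circ_sphere v q : dot v (infty psi) = 0 -> sphere (circ (dot v v) v q).
Proof.
move=> v0; have d0 := circ_den q (dotvv_ge0 v); apply/sphereP.
have /sphereP i1 := infty_sphere; move: v0 i1 d0; rewrite !dotE !mxE.
move: (infty psi 0 0) (infty psi 0 1) (infty psi 0 2%:R) => a b' c.
move: (v 0 0) (v 0 1) (v 0 2%:R) (q 0 0) => x y z t v0 i1.
set m := (x * x + y * y + z * z) => d0.
have -> : ((1 - m * t ^+ 2) * a + 2 * t * x) / (1 + m * t ^+ 2) *
  (((1 - m * t ^+ 2) * a + 2 * t * x) / (1 + m * t ^+ 2)) +
  ((1 - m * t ^+ 2) * b' + 2 * t * y) / (1 + m * t ^+ 2) *
  (((1 - m * t ^+ 2) * b' + 2 * t * y) / (1 + m * t ^+ 2)) +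
  ((1 - m * t ^+ 2) * c + 2 * t * z) / (1 + m * t ^+ 2) *
  (((1 - m * t ^+ 2) * c + 2 * t * z) / (1 + m * t ^+ 2)) =
  ((1 - m * t ^+ 2) ^+ 2 * (a * a + b' * b' + c * c) + 4 * t * (1 - m * t ^+ 2) * (x * a + y * b' + z * c)
    + 4 * t ^+ 2 * m) / (1 + m * t ^+ 2) ^+ 2.
  by rewrite /m; field; exact: d0.
by rewrite i1 v0; field; exact: d0.
Qed.

Lemma smooth_circ (m : R) v j : 0 <= m -> smooth setT (fun q => circ m v q 0 j).
Proof.
move=> m0; have oT : open (setT : set V) := openT.
have sq2 : smooth setT (fun q : V => m * q 0 0 ^+ 2).
  by apply: smoothM => //; [exact: smooth_cst|apply: smoothX => //; exact: smooth_coord].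
have sN : smooth setT (fun q : V => (1 - m * q 0 0 ^+ 2) * infty psi 0 j + 2 * q 0 0 * v 0 j).
  apply: smoothD => //; apply: smoothM => //; try exact: smooth_cst.
    by apply: smoothB => //; exact: smooth_cst.
  by apply: smoothM => //; [exact: smooth_cst|exact: smooth_coord].
have sD : smooth setT (fun q : V => (1 + m * q 0 0 ^+ 2)^-1).
  apply: smoothV => //; first by move=> q _; exact: circ_den.
  by apply: smoothD => //; exact: smooth_cst.
by apply: (smooth_ext_open oT _ (smoothM oT sN sD)) => q _; rewrite mxE.
Qed.

Lemma circ0 (m : R) v : circ m v 0 = infty psi.
Proof. by apply/rowP => i; rewrite !mxE expr0n /= !mulr0 mul0r addr0 subr0 addr0 invr1 mulr1 mul1r. Qed.

Lemma pd_circ (m : R) v j : 0 <= m -> pd 0 (fun q => circ m v q 0 j) 0 = 2 * v 0 j.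
Proof.
move=> m0.
have [_ /(_ 0) ->] // : differentiable (fun q => circ m v q 0 j) 0 /\
  forall i, pd i (fun q => circ m v q 0 j) 0 = (if i == 0 then 2 * v 0 j else 0).
(* With [t = w 0 0], [a = infty psi 0 j] and [x = v 0 j], the remainder is exactly
   [- 2 m (a + t x) t^2 / (1 + m t^2)], and [|t| <= 1] near 0. *)
apply: (@differentiable_quadratic R _ _ _ (2 * m * (`|infty psi 0 j| + `|v 0 j|))).
have : \forall w \near (0 : V), `|w| <= 1 by apply: nbhs0_le.
apply: filterS => w w1; rewrite sum_ord3 /= !mulr0 !addr0 circ0 add0r mxE.
have t1 := normr_coord w 0; have d0 := circ_den w m0.
have dd : 1 <= 1 + m * w 0 0 ^+ 2 by rewrite lerDl mulr_ge0// sqr_ge0.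
set t := w 0 0 in t1 d0 dd *; set a := infty psi 0 j; set x := v 0 j.
have -> : ((1 - m * t ^+ 2) * a + 2 * t * x) / (1 + m * t ^+ 2) - a - t * (2 * x) =
   - (2 * m * (a + t * x) * t ^+ 2 / (1 + m * t ^+ 2)).
  by field.
rewrite normrN normrM normfV (ger0_norm (x := 1 + _)) ?(le_trans ler01)//.
apply: le_trans (_ : `|2 * m * (a + t * x) * t ^+ 2| <= _).
  by rewrite ler_pdivrMr ?(lt_le_trans ltr01)// ler_peMr.
rewrite !normrM ger0_norm// (ger0_norm m0).
apply: ler_pM; rewrite ?mulr_ge0//.
  rewrite ler_wpM2l ?mulr_ge0// (le_trans (ler_normD _ _))// lerD2l normrM.
  by rewrite ler_piMl// (le_trans t1).
by rewrite expr2; apply: ler_pM.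
Qed.

(** Radially, every [b rho] fixes [infty psi]; tangentially, [b rho] is the identity near
    [infty psi] on the sphere. These directions span the space. *)
Lemma gdev_infty (rho : R) j : 0 < rho < 1 -> forall v, 'D_v (gdev j) (rho *: infty psi) = 0.
Proof.
move=> /andP[r0 r1].
have rho01 : 0 <= rho <= 1 by rewrite !ltW.
have ob : oball (rho *: infty psi).
  by apply: oball_scale infty_sphere; rewrite gtr0_norm.
have df := smooth_dif (smooth_gdev j) ob.
have radial : 'D_(infty psi) (gdev j) (rho *: infty psi) = 0.
  apply: derive_line0.
  have : \forall s \near (0 : R), 0 < s + rho < 1.
    have c : (s + rho) @[s --> (0 : R)] --> rho.
      by rewrite -[X in _ --> X]add0r; apply: cvgD; [exact: cvg_id|exact: cvg_cst].
    have H1 : nbhs rho [set x | 0 < x < 1].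
      have : open (`](0 : R), (1 : R)[%classic : set R) by exact: interval_open.
      rewrite openE => /(_ rho); rewrite /= in_itv /= r0 r1 => /(_ isT).
      by apply: filterS => x /=; rewrite in_itv.
    exact: (c _ H1).
  apply: filterS => s /andP[s0 s1]; rewrite -scalerDl /gdev.
  have s01 : 0 <= s + rho <= 1 by rewrite !ltW.
  by rewrite gb ?b_infty ?subrr//; exact: infty_sphere.
have tangent v : dot v (infty psi) = 0 -> 'D_v (gdev j) (rho *: infty psi) = 0.
  move=> v0; have m0 := dotvv_ge0 v.
  pose F q := rho *: circ (dot v v) v q.
  have dF i : differentiable (fun q => F q 0 i) 0.
    have -> : (fun q => F q 0 i) = (fun q => rho * circ (dot v v) v q 0 i).
      by apply/funext => q; rewrite /F mxE.
    by apply: differentiableM => //; exact: smooth_dif (smooth_circ v i m0) I.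
  have F0 : F 0 = rho *: infty psi by rewrite /F circ0.
  have pF i : pd 0 (fun q => F q 0 i) 0 = rho * (2 * v 0 i).
    have -> : (fun q => F q 0 i) = (fun q => (fun=> rho) q * circ (dot v v) v q 0 i).
      by apply/funext => q; rewrite /F mxE.
    rewrite pdM//; last exact: smooth_dif (smooth_circ v i m0) I.
    by rewrite pd_cst mulr0 addr0 pd_circ.
  have : pd 0 (fun q => gdev j (F q)) 0 = 0.
    rewrite (near_eq_pd (g := fun=> 0)) ?pd_cst//.
    have cc : {for 0, continuous (circ (dot v v) v)}.
      by apply: rV_continuous => i; exact: smooth_continuous (smooth_circ v i m0) I.
    have nb := b_near rho01; rewrite -(circ0 (dot v v) v) in nb.
    have : \forall q \near (0 : V), sphere (circ (dot v v) v q) ->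
       b rho (circ (dot v v) v q) = circ (dot v v) v q := cc _ nb.
    apply: filterS => q H; rewrite /gdev /F gb ?H ?subrr//; exact: circ_sphere.
  rewrite pd_comp//; last by rewrite F0.
  rewrite F0 (eq_bigr (fun i => (rho * 2) * (v 0 i * pd i (gdev j) (rho *: infty psi)))).
    rewrite -mulr_sumr -derive_basis// => /eqP; rewrite mulf_eq0 mulf_eq0 pnatr_eq0 orbF.
    by rewrite (gt_eqF r0) /= => /eqP.
  by move=> i _; rewrite pF; ring.
move=> v; pose a := dot v (infty psi).
have -> : v = a *: infty psi + (v - a *: infty psi) by rewrite addrC subrK.
have /sphereP i1 := infty_sphere.
have := tangent (v - a *: infty psi).
rewrite dotDl -scaleNr dotZ i1 mulr1 subrr => /(_ erefl).
move: radial; rewrite !deriveE// => r t.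
by rewrite linearD [X in _ + X]t addr0 linearZ /= r scaler0.
Qed.

(** The derivatives of [gdev j] are continuous and vanish along the ray through infinity, hence at
    its endpoint. So [g] is tangent to the identity at the origin. *)
Lemma gdev_0 i j : pd i (gdev j) 0 = 0.
Proof.
have ob0 : oball (0 : V) by rewrite -(scale0r (infty psi)); apply: oball_scale infty_sphere; rewrite normr0.
have c : {for 0, continuous (pd i (gdev j))} := smooth_continuous (smooth_pd i (smooth_gdev j)) ob0.
have c2 : (rho *: infty psi) @[rho --> (0 : R)^'+] --> (0 : V).
  rewrite -(scale0r (infty psi)); apply: cvg_at_right_filter.
  by apply: cvgZr_tmp; exact: cvg_id.
have c3 : pd i (gdev j) (rho *: infty psi) @[rho --> (0 : R)^'+] --> pd i (gdev j) 0.
  exact: (cvg_comp _ _ c2 c).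
apply: (@cvg_unique R _ _ _ _ _ c3); first exact: Rhausdorff.
apply: (cvg_near_cst 0).
near=> rho; apply: gdev_infty; apply/andP; split.
  by near: rho; exact: nbhs_right_gt.
by near: rho; exact: nbhs_right_lt.
Unshelve. all: by end_near. Qed.


(** For [rho > 0] this is [b rho] after [psi]; for [rho < 0] the same formula gives the antipodal
    conjugate ([kap_neg]), so that radius 0 becomes interior to the parameter domain. [bet] is the
    same map transported to the standard sphere. *)
Definition kap (rho : R) s : V := if rho == 0 then psi s else rho^-1 *: g (rho *: psi s).
Definition bet (rho : R) s : V := psi' (kap rho s).

Lemma kap_pos (rho : R) s : 0 < rho <= 1 -> sphere s -> kap rho s = b rho (psi s).
Proof.
move=> /andP[r0 r1] ss; rewrite /kap gt_eqF// gb ?r1 ?ltW//; last exact: psi_sphere.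
by rewrite scalerA mulVf ?gt_eqF// scale1r.
Qed.

Lemma kap_neg (rho : R) s : -1 <= rho < 0 -> sphere s ->
  kap rho s = - b (- rho) (- psi s).
Proof.
move=> /andP[r1 r0] ss; rewrite /kap lt_eqF//.
rewrite (_ : rho *: psi s = (- rho) *: (- psi s)); last by rewrite scalerN scaleNr opprK.
rewrite gb; last 2 first.
- by rewrite oppr_ge0 ltW//= lerNl.
- exact/sphereN/psi_sphere.
by rewrite scalerA mulrN mulVf ?lt_eqF// scaleN1r.
Qed.

Lemma kap_sphere (rho : R) s : -1 <= rho <= 1 -> sphere s -> sphere (kap rho s).
Proof.
move=> /andP[rm r1] ss; have [r0|r0|r0] := ltgtP rho 0.
- rewrite kap_neg ?rm//; apply/sphereN/b_sphere; last exact/sphereN/psi_sphere.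
  by rewrite oppr_ge0 ltW//= lerNl.
- by rewrite kap_pos ?r0//; apply: b_sphere; [rewrite ltW|exact: psi_sphere].
- by rewrite /kap r0 eqxx; exact: psi_sphere.
Qed.

Lemma bet_sphere (rho : R) s : -1 <= rho <= 1 -> sphere s -> sphere (bet rho s).
Proof. by move=> r1 ss; exact/psi'_sphere/kap_sphere. Qed.

Lemma bet0 s : sphere s -> bet 0 s = s.
Proof. by move=> ss; rewrite /bet /kap eqxx psiK. Qed.

(** [b rho] is injective and already takes the value [infty psi] at [infty psi]. *)
Lemma bet_north (rho : R) s : 0 <= rho <= 1 -> sphere s -> bet rho s = north -> s = north.
Proof.
move=> /andP[]; rewrite le_eqVlt => /orP[/eqP <- _ ss|r0 r1 ss]; first by rewrite bet0.
have r01 : 0 <= rho <= 1 by rewrite ltW.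
rewrite /bet kap_pos ?r0// => H.
have sb : sphere (b rho (psi s)) by apply: b_sphere => //; exact: psi_sphere.
have : b rho (psi s) = b rho (infty psi) by rewrite b_infty// -(psi'K sb) H.
by move/(b_inj r01 (psi_sphere ss) infty_sphere)/(congr1 psi'); rewrite /infty !psiK//; exact: north_sphere.
Qed.

Lemma bet_germ (rho : R) : 0 < rho <= 1 ->
  \forall s \near (north : V), sphere s -> bet rho s = s.
Proof.
move=> r01; have r01' : 0 <= rho <= 1 by case/andP: r01 => r0 ->; rewrite ltW.
have := psi_nbhs north_sphere (b_near r01'); apply: filterS => s H ss.
by rewrite /bet kap_pos// H ?psiK//; exact: psi_sphere.
Qed.

Section Chart.
Variable c : V -> V.
Hypothesis sc : forall j, smooth setT (fun q => c q 0 j).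
Hypothesis cs : forall q, sphere (c q).

Lemma smooth_psi_chart j : smooth slab (fun q => psi (c q) 0 j).
Proof.
have [[sm _] _ _ _] := hpsi.
apply: (smooth_on_comp j open_slab sm) => [q _|i]; first exact: cs.
by apply: smooth_sub (sc i) => q.
Qed.

Lemma smooth_ray_chart j : smooth slab (fun q => (q 0 0 *: psi (c q)) 0 j).
Proof.
apply: (smooth_ext_open open_slab _
  (smoothM open_slab (smooth_coord open_slab 0) (smooth_psi_chart j))) => q _.
by rewrite mxE.
Qed.

Lemma ray_chart_cball q : slab q -> cball (q 0 0 *: psi (c q)).
Proof.
by rewrite /slab /= -ltr_norml => /ltW q1; apply: cball_scale => //; exact: psi_sphere.
Qed.

Lemma smooth_g_chart j : smooth slab (fun q => g (q 0 0 *: psi (c q)) 0 j).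
Proof.
apply: (smooth_on_comp j open_slab gsmooth (c := fun q => q 0 0 *: psi (c q))).
  exact: ray_chart_cball.
exact: smooth_ray_chart.
Qed.

(** As [g 0 = 0], Hadamard's lemma divides [G] by [q 0 0]. At radius 0 the quotient is the radial
    derivative of [G], which equals [psi (c q)] because [g] is tangent to the identity at the
    origin. *)
Lemma smooth_kap j : smooth slab (fun q => kap (q 0 0) (c q) 0 j).
Proof.
pose G q := g (q 0 0 *: psi (c q)) 0 j.
have sG : smooth slab G := smooth_g_chart j.
apply: (smooth_ext_open open_slab _ (smooth_fibre_mean 0 (smooth_pd 0 sG))) => q sq.
have G0 : G (squeeze 0 q) = 0 by rewrite /G mxE eqxx mul0r scale0r g_0 mxE.
have [q0|q0] := eqVneq (q 0 0) 0; last first.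
  have := fibre_mean_pd0 sG sq G0; rewrite /kap (negbTE q0) => E.
  by rewrite mxE -/(G q) E mulrA mulVf// mul1r.
rewrite fibre_mean_0 // /kap q0 eqxx.
pose F q := q 0 0 *: psi (c q).
have Fq : F q = 0 by rewrite /F q0 scale0r.
have dF i : differentiable (fun q => F q 0 i) q := smooth_dif (smooth_ray_chart i) sq.
have ob0 : oball (F q).
  rewrite Fq -(scale0r (infty psi)); apply: oball_scale infty_sphere; by rewrite normr0.
have dgd := smooth_dif (smooth_gdev j) ob0.
have -> : G = (fun q => gdev j (F q) + F q 0 j).
  by apply/funext => x; rewrite /G /gdev /F subrK.
rewrite pdD//; last by apply: differentiable_comp dgd; exact: differentiable_rV.
rewrite pd_comp// Fq big1 ?add0r; last by move=> i _; rewrite gdev_0 mul0r.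
have -> : (fun q => F q 0 j) = (fun q => q 0 0 * psi (c q) 0 j).
  by apply/funext => x; rewrite /F mxE.
rewrite pdM; [|exact: differentiable_coordinate|exact: smooth_dif (smooth_psi_chart j) sq].
by rewrite q0 mul0r add0r pd_coord eqxx mulr1.
Qed.

Lemma smooth_bet j : smooth slab (fun q => bet (q 0 0) (c q) 0 j).
Proof.
have [[_ sm] _ _ _] := hpsi.
apply: (smooth_on_comp j open_slab sm (c := fun q => kap (q 0 0) (c q))); last exact: smooth_kap.
by move=> q /andP[q0 q1]; apply: kap_sphere; rewrite ?ltW.
Qed.

Definition dev j q : R := bet (q 0 0) (c q) 0 j - c q 0 j.

Lemma smooth_dev j : smooth slab (dev j).
Proof.
apply: smoothB; [exact: open_slab|exact: smooth_bet|].
by apply: smooth_sub (sc j) => q.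
Qed.

End Chart.

(** The axis of this chart is the point at infinity of each sphere, and each [bet rho] with
    [rho > 0] is the identity near it, on a neighbourhood depending on [rho]. *)
Lemma flat_dev_tau j : flat (dev tau j).
Proof.
have sT i : smooth setT (fun q : V => tau q 0 i) by apply: smooth_tau; exact: openT.
apply: flat_of_germ; first exact: (smooth_dev sT tau_sphere).
move=> rho /andP[r0 r1].
pose a : V := row3 rho 0 0.
have ct : {for a, continuous (tau : V -> V)}.
  by apply: rV_continuous => i; exact: smooth_continuous (sT i) I.
have ta : tau a = north by apply: tau_axis; rewrite row3E.
have := bet_germ (rho := rho); rewrite r0 ltW// -ta => /(_ isT) H.
have /nbhs_ballP[r /= rp Hr] : nbhs a (fun q : V => sphere (tau q) -> bet rho (tau q) = tau q) := ct _ H.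
exists r => // q q0 q1 q2; rewrite /dev q0 Hr ?subrr//; last exact: tau_sphere.
rewrite -ball_normE /=; have -> : a - q = row3 0 (- q 0 1) (- q 0 2%:R).
  by apply: row3P; rewrite !mxE /= ?sub0r// q0 subrr.
apply: le_lt_trans (_ : Num.max `|q 0 1| `|q 0 2%:R| < r); last by rewrite gt_max q1 q2.
apply: normr_rV_le; first by rewrite le_max normr_ge0.
by apply: ord3P; rewrite !row3E ?normrN ?normr0 le_max ?lexx ?normr_ge0 ?orbT.
Qed.

Lemma rapid_dev_sig (r1 : R) j : 0 < r1 < 1 -> alv (rapid slab (tube r1)) (dev sig j).
Proof.
move=> r01.
have sS i : smooth setT (fun q : V => sig q 0 i) by apply: smooth_sig; exact: openT.
apply: rapid_glue => //; first exact: (smooth_dev sS sig_sphere).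
have OU : far r1 `<=` outer.
  move=> q [/andP[q0 q1] nq]; split.
    case/andP: r01 => _ r11.
    by rewrite /slab /= (le_lt_trans q1 r11) andbT (lt_trans _ q0)// oppr_lt0.
  by rewrite (lt_le_trans _ nq)// invf_lt1 // ltr1n.
apply: (alv_ext (rapid_ideal open_outer OU) _ (flat_invert_rapid r01 (flat_dev_tau j))).
move=> q [_ nq]; have n0 : nrm2 q != 0 by rewrite gt_eqF// (lt_trans _ nq)// invr_gt0.
by rewrite /dev sig_invert// row3E.
Qed.

End FibredDiffeo.

(** * Divergence theorem on a tube *)

Section Measurability.
Context {R : realType} d (T : measurableType d).
Implicit Type f : T * R -> R.

Let grid (n : nat) (y : R) : R := (Num.floor (y * n.+1%:R))%:~R / n.+1%:R.

Let grid_cvg (y : R) : grid n y @[n --> \oo] --> y.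
Proof.
apply: (@squeeze_cvgr _ _ _ _ (fun n => y - harmonic n) (fun=> y)).
- near=> n; rewrite /grid /harmonic /= ler_pdivrMr// floor_le andbT.
  rewrite ler_pdivlMr// mulrBl mulVf// lerBlDr.
  by have := floorD1_gt (y * n.+1%:R); rewrite intrD => /ltW.
- by rewrite -[X in _ --> X]subr0; apply: cvgB; [exact: cvg_cst|exact: cvg_harmonic].
- exact: cvg_cst.
Unshelve. all: by end_near. Qed.

Let comp_grid (h : R -> R) (y : R) : continuous h -> h (grid n y) @[n --> \oo] --> h y.
Proof. by move=> ch; apply: continuous_cvg; [exact: ch|exact: grid_cvg]. Qed.

(** Replacing the second variable by the grid point below it gives functions that are measurable
    strip by strip, over countably many strips; continuity in that variable makes them converge. It
    is meant for functions cut off in the radius, which are not jointly continuous. *)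
Lemma caratheodory_measurable f : (forall y, measurable_fun setT (fun t => f (t, y))) ->
  (forall t, continuous (fun y => f (t, y))) -> measurable_fun setT f.
Proof.
move=> mf cf.
apply: (@measurable_realfun.measurable_fun_cvg _ _ _ _ (fun n z => f (z.1, grid n z.2))); last first.
  by move=> [t y] _; exact: (@comp_grid (fun y => f (t, y)) y (cf t)).
move=> n _ Y mY; rewrite setTI.
pose A (k : int) := (fun t => f (t, k%:~R / n.+1%:R)) @^-1` Y.
pose I (k : int) := [set y : R | k%:~R / n.+1%:R <= y < (k + 1)%:~R / n.+1%:R].
have -> : (fun z => f (z.1, grid n z.2)) @^-1` Y = \bigcup_(k : int) (A k `*` I k).
  apply/seteqP; split => [[t y] /= H|[t y] [k _ [/= H /andP[k1 k2]]]].
    exists (Num.floor (y * n.+1%:R)) => //; split => //=.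
    by rewrite /I /= ler_pdivrMr// ltr_pdivlMr// floor_itv.
  rewrite /preimage /= /grid (_ : Num.floor _ = k) //.
  apply/eqP; rewrite eq_le floor_ge_int -ltzD1 floor_lt_int.
  by rewrite ler_pdivrMr// in k1; rewrite ltr_pdivlMr// in k2; rewrite k1 k2.
apply: countable_bigcupT_measurable; first exact: countableP.
move=> k; apply: measurableX.
  by rewrite -[X in measurable X]setTI; exact: mf.
rewrite (_ : I k = [set` `[k%:~R / n.+1%:R, (k + 1)%:~R / n.+1%:R[]).
  exact: measurable_itv.
by apply/seteqP; split => y; rewrite /I /= in_itv.
Qed.

End Measurability.

Section ProductIntegrable.
Context d1 d2 (T1 : measurableType d1) (T2 : measurableType d2) (R : realType).
Variables (m1 : {sigma_finite_measure set T1 -> \bar R}).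
Variables (m2 : {sigma_finite_measure set T2 -> \bar R}).

Lemma integrable_tensor (u : T1 -> R) (v : T2 -> R) :
  m1.-integrable setT (EFin \o u) -> m2.-integrable setT (EFin \o v) ->
  (m1 \x m2)%E.-integrable setT (fun z => (u z.1 * v z.2)%:E).
Proof.
move=> iu iv; have [mu1 lu] := integrableP _ _ _ iu; have [mv lv] := integrableP _ _ _ iv.
have mu' : measurable_fun setT u by exact/measurable_EFinP.
have mv' : measurable_fun setT v by exact/measurable_EFinP.
apply/integrable12ltyP.
  apply/measurable_EFinP; apply: measurable_funM.
    exact: measurableT_comp mu' measurable_fst.
  exact: measurableT_comp mv' measurable_snd.
rewrite (eq_integral (fun x => (`|(u x)%:E| * \int[m2]_y `|(v y)%:E|)%E)); last first.
  move=> x _ /=; rewrite -ge0_integralZl//.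
    by apply: eq_integral => y _; rewrite normrM EFinM.
  by apply/measurable_EFinP; exact: (measurableT_comp (@normr_measurable _ _) mv').
have K : (\int[m2]_y `|(v y)%:E|)%E \is a fin_num.
  by rewrite ge0_fin_numE ?integral_ge0.
rewrite -(fineK K).
have -> : (\int[m1]_x (`|(u x)%:E| * (fine (\int[m2]_y `|(v y)%:E|))%:E))%E =
    ((\int[m1]_x `|(u x)%:E|) * (fine (\int[m2]_y `|(v y)%:E|))%:E)%E.
  apply: ge0_integralZr => //; first exact: measurableT_comp.
  by rewrite lee_fin fine_ge0 ?integral_ge0.
by rewrite muleC lte_mul_pinfty// lee_fin fine_ge0 ?integral_ge0.
Qed.

End ProductIntegrable.

Section LineIntegrals.
Context {R : realType}.
Local Notation mu := (@lebesgue_measure R).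

Definition bump (t : R) : R := (1 + t ^+ 2)^-1.

Lemma bump_ge0 t : 0 <= bump t.
Proof. by rewrite invr_ge0 addr_ge0// sqr_ge0. Qed.

Lemma integrable_bump : mu.-integrable setT (EFin \o bump).
Proof.
have cb : continuous bump by exact: continuous_oneDsqrV.
apply/integrableP; split; first by apply/measurable_EFinP; exact: continuous_measurable_fun.
under eq_integral => t _ do rewrite /= ger0_norm ?bump_ge0//.
rewrite ge0_symfun_integralT//; [|exact: bump_ge0|by move=> t; rewrite /bump /= sqrrN].
have := @integral0y_oneDsqr R; rewrite set_itvcy => ->.
by rewrite -EFinM ltry.
Qed.

Lemma integral_derive_compact (s ds : R -> R) (M : R) : 0 < M ->
  (forall y : R, is_derive y 1 s (ds y)) -> continuous ds ->
  (forall y : R, M <= `|y| -> s y = 0) -> (\int[mu]_y (ds y)%:E = 0)%E.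
Proof.
move=> M0 dsP cds s0.
have cs : continuous s.
  by move=> y; apply: differentiable_continuous; apply/derivable1_diffP; have [] := dsP y.
have ds0 y : M + 1 < `|y| -> ds y = 0.
  move=> yM; have [_ <-] := dsP y.
  rewrite (near_eq_derive (g := fun=> 0)) ?derive_cst//.
  have : \forall z \near y, M < `|z|.
    have c : `|z| @[z --> y] --> `|y| by apply: cvg_norm; exact: cvg_id.
    by apply: (cvgr_gt `|y| c); rewrite (lt_trans _ yM)// ltrDl.
  by apply: filterS => z zM; rewrite s0// ltW.
have -> : (fun y => (ds y)%:E) = ((fun y => (ds y)%:E) \_ `[(- (M + 1))%R, (M + 1)%R]%classic).
  apply/funext => y; rewrite /patch mem_setE in_itv /= -ler_norml.
  by case: ifPn => //; rewrite -ltNge => /ds0 ->.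
rewrite -integral_mkcond.
have M1 : - (M + 1) < M + 1 by rewrite -subr_gt0 opprK; lra.
rewrite (@continuous_FTC2 R ds s _ _ M1).
- by rewrite !s0 ?subee// ?normrN ger0_norm; lra.
- exact: continuous_subspaceT.
- split; [by move=> y _; have [] := dsP y| |].
    by apply: cvg_at_right_filter; exact: cs.
  by apply: cvg_at_left_filter; exact: cs.
- by move=> y _; rewrite derive1E; have [] := dsP y.
Qed.

Lemma integral_derive_segment (s ds : R -> R) (r : R) : 0 < r ->
  (forall t : R, 0 <= t <= r -> is_derive t 1 s (ds t)) ->
  (forall t : R, 0 <= t <= r -> {for t, continuous ds}) ->
  (\int[mu]_(t in `]0%R, r[) (ds t)%:E = (s r)%:E - (s 0%R)%:E)%E.
Proof.
move=> r0 dsP cds.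
have cs t : 0 <= t <= r -> {for t, continuous s}.
  by move=> tr; apply: differentiable_continuous; apply/derivable1_diffP; have [] := dsP t tr.
have cW : {within `[0, r], continuous ds}.
  by apply: continuous_in_subspaceT => t /set_mem; rewrite /= in_itv /=; exact: cds.
have m : measurable_fun `]0, r[ (EFin \o ds).
  apply/measurable_EFinP.
  have := @subspace_continuous_measurable_fun R `[0, r] ds (measurable_itv _) cW.
  by apply: measurable_funS => //; exact: subset_itv_oo_cc.
rewrite -(integral_itv_bndoo true false m).
have I0 : 0 <= (0 : R) <= r by rewrite lexx ltW.
have Ir : 0 <= r <= r by rewrite lexx ltW.
rewrite (@continuous_FTC2 R ds s _ _ r0)//.
- split.
  + by move=> t; rewrite in_itv /= => /andP[t0 t1]; have [] := dsP t; rewrite ?ltW.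
  + by apply: cvg_at_right_filter; exact: cs.
  + by apply: cvg_at_left_filter; exact: cs.
- by move=> t; rewrite in_itv /= => /andP[t0 t1]; rewrite derive1E; have [] := dsP t; rewrite ?ltW.
Qed.

End LineIntegrals.

Section PlaneMeasure.
Context {R : realType}.
Local Notation mu := (@lebesgue_measure R).

(* The canonical sigma-finite structure on products is only found for
   subprobabilities; it has to be redeclared to iterate Fubini's theorem. *)
Definition plane_measure := (mu \x mu)%E.
HB.instance Definition _ := Measure.on plane_measure.

Lemma plane_sigma_finite : sigma_finite setT plane_measure.
Proof.
exists (fun n : nat => [set` `[- n%:R, n%:R]%R] `*` [set` `[- n%:R, n%:R]%R]).
  apply/seteqP; split => // -[x y] _.
  have xb (z : R) : exists n : nat, forall m : nat, (n <= m)%N -> `|z| <= m%:R.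
    exists (Num.trunc `|z|).+1 => m nm; apply: ltW; apply: (lt_le_trans (truncnS_gt _)).
    by rewrite ler_nat.
  have [n1 H1] := xb x; have [n2 H2] := xb y.
  exists (maxn n1 n2) => //; split; rewrite /= in_itv /= -ler_norml.
    by apply: H1; exact: leq_maxl.
  by apply: H2; exact: leq_maxr.
move=> n; split; first by apply: measurableX; exact: measurable_itv.
rewrite /plane_measure product_measure1E; [|exact: measurable_itv|exact: measurable_itv].
have [r Er] : exists r : R, mu ([set` `[- n%:R, n%:R]%R] : set R) = r%:E.
  rewrite lebesgue_measure_itv /=; case: ifP => _; last by exists 0.
  by exists (n%:R - - n%:R).
rewrite [X in (X * _)%E](_ : _ = r%:E)// [X in (_ * X)%E](_ : _ = r%:E)//.
by rewrite -EFinM ltry.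
Qed.

HB.instance Definition _ := Measure_isSigmaFinite.Build _ _ _ plane_measure plane_sigma_finite.

End PlaneMeasure.

Section Divergence.
Context {R : realType}.
Local Notation V := 'rV[R]_3.
Local Notation mu := (@lebesgue_measure R).
Local Notation mu2 := (@plane_measure R).
Local Notation mu3 := (mu2 \x mu)%E.
Variables (U : set V) (r1 : R).
Hypotheses (oU : open U) (r10 : 0 < r1) (cU : ctube r1 `<=` U).
Implicit Types (h : V -> R) (c : (R * R) * R).

Definition in_tube (rho : R) : bool := 0 < rho < r1.

(** Extension by 0 lets Fubini run over the full product; continuity is kept in the last two
    variables. *)
Definition tube_ext h c : R := if in_tube c.1.1 then h (row3 c.1.1 c.1.2 c.2) else 0.

Lemma row3_line2 (a b t : R) : row3 a b t = row3 a b 0 + t *: evec 2%:R.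
Proof. by apply: row3P; rewrite !mxE /= ?mulr0 ?addr0 ?mulr1 ?add0r. Qed.

Lemma row3_line1 (a b t : R) : row3 a t b = row3 a 0 b + t *: evec 1.
Proof. by apply: row3P; rewrite !mxE /= ?mulr0 ?addr0 ?mulr1 ?add0r. Qed.

Lemma row3_line0 (a b t : R) : row3 t a b = row3 0 a b + t *: evec 0.
Proof. by apply: row3P; rewrite !mxE /= ?mulr0 ?addr0 ?mulr1 ?add0r. Qed.

Lemma ctube_row3 (a b t : R) : 0 <= a <= r1 -> U (row3 a b t).
Proof. by move=> ar; apply: cU; rewrite /ctube /= row3E. Qed.

Lemma in_tubeW (rho : R) : in_tube rho -> 0 <= rho <= r1.
Proof. by move=> /andP[a b]; rewrite !ltW. Qed.

Lemma is_derive_coord h i q (t : R) : smooth U h -> U (q + t *: evec i) ->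
  is_derive t 1 (fun t : R => h (q + t *: evec i)) (pd i h (q + t *: evec i)).
Proof. by move=> sh Uq; apply: is_derive_line; apply: diff_derivable; exact: smooth_dif sh Uq. Qed.

Lemma continuous_coord h i q (t : R) : smooth U h -> U (q + t *: evec i) ->
  {for t, continuous (fun t : R => h (q + t *: evec i))}.
Proof.
move=> sh Uq; apply: differentiable_continuous; apply/derivable1_diffP.
by have [] := is_derive_coord sh Uq.
Qed.

Lemma continuous_tube_ext1 h (a b : R) : smooth U h -> continuous (fun t => tube_ext h ((a, t), b)).
Proof.
move=> sh; have [ia|ia] := boolP (in_tube a); last first.
  by rewrite /tube_ext /= (negbTE ia) => t; exact: cvg_cst.
have -> : (fun t => tube_ext h ((a, t), b)) = (fun t => h (row3 a 0 b + t *: evec 1)).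
  by apply/funext => t; rewrite /tube_ext /= ia row3_line1.
move=> t.
by apply: continuous_coord => //; rewrite -row3_line1; apply/ctube_row3/in_tubeW.
Qed.

Lemma continuous_tube_ext2 h (a b : R) : smooth U h -> continuous (fun t => tube_ext h ((a, b), t)).
Proof.
move=> sh; have [ia|ia] := boolP (in_tube a); last first.
  by rewrite /tube_ext /= (negbTE ia) => t; exact: cvg_cst.
have -> : (fun t => tube_ext h ((a, b), t)) = (fun t => h (row3 a b 0 + t *: evec 2%:R)).
  by apply/funext => t; rewrite /tube_ext /= ia row3_line2.
move=> t.
by apply: continuous_coord => //; rewrite -row3_line2; apply/ctube_row3/in_tubeW.
Qed.

Lemma measurable_tube_ext h : smooth U h -> measurable_fun setT (tube_ext h).
Proof.
move=> sh; apply: caratheodory_measurable; last by move=> [a b]; exact: continuous_tube_ext2.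
move=> y; apply: caratheodory_measurable; last by move=> a; exact: continuous_tube_ext1.
move=> x.
have -> : (fun t => tube_ext h (t, x, y)) = (fun t => h (row3 t x y)) \_ `]0, r1[%classic.
  by apply/funext => t; rewrite /tube_ext /patch /in_tube mem_setE in_itv.
apply/measurable_restrict => //; rewrite setTI.
apply: open_continuous_measurable_fun; first exact: interval_open.
move=> t; rewrite inE /= in_itv /= => tr.
have -> : (fun t => h (row3 t x y)) = (fun t => h (row3 0 x y + t *: evec 0)).
  by apply/funext => z; rewrite row3_line0.
by apply: continuous_coord => //; rewrite -row3_line0; apply/ctube_row3/in_tubeW.
Qed.

Let ind (t : R) : R := \1_(`[0, r1]%classic) t.

(** Decay of exponent 2 is enough, since [(1 + x^2) (1 + y^2)] is at most the square of the weight
    [1 + x^2 + y^2]. *)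
Lemma tube_ext_bound h : rapid U (tube r1) h ->
  exists C : R, forall c, `|tube_ext h c| <= C * (ind c.1.1 * bump c.1.2 * bump c.2).
Proof.
move=> [_ /(_ 2%N)[C HC]]; exists `|C| => -[[a x] y]; rewrite /tube_ext /=.
case: ifPn => [|_]; last first.
  by rewrite normr0 mulr_ge0 ?mulr_ge0 ?bump_ge0// indicE.
move=> ia; have := HC (row3 a x y); rewrite /tube /= row3E.
have [a0 ar] := andP ia; rewrite a0 ltW// => /(_ isT).
have -> : ind a = 1 by rewrite /ind indicE mem_setE in_itv /= (in_tubeW ia).
rewrite mul1r /wgt /nrm2 !row3E /bump -invfM.
have d0 (t : R) : 0 < 1 + t ^+ 2 by rewrite ltr_pwDl// sqr_ge0.
rewrite ler_pdivlMr ?mulr_gt0// => H.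
apply: le_trans (le_trans H (ler_norm C)); apply: ler_wpM2l => //.
move: (x ^+ 2) (y ^+ 2) (sqr_ge0 x) (sqr_ge0 y) => X Y X0 Y0.
by rewrite expr2; nra.
Qed.

Let integrable_dom2 : mu2.-integrable setT (fun t => (ind t.1 * bump t.2)%:E).
Proof.
apply: integrable_tensor; last exact: integrable_bump.
exact: integrable_indic_itv.
Qed.

Let integrable_dom3 : mu3.-integrable setT (fun c => (ind c.1.1 * bump c.1.2 * bump c.2)%:E).
Proof.
exact: (@integrable_tensor _ _ _ _ _ mu2 mu (fun t => ind t.1 * bump t.2) bump
  integrable_dom2 integrable_bump).
Qed.

Lemma integrable_tube_ext h : smooth U h -> rapid U (tube r1) h ->
  mu3.-integrable setT (EFin \o tube_ext h).
Proof.
move=> sh rh; have [C HC] := tube_ext_bound rh.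
apply: (le_integrable measurableT _ _ (integrableZl measurableT `|C| integrable_dom3)).
  by apply/measurable_EFinP; exact: measurable_tube_ext.
move=> c _; rewrite -EFinM /= lee_fin; apply: le_trans (HC c) _.
by apply: le_trans (ler_norm _); rewrite ler_wpM2r ?ler_norm// ?mulr_ge0 ?bump_ge0// /ind indicE.
Qed.

Lemma integrable_tube_ext2 h y : smooth U h -> rapid U (tube r1) h ->
  mu2.-integrable setT (fun t => (tube_ext h (t, y))%:E).
Proof.
move=> sh rh; have [C HC] := tube_ext_bound rh.
apply: (le_integrable measurableT _ _ (integrableZl measurableT (`|C| * bump y) integrable_dom2)).
  apply/measurable_EFinP; exact: (measurable_fun_pair1 y (measurable_tube_ext sh)).
move=> t _; rewrite -EFinM /= lee_fin; apply: le_trans (HC (t, y)) _ => /=.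
apply: le_trans (ler_norm _); rewrite [ind t.1 * _ * _]mulrC mulrA.
have i0 : 0 <= ind t.1 * bump t.2 by rewrite mulr_ge0 ?bump_ge0// /ind indicE.
by apply: ler_wpM2r => //; apply: ler_wpM2r; rewrite ?bump_ge0// ler_norm.
Qed.

(** The last variable is integrated first, one line at a time, so [M] may depend on [rho]; global
    integrability, needed for Fubini, comes from the decay instead. *)
Lemma tube_integral2 h : smooth U h -> rapid U (tube r1) (pd 2%:R h) ->
  (forall rho, in_tube rho -> exists2 M : R, 0 < M & forall q : V, q 0 0 = rho ->
     M <= `|q 0 1| \/ M <= `|q 0 2%:R| -> h q = 0) ->
  (\int[mu3]_c (tube_ext (pd 2%:R h) c)%:E = 0)%E.
Proof.
move=> sh rh h0.
rewrite -(integral12_prod_meas1 (integrable_tube_ext (smooth_pd 2%:R sh) rh)).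
apply: integral0_eq => -[a x] _; rewrite /fubini_F /=.
have [ia|ia] := boolP (in_tube a); last first.
  by apply: integral0_eq => y _; rewrite /tube_ext /= (negbTE ia).
have [M M0 HM] := h0 _ ia.
have -> : (fun y => (tube_ext (pd 2%:R h) (a, x, y))%:E) =
    (fun y : R => (pd 2%:R h (row3 a x 0 + y *: evec 2%:R))%:E).
  by apply/funext => y; rewrite /tube_ext /= ia row3_line2.
have inU (y : R) : U (row3 a x 0 + y *: evec 2%:R).
  by rewrite -row3_line2; apply/ctube_row3/in_tubeW.
apply: (@integral_derive_compact R (fun y : R => h (row3 a x 0 + y *: evec 2%:R)) _ M) => //.
- by move=> y; apply: is_derive_coord.
- by move=> y; apply: (continuous_coord (smooth_pd _ sh)).
- by move=> y My; rewrite -row3_line2; apply: HM; rewrite !row3E //; right.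
Qed.

Lemma tube_integral1 h : smooth U h -> rapid U (tube r1) (pd 1 h) ->
  (forall rho, in_tube rho -> exists2 M : R, 0 < M & forall q : V, q 0 0 = rho ->
     M <= `|q 0 1| \/ M <= `|q 0 2%:R| -> h q = 0) ->
  (\int[mu3]_c (tube_ext (pd 1 h) c)%:E = 0)%E.
Proof.
move=> sh rh h0.
rewrite -(integral21_prod_meas1 (integrable_tube_ext (smooth_pd 1 sh) rh)).
apply: integral0_eq => y _; rewrite /fubini_G /=.
rewrite -(integral12_prod_meas1 (integrable_tube_ext2 y (smooth_pd 1 sh) rh)).
apply: integral0_eq => a _; rewrite /fubini_F /=.
have [ia|ia] := boolP (in_tube a); last first.
  by apply: integral0_eq => x _; rewrite /tube_ext /= (negbTE ia).
have [M M0 HM] := h0 _ ia.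
have -> : (fun x => (tube_ext (pd 1 h) (a, x, y))%:E) =
    (fun x : R => (pd 1 h (row3 a 0 y + x *: evec 1))%:E).
  by apply/funext => x; rewrite /tube_ext /= ia row3_line1.
have inU (x : R) : U (row3 a 0 y + x *: evec 1).
  by rewrite -row3_line1; apply/ctube_row3/in_tubeW.
apply: (@integral_derive_compact R (fun x : R => h (row3 a 0 y + x *: evec 1)) _ M) => //.
- by move=> x; apply: is_derive_coord.
- by move=> x; apply: (continuous_coord (smooth_pd _ sh)).
- by move=> x Mx; rewrite -row3_line1; apply: HM; rewrite !row3E //; left.
Qed.

(** With the radius integrated innermost, only the endpoint [r1] remains. *)
Lemma tube_integral0 h : smooth U h -> rapid U (tube r1) (pd 0 h) ->
  (forall q : V, q 0 0 = 0 -> h q = 0) ->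
  (\int[mu3]_c (tube_ext (pd 0 h) c)%:E = \int[mu]_y \int[mu]_x (h (row3 r1 x y))%:E)%E.
Proof.
move=> sh rh h0.
rewrite -(integral21_prod_meas1 (integrable_tube_ext (smooth_pd 0 sh) rh)).
apply: eq_integral => y _; rewrite /fubini_G /=.
rewrite -(integral21_prod_meas1 (integrable_tube_ext2 y (smooth_pd 0 sh) rh)).
apply: eq_integral => x _; rewrite /fubini_G /=.
pose ds t := pd 0 h (row3 0 x y + t *: evec 0).
rewrite (_ : (fun t => (tube_ext (pd 0 h) (t, x, y))%:E) = (fun t => (ds t)%:E) \_ `]0, r1[%classic); last first.
  apply/funext => t; rewrite /tube_ext /patch /in_tube mem_setE in_itv /= /ds row3_line0.
  by case: ifP.
rewrite -integral_mkcond.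
apply: (eq_trans (@integral_derive_segment R (fun t : R => h (row3 0 x y + t *: evec 0)) ds r1 r10 _ _)).
- by move=> t tr; apply: is_derive_coord => //; rewrite -row3_line0; exact: ctube_row3.
- by move=> t tr; apply: (continuous_coord (smooth_pd _ sh)); rewrite -row3_line0; exact: ctube_row3.
- by rewrite -!row3_line0 [h (row3 0 _ _)]h0 ?row3E// sube0.
Qed.

Lemma tube_stokes (P Q S : V -> R) : smooth U P -> smooth U Q -> smooth U S ->
  rapid U (tube r1) (pd 0 P) -> rapid U (tube r1) (pd 1 Q) -> rapid U (tube r1) (pd 2%:R S) ->
  (forall q : V, q 0 0 = 0 -> P q = 0) ->
  (forall rho, in_tube rho -> exists2 M : R, 0 < M & forall q : V, q 0 0 = rho ->
     M <= `|q 0 1| \/ M <= `|q 0 2%:R| -> Q q = 0 /\ S q = 0) ->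
  (\int[mu3]_c (tube_ext (fun q => pd 0 P q + pd 1 Q q + pd 2%:R S q) c)%:E =
   \int[mu]_y \int[mu]_x (P (row3 r1 x y))%:E)%E.
Proof.
move=> sP sQ sS rP rQ rS P0 QS0.
have iP := integrable_tube_ext (smooth_pd 0 sP) rP.
have iQ := integrable_tube_ext (smooth_pd 1 sQ) rQ.
have iS := integrable_tube_ext (smooth_pd 2%:R sS) rS.
have -> : (fun c => (tube_ext (fun q => pd 0 P q + pd 1 Q q + pd 2%:R S q) c)%:E) =
    (fun c => (tube_ext (pd 0 P) c)%:E + (tube_ext (pd 1 Q) c)%:E + (tube_ext (pd 2%:R S) c)%:E)%E.
  by apply/funext => c; rewrite /tube_ext -!EFinD; case: ifP => // _; rewrite !addr0.
rewrite integralD//; last exact: integrableD.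
rewrite integralD// tube_integral0// tube_integral1// ?tube_integral2// ?adde0//.
- by move=> rho /QS0[M M0 H]; exists M => // q q0 qM; have [] := H q q0 qM.
- by move=> rho /QS0[M M0 H]; exists M => // q q0 qM; have [] := H q q0 qM.
Qed.

End Divergence.

(** * The density as a divergence *)

Section Wedge.
Context {R : realType}.
Local Notation M3 := 'M[R]_3.

(** Together with [shuffle_signE], turns questions on subsets of three indices into membership
    booleans that simplification evaluates. *)
Lemma set1_ord3 (I : {set 'I_3}) (i : 'I_3) : (I == [set i]%SET) =
  [&& (0 \in I) == (0 == i :> 'I_3), (1 \in I) == (1 == i :> 'I_3) & (2%:R \in I) == (2%:R == i :> 'I_3)].
Proof.
apply/eqP/and3P => [->|[/eqP h0 /eqP h1 /eqP h2]]; first by rewrite !inE !eqxx.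
by apply/setP; apply: ord3P; rewrite !inE ?h0 ?h1 ?h2 // eq_sym.
Qed.

Lemma shuffle_signE (A B : {set 'I_3}) : shuffle_sign A B =
  (-1) ^+ (\sum_(i < 3) \sum_(j < 3) [&& i \in A, j \in B & (j < i)%N])%N :> R.
Proof.
rewrite /shuffle_sign -sum1_card big_mkcond/=.
rewrite (pair_bigA _ (fun i j : 'I_3 => [&& i \in A, j \in B & (j < i)%N] : nat)) /=.
by congr (_ ^+ _); apply: eq_bigr => -[i j] _ /=; rewrite inE /=; case: ifP => ->.
Qed.

(** A 1-form lives on singletons, so only the subsets [A] missing exactly one index of [I]
    contribute. *)
Lemma wedge_form1 (F : mxform) (b : 'I_3 -> M3) (I : {set 'I_3}) :
  wedge F (form1 b) I =
  \sum_(k in I) shuffle_sign (I :\ k)%SET [set k]%SET *: (F (I :\ k)%SET *m b k).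
Proof.
rewrite /wedge /form1.
transitivity (\sum_(k : 'I_3) \sum_(A : {set 'I_3} | (A \subset I) && ((I :\: A)%SET == [set k]%SET))
    shuffle_sign A [set k]%SET *: (F A *m b k)).
  rewrite (exchange_big_dep (fun A : {set 'I_3} => A \subset I)) /=; last by move=> k A _ /andP[].
  apply: eq_bigr => A AI; rewrite mulmx_sumr scaler_sumr.
  apply: eq_big => [k|k /eqP ->//]; by rewrite AI.
rewrite [RHS]big_mkcond /=; apply: eq_bigr => k _; case: ifPn => kI; last first.
  rewrite big_pred0// => A; apply: contraNF kI => /andP[_ /eqP E].
  by have : k \in (I :\: A)%SET; rewrite E ?inE// => _; move: (set11 k); rewrite -E inE => /andP[].
rewrite (big_pred1 (I :\ k)%SET)// => A /=; apply/andP/eqP => [[AI /eqP E]|->].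
  by rewrite -E finset.setDDr finset.setDv finset.set0U; apply/esym/finset.setIidPr.
rewrite subsetDl finset.setDDr finset.setDv finset.set0U; split => //; apply/eqP/finset.setIidPr; rewrite finset.sub1set; exact: kI.
Qed.

Lemma mulmx_form1 (M : M3) (a : 'I_3 -> M3) :
  mulmx_form M (form1 a) = form1 (fun k => M *m a k).
Proof. by apply/funext => I; rewrite /mulmx_form /form1 mulmx_sumr. Qed.

(** Of the six orderings, the three even ones have the same trace by cyclicity, and so do the three
    odd ones. *)
Lemma trace_cube (t : 'I_3 -> M3) :
  \tr (wedge (wedge (form1 t) (form1 t)) (form1 t) [set: 'I_3]%SET) =
  3%:R * (\tr (t 0 *m t 1 *m t 2%:R) - \tr (t 0 *m t 2%:R *m t 1)).
Proof.
rewrite wedge_form1 big_mkcond /= sum_ord3 !inE /=.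
rewrite !wedge_form1 !(big_mkcond (fun k => k \in _)) /= !sum_ord3 !inE /=.
rewrite !shuffle_signE !sum_ord3 !inE /= /form1 !(big_mkcond (fun k => _ == _)) /= !sum_ord3 !set1_ord3 !inE /=.
rewrite !add0r !addr0 !expr0 !expr1 !scale1r !scaleN1r exprD !expr1 mulrNN mulr1 scale1r.
rewrite !mulmxDl !mulNmx !mxtraceD.
have trN (A : M3) : \tr (- A) = - \tr A by exact: raddfN.
have tc (A B C : M3) : \tr (A *m B *m C) = \tr (C *m A *m B) by rewrite mxtrace_mulC mulmxA.
rewrite !trN !mxtraceD !trN.
rewrite (tc (t 2%:R) (t 1) (t 0)) (tc (t 1) (t 2%:R) (t 0)) (tc (t 2%:R) (t 0) (t 1)).
rewrite (tc (t 1) (t 2%:R) (t 0)) (tc (t 1) (t 0) (t 2%:R)) (tc (t 2%:R) (t 1) (t 0)).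
by move: (\tr _) (\tr _) => x y; ring.
Qed.

End Wedge.

(** * Linear algebra of Jacobians preserving the radius *)

Section Jacobian.
Context {R : realType}.
Local Notation V := 'rV[R]_3.
Local Notation M3 := 'M[R]_3.
Implicit Types (X Y : V -> R) (q : V).

(** The determinant of three covectors, that is the coefficient of their wedge product on the volume
    form. *)
Definition triple (a b c : 'I_3 -> R) : R :=
  a 0 * (b 1 * c 2%:R - b 2%:R * c 1) + a 1 * (b 2%:R * c 0 - b 0 * c 2%:R) +
  a 2%:R * (b 0 * c 1 - b 1 * c 0).

(** With zero first rows only the lower right blocks count, and their scalar parts cancel in the
    antisymmetrisation, so the diagonal enters through its difference. *)
Lemma trace_fibred (t : 'I_3 -> M3) : (forall k j, t k 0 j = 0) ->
  \tr (t 0 *m t 1 *m t 2%:R) - \tr (t 0 *m t 2%:R *m t 1) =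
  triple (fun k => t k 2%:R 1) (fun k => t k 1 1 - t k 2%:R 2%:R) (fun k => t k 1 2%:R).
Proof.
move=> t0; rewrite /mxtrace !sum_ord3 !mxE !sum_ord3 !mxE !sum_ord3 !t0 /triple.
move: (t 0) (t 1) (t 2%:R) => A B C.
move: (A 1 1) (A 1 2%:R) (A 2%:R 1) (A 2%:R 2%:R) (B 1 1) (B 1 2%:R) (B 2%:R 1) (B 2%:R 2%:R).
move: (C 1 1) (C 1 2%:R) (C 2%:R 1) (C 2%:R 2%:R).
move: (A 1 0) (A 2%:R 0) (B 1 0) (B 2%:R 0) (C 1 0) (C 2%:R 0).
move=> *.
ring.
Qed.

Definition fibred_jac (r : 'I_3 -> R) (s : 'I_3 -> R) : M3 :=
  \matrix_(i, j) nth 0 [:: (j == 0)%:R; r j; s j] i.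

(** The first column of the inverse will meet the zero first row of the differentiated Jacobian, so
    its lower entries stay existential. *)
Lemma fibred_invmx (r s : 'I_3 -> R) (D : R) : D = r 1 * s 2%:R - r 2%:R * s 1 -> D != 0 ->
  exists u v : R, invmx (fibred_jac r s) = 
  \matrix_(i, j) nth 0 [:: (j == 0)%:R;
      nth 0 [:: u; s 2%:R / D; - (r 2%:R / D)] j; nth 0 [:: v; - (s 1 / D); r 1 / D] j] i.
Proof.
move=> ED D0.
exists (- (s 2%:R * r 0 - r 2%:R * s 0) / D), (- (r 1 * s 0 - s 1 * r 0) / D).
set K := \matrix_(i, j) _.
have KJ : K *m fibred_jac r s = 1%:M.
  apply/matrixP; apply: ord3P; apply: ord3P; rewrite !mxE sum_ord3 !mxE /= ?mulr0 ?mul0r ?mulr1 ?mul1r ?addr0 ?add0r //; rewrite ED in D0 *; move: (r 0) (r 1) (r 2%:R) (s 0) (s 1) (s 2%:R) D0 => *; by field.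
have [uK uJ] := mulmx1_unit KJ.
by rewrite -[LHS]mul1mx -KJ -mulmxA mulmxV// mulmx1.
Qed.


(** A triangular change of covectors with diagonal product 1 preserves the determinant. *)
Lemma triple_shear (x y z : 'I_3 -> R) (r r' s v w : R) : r * r' = 1 ->
  triple (fun k => r * x k) (fun k => r' * y k + s * x k) (fun k => z k - v * y k + w * x k) =
  triple x y z.
Proof.
rewrite /triple => rr.
move: (x 0) (x 1) (x 2%:R) (y 0) (y 1) (y 2%:R) (z 0) (z 1) (z 2%:R) => x0 x1 x2 y0 y1 y2 z0 z1 z2.
transitivity (r * r' * (x0 * (y1 * z2 - y2 * z1) + x1 * (y2 * z0 - y0 * z2) + x2 * (y0 * z1 - y1 * z0))).
  by ring.
by rewrite rr mul1r.
Qed.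

(* The right-hand side uses the differentials of the angle, of the ratio of the
   diagonal entries and of the shear in the decomposition of [[a, b], [c, d]] as
   a rotation times an upper triangular matrix. *)
Lemma iwasawa_identity (a b c d : R) (da db dc dd : 'I_3 -> R) (D n : R) :
  D = a * d - b * c -> n = a ^+ 2 + c ^+ 2 -> D != 0 -> n != 0 ->
  triple (fun k => (a * dc k - c * da k) / D)
    (fun k => (d * da k - b * dc k) / D - (a * dd k - c * db k) / D)
    (fun k => (d * db k - b * dd k) / D) =
  triple (fun k => (a * dc k - c * da k) / n)
    (fun k => (2%:R * (a * da k + c * dc k)) / D - n * (a * dd k + d * da k - b * dc k - c * db k) / D ^+ 2)
    (fun k => (a * db k + b * da k + c * dd k + d * dc k) / n - 2%:R * (a * b + c * d) * (a * da k + c * dc k) / n ^+ 2).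
Proof.
move=> ED En D0 n0.
pose u := (a * b + c * d) / n.
(* The new covectors are triangular combinations of the old ones, with diagonal coefficients
   [D / n], [n / D] and 1. *)
have dqE k : (2%:R * (a * da k + c * dc k)) / D - n * (a * dd k + d * da k - b * dc k - c * db k) / D ^+ 2 =
   n / D * ((d * da k - b * dc k) / D - (a * dd k - c * db k) / D) + 2%:R * (n / D) * u * ((a * dc k - c * da k) / D).
  rewrite /u; move: (da k) (db k) (dc k) (dd k) => x y z w; rewrite ED En in D0 n0 *; field.
  by rewrite ?D0 ?n0.
have duE k : (a * db k + b * da k + c * dd k + d * dc k) / n - 2%:R * (a * b + c * d) * (a * da k + c * dc k) / n ^+ 2 =
   (d * db k - b * dd k) / D - u * ((d * da k - b * dc k) / D - (a * dd k - c * db k) / D) +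
     ((b ^+ 2 + d ^+ 2) / n - 2%:R * u ^+ 2) * ((a * dc k - c * da k) / D).
  rewrite /u; move: (da k) (db k) (dc k) (dd k) => x y z w; rewrite ED En in D0 n0 *; field.
  by rewrite ?D0 ?n0.
have aE k : (a * dc k - c * da k) / n = D / n * ((a * dc k - c * da k) / D) by field; rewrite D0 n0.
rewrite (funext dqE) (funext duE) (funext aE) triple_shear//.
by rewrite mulrA divfK// divff.
Qed.

End Jacobian.

Section PdIs.
Context {R : realType}.
Local Notation V := 'rV[R]_3.
Implicit Types (f g : V -> R) (q : V) (k : 'I_3) (a b : R).

(** Bundling differentiability with the value lets derivatives of compound expressions be computed
    by composing lemmas. *)
Definition pd_is k f q a := differentiable f q /\ pd k f q = a.

Lemma pd_isD k f g q a b : pd_is k f q a -> pd_is k g q b ->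
  pd_is k (fun x => f x + g x) q (a + b).
Proof. by move=> [df <-] [dg <-]; split; [exact: differentiableD|exact: pdD]. Qed.

Lemma pd_isM k f g q a b : pd_is k f q a -> pd_is k g q b ->
  pd_is k (fun x => f x * g x) q (f q * b + g q * a).
Proof. by move=> [df <-] [dg <-]; split; [exact: differentiableM|exact: pdM]. Qed.

Lemma pd_is_cst k (c : R) q : pd_is k (fun=> c) q 0.
Proof. by split; [exact: differentiable_cst|exact: pd_cst]. Qed.

Lemma pd_isN k f q a : pd_is k f q a -> pd_is k (fun x => - f x) q (- a).
Proof. by move=> [df <-]; split; [exact: differentiableN|rewrite /pd deriveN//; exact: diff_derivable]. Qed.

Lemma pd_isB k f g q a b : pd_is k f q a -> pd_is k g q b ->
  pd_is k (fun x => f x - g x) q (a - b).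
Proof. by move=> Hf Hg; apply: pd_isD => //; exact: pd_isN. Qed.

Lemma pd_isX2 k f q a : pd_is k f q a -> pd_is k (fun x => f x ^+ 2) q (f q * a + f q * a).
Proof.
move=> H; have -> : (fun x => f x ^+ 2) = (fun x => f x * f x) by apply/funext => x; rewrite expr2.
exact: (pd_isM H H).
Qed.

Lemma pd_isV k f q a : f q != 0 -> pd_is k f q a ->
  pd_is k (fun x => (f x)^-1) q (- (a * (f q)^-1 * (f q)^-1)).
Proof. by move=> f0 [df <-]; split; [exact: differentiableV|exact: pdV]. Qed.

Lemma pd_is_smooth k U f q : smooth U f -> U q -> pd_is k f q (pd k f q).
Proof. by move=> sf Uq; split => //; exact: smooth_dif sf Uq. Qed.

(** This and the next identities are stated over plain reals, so that [field] and [ring] never meet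
    partial derivatives. Here the equality is the closedness of dalpha. *)
Lemma closed_identity (A B n a c a1 c1 a2 c2 a12 c12 a21 c21 : R) :
  A = (a * c2 - c * a2) * - (2%:R * (a * a1 + c * c1) / n / n) +
   n^-1 * (a * c21 + c2 * a1 - (c * a21 + a2 * c1)) ->
  B = (a * c1 - c * a1) * - (2%:R * (a * a2 + c * c2) / n / n) +
   n^-1 * (a * c12 + c1 * a2 - (c * a12 + a1 * c2)) ->
  a21 = a12 -> c21 = c12 -> n = a ^+ 2 + c ^+ 2 -> n != 0 -> A = B.
Proof. by move=> -> -> -> -> -> n0; field. Qed.

Lemma ratio_identity (D n a a' b b' c c' d d' : R) : D != 0 ->
  n * - ((a * d' + d * a' - (b * c' + c * b')) / D / D) + D^-1 * (2%:R * (a * a' + c * c')) =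
  (2%:R * (a * a' + c * c')) / D - n * (a * d' + d * a' - b * c' - c * b') / D ^+ 2.
Proof. by move=> D0; field. Qed.

Lemma shear_identity (n a a' b b' c c' d d' : R) : n != 0 ->
  (a * b + c * d) * - (2%:R * (a * a' + c * c') / n / n) +
    n^-1 * (a * b' + b * a' + (c * d' + d * c')) =
  (a * b' + b * a' + c * d' + d * c') / n - 2%:R * (a * b + c * d) * (a * a' + c * c') / n ^+ 2.
Proof. by move=> n0; field. Qed.

Lemma divergence_identity (P Q S s a b c a' b' c' s0 s1 s2 : R)
    (Aij Aji Aik Aki Ajk Akj Rij Rji Rik Rki Rjk Rkj : R) :
  P = 3%:R * s * (b * Rki + c' * Aji - (c * Rji + b' * Aki)) +
    (b * c' - c * b') * (3%:R * s0 + s * 0) ->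
  Q = 3%:R * s * (c * Rij + a' * Akj - (a * Rkj + c' * Aij)) +
    (c * a' - a * c') * (3%:R * s1 + s * 0) ->
  S = 3%:R * s * (a * Rjk + b' * Aik - (b * Rik + a' * Ajk)) +
    (a * b' - b * a') * (3%:R * s2 + s * 0) ->
  Aij = Aji -> Aik = Aki -> Ajk = Akj -> Rij = Rji -> Rik = Rki -> Rjk = Rkj ->
  P + Q + S =
  3%:R * (a * (b' * s2 - c' * s1) + b * (c' * s0 - a' * s2) + c * (a' * s1 - b' * s0)).
Proof. by move=> -> -> -> -> -> -> -> -> ->; ring. Qed.

Lemma entry_identity (D a a' c c' : R) :
  - (c / D) * a' + a / D * c' = (a * c' - c * a') / D.
Proof. by ring. Qed.

Lemma entry_identity' (D b d a' c' : R) :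
  d / D * a' + - (b / D) * c' = (d * a' - b * c') / D.
Proof. by ring. Qed.

End PdIs.

(** * The primitive and its exterior derivative *)

Section Flux.
Local Opaque pd.
Context {R : realType}.
Local Notation V := 'rV[R]_3.
Local Notation M3 := 'M[R]_3.
Variables X Y : V -> R.
Implicit Types (q : V) (U : set V) (i j k : 'I_3).

(** For the block j = [[a, b], [c, d]] of the map (X, Y), the next definitions are ad - bc, a^2 +
    c^2, ab + cd, the components of dalpha, then q and u; [flux i j] is the component (i, j) of 3 u
    dalpha /\ dq. *)
Definition jdet q := pd 1 X q * pd 2%:R Y q - pd 2%:R X q * pd 1 Y q.
Definition jcol q := pd 1 X q ^+ 2 + pd 1 Y q ^+ 2.
Definition jdot q := pd 1 X q * pd 2%:R X q + pd 1 Y q * pd 2%:R Y q.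
Definition darg k q := (pd 1 X q * pd k (pd 1 Y) q - pd 1 Y q * pd k (pd 1 X) q) * (jcol q)^-1.
Definition jratio q := jcol q * (jdet q)^-1.
Definition jshear q := jdot q * (jcol q)^-1.
Definition flux i j q := 3%:R * jshear q * (darg i q * pd j jratio q - darg j q * pd i jratio q).

Lemma jcol_neq0 q : jdet q != 0 -> jcol q != 0.
Proof.
apply: contraNneq => /eqP; rewrite /jcol paddr_eq0 ?sqr_ge0// !sqrf_eq0 => /andP[/eqP a0 /eqP c0].
by rewrite /jdet a0 c0 mul0r mulr0 subrr.
Qed.

Variable U : set V.
Hypotheses (oU : open U) (sX : smooth U X) (sY : smooth U Y) (D0 : forall q, U q -> jdet q != 0).

Let sXi i : smooth U (pd i X). Proof. exact: smooth_pd. Qed.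
Let sYi i : smooth U (pd i Y). Proof. exact: smooth_pd. Qed.
Let sXij i j : smooth U (pd i (pd j X)). Proof. by do 2 apply: smooth_pd. Qed.
Let sYij i j : smooth U (pd i (pd j Y)). Proof. by do 2 apply: smooth_pd. Qed.

Lemma smooth_jdet : smooth U jdet.
Proof. by apply: smoothB => //; apply: smoothM. Qed.

Lemma smooth_jcol : smooth U jcol.
Proof. by apply: smoothD => //; apply: smoothX. Qed.

Lemma smooth_jdot : smooth U jdot.
Proof. by apply: smoothD => //; apply: smoothM. Qed.

Lemma smooth_darg k : smooth U (darg k).
Proof.
apply: smoothM => //; first by apply: smoothB => //; apply: smoothM.
apply: smoothV => //; last exact: smooth_jcol.
by move=> q /D0; exact: jcol_neq0.
Qed.

Lemma smooth_jratio : smooth U jratio.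
Proof. apply: smoothM => //; [exact: smooth_jcol|apply: smoothV => //; exact: smooth_jdet]. Qed.

Lemma smooth_jshear : smooth U jshear.
Proof.
apply: smoothM => //; [exact: smooth_jdot|apply: smoothV => //; last exact: smooth_jcol].
by move=> q /D0; exact: jcol_neq0.
Qed.

Lemma smooth_flux i j : smooth U (flux i j).
Proof.
apply: smoothM => //; first by apply: smoothM => //; [exact: smooth_cst|exact: smooth_jshear].
by apply: smoothB => //; apply: smoothM => //; [exact: smooth_darg|exact/smooth_pd/smooth_jratio|
  exact: smooth_darg|exact/smooth_pd/smooth_jratio].
Qed.

Let dXi i k q : U q -> pd_is k (pd i X) q (pd k (pd i X) q).
Proof. exact: pd_is_smooth. Qed.
Let dYi i k q : U q -> pd_is k (pd i Y) q (pd k (pd i Y) q).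
Proof. exact: pd_is_smooth. Qed.

Lemma pd_jcol k q : U q ->
  pd_is k jcol q (2%:R * (pd 1 X q * pd k (pd 1 X) q + pd 1 Y q * pd k (pd 1 Y) q)).
Proof.
move=> Uq; have [df df'] := pd_isD (pd_isX2 (dXi 1 k Uq)) (pd_isX2 (dYi 1 k Uq)).
split; [exact: df|rewrite [LHS]df'].
by move: (pd 1 X q) (pd k (pd 1 X) q) (pd 1 Y q) (pd k (pd 1 Y) q) => a a' c c'; ring.
Qed.

Lemma pd_jdet k q : U q ->
  pd_is k jdet q (pd 1 X q * pd k (pd 2%:R Y) q + pd 2%:R Y q * pd k (pd 1 X) q
    - (pd 2%:R X q * pd k (pd 1 Y) q + pd 1 Y q * pd k (pd 2%:R X) q)).
Proof. by move=> Uq; apply: pd_isB; apply: pd_isM; [exact: dXi|exact: dYi|exact: dXi|exact: dYi]. Qed.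

Lemma pd_jdot k q : U q ->
  pd_is k jdot q (pd 1 X q * pd k (pd 2%:R X) q + pd 2%:R X q * pd k (pd 1 X) q
    + (pd 1 Y q * pd k (pd 2%:R Y) q + pd 2%:R Y q * pd k (pd 1 Y) q)).
Proof. by move=> Uq; apply: pd_isD; apply: pd_isM; [exact: dXi|exact: dXi|exact: dYi|exact: dYi]. Qed.

Lemma pd_jratio k q : U q -> pd k jratio q =
  (2%:R * (pd 1 X q * pd k (pd 1 X) q + pd 1 Y q * pd k (pd 1 Y) q)) / jdet q -
  jcol q * (pd 1 X q * pd k (pd 2%:R Y) q + pd 2%:R Y q * pd k (pd 1 X) q
    - pd 2%:R X q * pd k (pd 1 Y) q - pd 1 Y q * pd k (pd 2%:R X) q) / jdet q ^+ 2.
Proof.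
move=> Uq; have [_ E] := pd_isM (pd_jcol k Uq) (pd_isV (D0 Uq) (pd_jdet k Uq)).
rewrite [LHS]E; apply: ratio_identity; exact: D0.
Qed.

Lemma pd_jshear k q : U q -> pd k jshear q =
  (pd 1 X q * pd k (pd 2%:R X) q + pd 2%:R X q * pd k (pd 1 X) q
    + pd 1 Y q * pd k (pd 2%:R Y) q + pd 2%:R Y q * pd k (pd 1 Y) q) / jcol q -
  2%:R * (pd 1 X q * pd 2%:R X q + pd 1 Y q * pd 2%:R Y q) *
   (pd 1 X q * pd k (pd 1 X) q + pd 1 Y q * pd k (pd 1 Y) q) / jcol q ^+ 2.
Proof.
move=> Uq; have n0 := jcol_neq0 (D0 Uq).
have [_ E] := pd_isM (pd_jdot k Uq) (pd_isV n0 (pd_jcol k Uq)).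
rewrite [LHS]E; exact: shear_identity.
Qed.

(* [darg] is the differential of the argument of [pd 1 X + i pd 1 Y]. *)
Lemma darg_closed i j q : U q -> pd i (darg j) q = pd j (darg i) q.
Proof.
move=> Uq; have n0 := jcol_neq0 (D0 Uq).
have pXX k l : pd_is l (pd k (pd 1 X)) q (pd l (pd k (pd 1 X)) q) by exact: pd_is_smooth.
have pYY k l : pd_is l (pd k (pd 1 Y)) q (pd l (pd k (pd 1 Y)) q) by exact: pd_is_smooth.
have E k l := (pd_isM (pd_isB (pd_isM (dXi 1 l Uq) (pYY k l)) (pd_isM (dYi 1 l Uq) (pXX k l)))
  (pd_isV n0 (pd_jcol l Uq))).2.
have sw f : smooth U f -> pd i (pd j f) q = pd j (pd i f) q.
  by move=> sf; exact: smooth_pdC oU sf Uq.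
exact: (closed_identity (E j i) (E i j) (sw _ (sXi 1)) (sw _ (sYi 1)) erefl n0).
Qed.

(** Since dalpha and dq are closed, only u gets differentiated: d(3 u dalpha /\ dq) = 3 du /\ dalpha
    /\ dq, which is a cyclic permutation of the right-hand side. *)
Lemma flux_divergence i j k q : U q ->
  pd i (flux j k) q + pd j (flux k i) q + pd k (flux i j) q =
  3%:R * (darg i q * (pd j jratio q * pd k jshear q - pd k jratio q * pd j jshear q) +
    darg j q * (pd k jratio q * pd i jshear q - pd i jratio q * pd k jshear q) +
    darg k q * (pd i jratio q * pd j jshear q - pd j jratio q * pd i jshear q)).
Proof.
move=> Uq.
have pa l m : pd_is m (darg l) q (pd m (darg l) q) by exact: (pd_is_smooth m (smooth_darg l)).
have pr l m : pd_is m (pd l jratio) q (pd m (pd l jratio) q).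
  exact: (pd_is_smooth m (smooth_pd l smooth_jratio)).
have ps m : pd_is m jshear q (pd m jshear q) by exact: (pd_is_smooth m smooth_jshear).
have E l m r : pd r (flux l m) q = _ := (pd_isM (pd_isM (pd_is_cst r 3%:R q) (ps r))
  (pd_isB (pd_isM (pa l r) (pr m r)) (pd_isM (pa m r) (pr l r)))).2.
have sw l m : pd l (pd m jratio) q = pd m (pd l jratio) q.
  exact: smooth_pdC oU smooth_jratio Uq.
exact: (divergence_identity (E j k i) (E k i j) (E i j k) (darg_closed j i Uq)
  (darg_closed k i Uq) (darg_closed k j Uq) (sw j i) (sw k i) (sw k j)).
Qed.

(** [iwasawa_identity] converts dalpha, dq and du back to the entries of j^-1 dj. *)
Lemma flux_divergenceE q : U q ->
  pd 0 (flux 1 2%:R) q + pd 1 (flux 2%:R 0) q + pd 2%:R (flux 0 1) q =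
  3%:R * triple (fun k => (pd 1 X q * pd k (pd 1 Y) q - pd 1 Y q * pd k (pd 1 X) q) / jdet q)
    (fun k => (pd 2%:R Y q * pd k (pd 1 X) q - pd 2%:R X q * pd k (pd 1 Y) q) / jdet q
       - (pd 1 X q * pd k (pd 2%:R Y) q - pd 1 Y q * pd k (pd 2%:R X) q) / jdet q)
    (fun k => (pd 2%:R Y q * pd k (pd 2%:R X) q - pd 2%:R X q * pd k (pd 2%:R Y) q) / jdet q).
Proof.
move=> Uq; rewrite (iwasawa_identity _ _ _ _ (n := jcol q)) //; last 2 first.
- exact: D0.
- exact/jcol_neq0/D0.
rewrite flux_divergence// !pd_jratio// !pd_jshear//.
Qed.

End Flux.

Section Density.
Context {R : realType}.
Local Notation V := 'rV[R]_3.
Local Notation M3 := 'M[R]_3.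
Implicit Types (q : V) (U : set V) (i j k : 'I_3).

Lemma jacobian_fibred (f : V -> V) (X Y : V -> R) q : 
  differentiable X q -> differentiable Y q ->
  (\forall x \near q, f x = row3 (x 0 0) (X x) (Y x)) ->
  ('J f q)^T = fibred_jac (fun k => pd k X q) (fun k => pd k Y q).
Proof.
move=> dX dY nf.
have df : differentiable f q.
  apply: differentiable_rV => j.
  have [h dh hE] : exists2 h : V -> R, differentiable h q & forall x : V, row3 (x 0 0) (X x) (Y x) 0 j = h x.
    move: j; apply: ord3P; [exists (fun x => x 0 0)|exists X|exists Y] => //.
    - exact: differentiable_coordinate.
    - by move=> x; rewrite row3_0.
    - by move=> x; rewrite row3_1.
    - by move=> x; rewrite row3_2.
  apply: near_eq_differentiable dh.
  by apply: filterS nf => x fx; rewrite fx hE.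
have pf i j : ('J f q) j i = pd j (fun x => f x 0 i) q.
  have := deriveEjacobian (evec j) df; rewrite derive_mx; last exact: diff_derivable.
  by move=> /matrixP/(_ 0 i); rewrite -rowE !mxE => <-.
apply/matrixP => i j; rewrite [LHS]mxE [RHS]mxE pf.
move: i; apply: ord3P => /=.
- by rewrite -(pd_coord q j 0); apply: near_eq_pd; apply: filterS nf => x ->; rewrite row3_0.
- by apply: near_eq_pd; apply: filterS nf => x ->; rewrite row3_1.
- by apply: near_eq_pd; apply: filterS nf => x ->; rewrite row3_2.
Qed.

Lemma derive_fibred_jac U (X Y : V -> R) q k : smooth U X -> smooth U Y -> U q ->
  'D_(delta_mx 0 k) (fun x => fibred_jac (fun j => pd j X x) (fun j => pd j Y x)) q =
  \matrix_(i, j) nth 0 [:: 0; pd k (pd j X) q; pd k (pd j Y) q] i.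
Proof.
move=> sX sY Uq.
have dX j : derivable (pd j X) q (delta_mx 0 k).
  by apply: diff_derivable; exact: smooth_dif (smooth_pd j sX) Uq.
have dY j : derivable (pd j Y) q (delta_mx 0 k).
  by apply: diff_derivable; exact: smooth_dif (smooth_pd j sY) Uq.
have E i j : (fun x => fibred_jac (fun j => pd j X x) (fun j => pd j Y x) i j) =
    nth (fun=> 0) [:: (fun=> (j == 0)%:R); pd j X; pd j Y] i.
  by apply/funext => x; rewrite mxE; move: i; apply: ord3P.
rewrite derive_mx; last first.
  apply/derivable_mxP => i j; rewrite E; move: i; apply: ord3P => //=.
apply/matrixP => i j; rewrite !mxE E; move: i; apply: ord3P => //=.
exact: derive_cst.
Qed.

Lemma density_divergence psi psi' g U (X Y : V -> R) q : open U -> U q ->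
  smooth U X -> smooth U Y -> (forall x, U x -> jdet X Y x != 0) ->
  (forall x, U x -> in_coord psi psi' g x = row3 (x 0 0) (X x) (Y x)) ->
  W_density psi psi' g q =
  pd 0 (flux X Y 1 2%:R) q + pd 1 (flux X Y 2%:R 0) q + pd 2%:R (flux X Y 0 1) q.
Proof.
move=> oU Uq sX sY D0 gE.
have JE x : U x -> J_B3 psi psi' g x = fibred_jac (fun j => pd j X x) (fun j => pd j Y x).
  move=> Ux; apply: jacobian_fibred; [exact: smooth_dif sX Ux|exact: smooth_dif sY Ux|].
  by apply: filterS gE _; exact: open_nbhs_nbhs.
rewrite (flux_divergenceE oU sX sY D0 Uq) /W_density /theta_B3 /dmx mulmx_form1 trace_cube; congr (_ * _).
have dJ k : 'D_(delta_mx 0 k) (J_B3 psi psi' g) q =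
    \matrix_(i, j) nth 0 [:: 0; pd k (pd j X) q; pd k (pd j Y) q] i.
  rewrite -(derive_fibred_jac k sX sY Uq); apply: near_eq_derive.
  by apply: filterS JE _; exact: open_nbhs_nbhs.
rewrite (JE _ Uq) !dJ.
have [u [v ->]] := @fibred_invmx _ (fun j => pd j X q) (fun j => pd j Y q) _ erefl (D0 _ Uq).
set K := \matrix_(i, j) _.
rewrite (trace_fibred (t := fun k => K *m \matrix_(i, j) nth 0 [:: 0; pd k (pd j X) q; pd k (pd j Y) q] i)); last first.
  move=> k j; rewrite mxE sum_ord3 [K 0 1]mxE [K 0 2%:R]mxE !mul0r !addr0.
  by rewrite [X in _ * X]mxE mulr0.
congr triple; apply/funext => k; rewrite !mxE !sum_ord3 !mxE /= mulr0 add0r ?mulr0 ?add0r.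
- exact: entry_identity.
- exact: (congr2 (fun x y : R => x - y) (entry_identity' _ _ _ _ _) (entry_identity _ _ _ _ _)).
- exact: entry_identity'.
Qed.

End Density.

(** * Decay of the primitive *)

Section FluxDecay.
Local Opaque pd.
Context {R : realType}.
Local Notation V := 'rV[R]_3.
Implicit Types (q : V) (i j k : 'I_3) (f h : V -> R).
Variables (U : set V) (r1 : R) (X Y : V -> R).
Hypotheses (oU : open U) (r10 : 0 < r1) (cU : ctube r1 `<=` U).
Hypotheses (sX : smooth U X) (sY : smooth U Y).
Hypothesis D0 : forall q, U q -> jdet X Y q != 0.
Hypothesis rX : alv (rapid U (tube r1)) (fun q => X q - q 0 1).
Hypothesis rY : alv (rapid U (tube r1)) (fun q => Y q - q 0 2%:R).

Local Notation T := (tube r1).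
Let TU : T `<=` U. Proof. by move=> q /tube_sub /cU. Qed.
Let RI := rapid_ideal oU TU.
Let MI := moderate_ideal oU TU.

Let rapid_mod f : alv (rapid U T) f -> alv (moderate U T) f.
Proof. by apply: alv_sub => h; exact: rapid_moderate. Qed.

Let mod_cst (c : R) : alv (moderate U T) (fun=> c).
Proof. exact: alv_moderate_cst. Qed.

Let near_mod f (c : R) : alv (rapid U T) (fun q => f q - c) -> alv (moderate U T) f.
Proof.
move=> H; apply: (alv_ext MI _ (alvD MI (rapid_mod H) (mod_cst c))) => q _.
by rewrite subrK.
Qed.

Let rapidN f : alv (rapid U T) f -> alv (rapid U T) (fun q => - f q).
Proof.
move=> H; apply: (alv_ext RI _ (alvM RI H (mod_cst (-1)))) => q _.
by rewrite mulrN1.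
Qed.

Let rapidB f h : alv (rapid U T) f -> alv (rapid U T) h -> alv (rapid U T) (fun q => f q - h q).
Proof. by move=> Hf Hh; apply: (alvD RI) => //; exact: rapidN. Qed.

Let rapid_jet Z j i : smooth U Z -> alv (rapid U T) (fun q => Z q - q 0 j) ->
  alv (rapid U T) (fun q => pd i Z q - (i == j)%:R).
Proof.
move=> sZ rZ; apply: (alv_ext RI _ (alv_pd i rZ)) => q Uq.
have dZ : pd_is i Z q (pd i Z q) := pd_is_smooth i sZ Uq.
have dj : pd_is i (fun q : V => q 0 j) q (i == j)%:R.
  by split; [exact: differentiable_coordinate|exact: pd_coord].
exact: (pd_isB dZ dj).2.
Qed.

Let rapid_jet2 Z j i k : smooth U Z -> alv (rapid U T) (fun q => Z q - q 0 j) ->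
  alv (rapid U T) (pd k (pd i Z)).
Proof.
move=> sZ rZ; apply: (alv_ext RI _ (alv_pd k (rapid_jet i sZ rZ))) => q Uq.
by have [_ ->] := pd_isB (pd_is_smooth k (smooth_pd i sZ) Uq) (pd_is_cst k (i == j)%:R q); rewrite subr0.
Qed.

Let a1 : alv (rapid U T) (fun q => pd 1 X q - 1). Proof. exact: (rapid_jet 1 sX rX). Qed.
Let d1 : alv (rapid U T) (fun q => pd 2%:R Y q - 1). Proof. exact: (rapid_jet 2%:R sY rY). Qed.
Let b0 : alv (rapid U T) (pd 2%:R X).
Proof. by apply: (alv_ext RI _ (rapid_jet 2%:R sX rX)) => q _; rewrite subr0. Qed.
Let c0 : alv (rapid U T) (pd 1 Y).
Proof. by apply: (alv_ext RI _ (rapid_jet 1 sY rY)) => q _; rewrite subr0. Qed.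
Let am := near_mod a1.
Let dm := near_mod d1.

Lemma rapid_jdet : alv (rapid U T) (fun q => jdet X Y q - 1).
Proof.
apply: (alv_ext RI _ (rapidB (alvD RI (alvM RI a1 dm) d1) (alvM RI b0 (rapid_mod c0)))) => q _.
by rewrite /jdet; ring.
Qed.

Lemma rapid_jcol : alv (rapid U T) (fun q => jcol X Y q - 1).
Proof.
apply: (alv_ext RI _ (alvD RI (alvD RI (alvM RI a1 am) a1) (alvM RI c0 (rapid_mod c0)))) => q _.
by rewrite /jcol; ring.
Qed.

Lemma rapid_jdot : alv (rapid U T) (jdot X Y).
Proof.
by apply: (alv_ext RI _ (alvD RI (alvM RI b0 am) (alvM RI c0 dm))) => q _; rewrite /jdot; ring.
Qed.

Let inv_mod f : smooth U f -> (forall q, U q -> f q != 0) ->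
  alv (rapid U T) (fun q => f q - 1) -> alv (moderate U T) (fun q => (f q)^-1).
Proof.
move=> sf f0 rf; have [c cp fc] := lower_bound oU cU sf ltr01 (fun q cq => f0 q (cU cq)) (alv0 rf).
exact: (alv_moderateV oU TU cp f0 fc (near_mod rf)).
Qed.

Let jdetV : alv (moderate U T) (fun q => (jdet X Y q)^-1).
Proof. exact: inv_mod (smooth_jdet oU sX sY) D0 rapid_jdet. Qed.

Let jcolV : alv (moderate U T) (fun q => (jcol X Y q)^-1).
Proof.
by apply: inv_mod (smooth_jcol oU sX sY) _ rapid_jcol => q /D0; exact: jcol_neq0.
Qed.

(** j differs from the identity by a rapidly decreasing matrix. So [jdet] and [jcol] are bounded
    below and have moderate inverses, [jratio] is moderate, and the factors [jshear] and [darg] are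
    rapid. *)
Lemma rapid_flux i j : alv (rapid U T) (flux X Y i j).
Proof.
have rs : alv (rapid U T) (jshear X Y) := alvM RI rapid_jdot jcolV.
have rd k : alv (rapid U T) (darg X Y k).
  have H := rapidB (alvM RI (rapid_jet2 1 k sY rY) am) (alvM RI (rapid_jet2 1 k sX rX) (rapid_mod c0)).
  apply: (alv_ext RI _ (alvM RI H jcolV)) => q _.
  exact: (congr2 (fun x y : R => (x - y) * (jcol X Y q)^-1) (mulrC _ _) (mulrC _ _)).
have mr : alv (moderate U T) (jratio X Y) := alvM MI (near_mod rapid_jcol) jdetV.
have H := rapidB (alvM RI (rd i) (alv_pd j mr)) (alvM RI (rd j) (alv_pd i mr)).
have H2 := alvM RI H (alvM MI (mod_cst 3) (rapid_mod rs)).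
by apply: (alv_ext RI _ H2) => q _; rewrite /flux [in RHS]mulrC.
Qed.

End FluxDecay.

(** * The coordinate expression of a fibred diffeomorphism *)

Section FluxLocality.
Local Opaque pd.
Context {R : realType}.
Local Notation V := 'rV[R]_3.
Implicit Types (q : V) (i j k : 'I_3) (f h X Y : V -> R) (U : set V).

Lemma pd_line_eq f h q i : differentiable f q -> differentiable h q ->
  (\forall s \near (0 : R), f (s *: evec i + q) = h (s *: evec i + q)) -> pd i f q = pd i h q.
Proof.
move=> df dh H; apply/eqP; rewrite -subr_eq0; apply/eqP.
have [_ <-] : pd_is i (fun x => f x - h x) q (pd i f q - pd i h q) by apply: pd_isB; split.
by apply: pd_line0; apply: filterS H => s ->; rewrite subrr.
Qed.

(** Only transverse derivatives enter [jdet] and [jdot], so agreement with the coordinates along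
    lines of the slice suffices. It applies both at radius 0 and far out. *)
Lemma fibre_jdet X Y q : differentiable X q -> differentiable Y q ->
  (forall i, i != 0 -> \forall s \near (0 : R), X (s *: evec i + q) = (s *: evec i + q) 0 1 /\
     Y (s *: evec i + q) = (s *: evec i + q) 0 2%:R) ->
  jdet X Y q = 1 /\ jdot X Y q = 0.
Proof.
move=> dX dY H.
have pX i : i != 0 -> pd i X q = (i == 1)%:R.
  move=> i0; rewrite -(pd_coord q); apply: pd_line_eq => //; first exact: differentiable_coordinate.
  by apply: filterS (H i i0) => s [].
have pY i : i != 0 -> pd i Y q = (i == 2%:R)%:R.
  move=> i0; rewrite -(pd_coord q); apply: pd_line_eq => //; first exact: differentiable_coordinate.
  by apply: filterS (H i i0) => s [].
by rewrite /jdet /jdot !pX // !pY //= !mulr1 !mulr0 subr0 addr0.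
Qed.

Lemma flux_jdot0 X Y i j q : jdot X Y q = 0 -> flux X Y i j q = 0.
Proof. by move=> d0; rewrite /flux /jshear d0 mul0r mulr0 mul0r. Qed.

Lemma flux_local U X Y X' Y' i j q : open U -> U q ->
  (forall x, U x -> X x = X' x) -> (forall x, U x -> Y x = Y' x) ->
  flux X Y i j q = flux X' Y' i j q.
Proof.
move=> oU Uq XE YE.
have pE f h k : (forall x, U x -> f x = h x) -> forall x, U x -> pd k f x = pd k h x.
  by move=> fh x Ux; exact: open_eq_pd oU fh Ux.
have pX k x : U x -> pd k X x = pd k X' x by exact: pE.
have pY k x : U x -> pd k Y x = pd k Y' x by exact: pE.
have nE x : U x -> jcol X Y x = jcol X' Y' x by move=> Ux; rewrite /jcol pX// pY.
have rE x : U x -> jratio X Y x = jratio X' Y' x.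
  by move=> Ux; rewrite /jratio nE// /jdet (pX 1)// (pX 2%:R)// (pY 1)// (pY 2%:R).
have aE k : darg X Y k q = darg X' Y' k q.
  have gen (a a1 c c1 ak ak1 ck ck1 n n1 : R) : a = a1 -> c = c1 -> ak = ak1 -> ck = ck1 -> n = n1 ->
    (a * ck - c * ak) * n^-1 = (a1 * ck1 - c1 * ak1) * n1^-1 by move=> -> -> -> -> ->.
  exact: (gen _ _ _ _ _ _ _ _ _ _ (pX 1 q Uq) (pY 1 q Uq) (pE _ _ k (pX 1) q Uq) (pE _ _ k (pY 1) q Uq) (nE q Uq)).
have sE : jshear X Y q = jshear X' Y' q.
  have gen (a a1 c c1 b b1 d d1 n n1 : R) : a = a1 -> b = b1 -> c = c1 -> d = d1 -> n = n1 ->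
    (a * b + c * d) * n^-1 = (a1 * b1 + c1 * d1) * n1^-1 by move=> -> -> -> -> ->.
  exact: (gen _ _ _ _ _ _ _ _ _ _ (pX 1 q Uq) (pX 2%:R q Uq) (pY 1 q Uq) (pY 2%:R q Uq) (nE q Uq)).
by rewrite /flux sE !aE (pE _ _ i rE q Uq) (pE _ _ j rE q Uq).
Qed.

Lemma triple0 (x y z : 'I_3 -> R) : x 0 = 0 -> y 0 = 0 -> z 0 = 0 -> triple x y z = 0.
Proof. by rewrite /triple => -> -> ->; rewrite !(mul0r, mulr0, subrr, addr0). Qed.

(** All entries of dj lose their radial component, and three covectors in two variables have zero
    determinant. *)
Lemma divergence_radial U X Y q : open U -> smooth U X -> smooth U Y ->
  (forall x, U x -> jdet X Y x != 0) -> U q ->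
  (forall x, U x -> pd 0 X x = 0) -> (forall x, U x -> pd 0 Y x = 0) ->
  pd 0 (flux X Y 1 2%:R) q + pd 1 (flux X Y 2%:R 0) q + pd 2%:R (flux X Y 0 1) q = 0.
Proof.
move=> oU sX sY D0 Uq X0 Y0; rewrite (flux_divergenceE oU sX sY D0 Uq).
have p0 Z i : smooth U Z -> (forall x, U x -> pd 0 Z x = 0) -> pd 0 (pd i Z) q = 0.
  move=> sZ Z0; rewrite (smooth_pdC _ _ oU sZ Uq) (open_eq_pd i oU Z0 Uq); exact: pd_cst.
have X1 := p0 X 1 sX X0; have X2 := p0 X 2%:R sX X0.
have Y1 := p0 Y 1 sY Y0; have Y2 := p0 Y 2%:R sY Y0.
have gen (a c x y D : R) : x = 0 -> y = 0 -> (a * x - c * y) / D = 0.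
  by move=> -> ->; rewrite !mulr0 subrr mul0r.
rewrite triple0; [by rewrite mulr0|exact: gen| |exact: gen].
by apply/eqP; rewrite subr_eq0; apply/eqP; transitivity (0 : R); [|symmetry]; exact: gen.
Qed.

End FluxLocality.

Section CoordinateFunctions.
Context {R : realType}.
Local Notation V := 'rV[R]_3.
Implicit Types (p u v w q s : V).
Variables (psi psi' g g' : V -> V) (b : R -> V -> V).
Hypothesis hpsi : diffeo_pair sphere psi psi'.
Hypothesis hg : diffeo_pair cball g g'.
Hypothesis bci : forall rho : R, 0 <= rho <= 1 -> Diff_ci psi (b rho).
Hypothesis gb : forall (rho : R) p, 0 <= rho <= 1 -> sphere p ->
  g (rho *: p) = rho *: b rho p.

Let gsmooth : smooth_on cball g. Proof. by case: hg => [[]]. Qed.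

Local Notation bs q := (bet psi psi' g (q 0 0) (sig q)).
Local Notation e := (dev psi psi' g sig).

Let sS i : smooth setT (fun q : V => sig q 0 i). Proof. exact: smooth_sig openT. Qed.
Let se j : smooth slab (e j). Proof. exact: (smooth_dev hpsi gsmooth bci gb sS sig_sphere). Qed.

(** The stereographic denominator of the image divided by that of [sig q] ([bet_third]). *)
Definition hgt q : R := 1 - wgt q / 2 * e 2%:R q.
(** Stereographic coordinate of the image, written as the original coordinate plus a term carrying a
    factor linear in the deviations, so that its decay is visible. Index [i] is the coordinate on
    the sphere that corresponds to [j] in the plane. *)
Definition chart (i j : 'I_3) q : R := q 0 j + wgt q / 2 * (e i q + q 0 j * e 2%:R q) * (hgt q)^-1.
Local Notation X := (chart 0 1).
Local Notation Y := (chart 1 2%:R).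

Lemma bet_third q : 1 - bs q 0 2%:R = 2 / wgt q * hgt q.
Proof.
have w0 := wgt_neq0 q; have := sig_third q.
rewrite /hgt /dev; move: (bs q 0 2%:R) (sig q 0 2%:R) => x y yE.
have -> : y = 1 - 2 / wgt q by rewrite -yE; ring.
by move: (wgt q) w0 => w w0; field.
Qed.

(** A zero would place the image of [sig q] at the north pole, which only the north pole reaches. *)
Lemma hgt_neq0 q : 0 <= q 0 0 <= 1 -> hgt q != 0.
Proof.
move=> q01; apply/eqP => h0; have := bet_third q; rewrite h0 mulr0 => /eqP; rewrite subr_eq0 => /eqP b1.
apply: (@sig_neq_north _ q); apply: (bet_north hpsi bci gb q01 (sig_sphere q)).
apply: sphere_north => //; apply: (bet_sphere hpsi bci gb); last exact: sig_sphere.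
by case/andP: q01 => q0 ->; rewrite (le_trans _ q0)// oppr_le0.
Qed.

Lemma stereo_bet q : hgt q != 0 -> stereo (bs q) = (X q, Y q).
Proof.
move=> h0; have w0 := wgt_neq0 q; rewrite /stereo bet_third.
have b0 : bs q 0 0 = q 0 1 *+ 2 / wgt q + e 0 q.
  have <- : sig q 0 0 = q 0 1 *+ 2 / wgt q by rewrite sigE row3E.
  by rewrite /dev addrC subrK.
have b1 : bs q 0 1 = q 0 2%:R *+ 2 / wgt q + e 1 q.
  have <- : sig q 0 1 = q 0 2%:R *+ 2 / wgt q by rewrite sigE row3E.
  by rewrite /dev addrC subrK.
have key (x f w d : R) : w != 0 -> 1 - w / 2 * d != 0 ->
    (x *+ 2 / w + f) / (2 / w * (1 - w / 2 * d)) = x + w / 2 * (f + x * d) * (1 - w / 2 * d)^-1.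
  move=> W0 H0; have -> : x *+ 2 = 2 * x by ring.
  have -> : x + w / 2 * (f + x * d) * (1 - w / 2 * d)^-1 =
     ((x * (1 - w / 2 * d) + w / 2 * (f + x * d))) / (1 - w / 2 * d) by rewrite mulrDl mulfK.
  have -> : x * (1 - w / 2 * d) + w / 2 * (f + x * d) = w / 2 * (x * 2 / w + f) by field.
  by rewrite invfM invf_div [2 * x]mulrC; ring.
by rewrite b0 b1; congr pair; exact: key.
Qed.

(** Nonvanishing of [hgt] is established at nonnegative radii; [dom] is an open set around them that
    also covers slightly negative ones. *)
Definition dom : set V := [set q | slab q /\ hgt q != 0].

Lemma smooth_hgt : smooth slab hgt.
Proof.
apply: smoothB; [exact: open_slab|exact: smooth_cst open_slab 1|].
apply: smoothM; [exact: open_slab| |exact: se].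
apply: smoothM; [exact: open_slab|exact: smooth_wgt open_slab|exact: smooth_cst open_slab _].
Qed.

Lemma open_neq0 (U : set V) f : open U -> smooth U f -> open [set q | U q /\ f q != 0].
Proof.
move=> oU sf; rewrite openE => q [Uq fq]; apply: filterI; first exact: (open_nbhs_nbhs (conj oU Uq)).
have c : {for q, continuous f} := smooth_continuous sf Uq.
exact: (cvgr_neq0 (f q) c fq).
Qed.

Lemma open_dom : open dom.
Proof. exact: open_neq0 open_slab smooth_hgt. Qed.

Lemma ctube_dom (r1 : R) : r1 < 1 -> ctube r1 `<=` dom.
Proof.
move=> r11 q /andP[q0 q1]; have q11 := le_lt_trans q1 r11; split.
  by rewrite /slab /= q11 andbT (lt_le_trans _ q0)// oppr_lt0.
by apply: hgt_neq0; rewrite q0 ltW.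
Qed.

Lemma smooth_chart i j : smooth dom (chart i j).
Proof.
have oD := open_dom; have sub : dom `<=` slab by move=> q [].
have sw : smooth dom (fun q => wgt q / 2).
  by apply: smoothM => //; [exact: smooth_wgt|exact: smooth_cst].
have sE k : smooth dom (e k) := smooth_sub sub (@se k).
apply: smoothD => //; first exact: smooth_coord.
apply: smoothM => //; last by apply: smoothV => //; [move=> q []|exact: smooth_sub smooth_hgt].
apply: smoothM => //; apply: smoothD => //; apply: smoothM => //; exact: smooth_coord.
Qed.

Lemma rapid_chart (r1 : R) i j : 0 < r1 < 1 ->
  alv (rapid dom (tube r1)) (fun q => chart i j q - q 0 j).
Proof.
move=> r01; have /andP[r0 r11] := r01.
have oD := open_dom; have cD := ctube_dom r11.
have tD : tube r1 `<=` dom by move=> q /tube_sub /cD.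
have RI := rapid_ideal oD tD; have MI := moderate_ideal oD tD.
have sub : dom `<=` slab by move=> q [].
have re k : alv (rapid dom (tube r1)) (e k).
  apply: alv_sub (rapid_dev_sig hpsi gsmooth bci gb k r01) => h [dh H]; split => // q /sub; exact: dh.
have mc k : alv (moderate dom (tube r1)) (fun q => q 0 k).
  apply: alv_moderate_coord => //; exists r1 => q /andP[q0 q1].
  by rewrite ger0_norm// ltW.
have mcst (c : R) : alv (moderate dom (tube r1)) (fun=> c) by exact: alv_moderate_cst.
have mw : alv (moderate dom (tube r1)) (fun q => wgt q / 2).
  apply: (alvM MI _ (mcst _)); apply: (alvD MI (mcst 1)).
  by apply: (alvD MI); exact: (alvX MI (@moderate_cst _ _ _)).
have rh : alv (rapid dom (tube r1)) (fun q => hgt q - 1).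
  apply: (alv_ext RI _ (alvM RI (alvM RI (re 2%:R) mw) (mcst (-1)))) => q _.
  by rewrite /hgt; ring.
have sh : smooth dom hgt := smooth_sub sub smooth_hgt.
have h0 q : dom q -> hgt q != 0 by case.
have [c cp hc] := lower_bound oD cD sh ltr01 (fun q cq => h0 q (cD q cq)) (alv0 rh).
have mh : alv (moderate dom (tube r1)) hgt.
  have rmh : alv (moderate dom (tube r1)) (fun q => hgt q - 1).
    by apply: alv_sub rh => h; exact: rapid_moderate.
  by apply: (alv_ext MI _ (alvD MI rmh (mcst 1))) => q _; rewrite subrK.
have mhV := alv_moderateV oD tD cp h0 hc mh.
have H := alvM RI (alvM RI (alvD RI (re i) (alvM RI (re 2%:R) (mc j))) mw) mhV.
apply: (alv_ext RI _ H) => q _; rewrite /chart.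
by move: (hgt q)^-1 (wgt q / 2) (e i q) (e 2%:R q) (q 0 j) => *; ring.
Qed.

Lemma chart_e0 i j q : e i q = 0 -> e 2%:R q = 0 -> chart i j q = q 0 j.
Proof. by move=> ei e2; rewrite /chart ei e2 mulr0 addr0 mulr0 mul0r addr0. Qed.

Lemma chart_0 i j q : q 0 0 = 0 -> chart i j q = q 0 j.
Proof.
move=> q0; have e0 k : e k q = 0 by rewrite /dev q0 (bet0 g hpsi (sig_sphere q)) subrr.
exact: chart_e0.
Qed.

Lemma chart_far (rho : R) : 0 < rho <= 1 -> exists2 M : R, 0 < M & forall q, q 0 0 = rho ->
  M <= `|q 0 1| \/ M <= `|q 0 2%:R| -> forall i j, chart i j q = q 0 j.
Proof.
move=> r01; have /nbhs_ballP[r /= r0 Hr] := bet_germ hpsi bci gb r01.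
(* Up to sign the coordinates of [north - sig q] are 2x, 2y and 2 divided by [wgt q]. If the larger
   of |x| and |y| is some [m >= 4 / r], then [wgt q >= 1 + m ^+ 2] makes all three at most
   [r / 2]. *)
exists (4 / r); first by rewrite divr_gt0.
move=> q q0 qM i j.
have e0 k : e k q = 0; last exact: chart_e0.
rewrite /dev q0 Hr ?subrr//; last exact: sig_sphere.
rewrite -ball_normE /=.
have w0 := wgt_gt0 q.
have [m mM mw] : exists2 m : R, 4 / r <= m & [/\ `|q 0 1| <= m, `|q 0 2%:R| <= m & 1 + m ^+ 2 <= wgt q].
  exists (Num.max `|q 0 1| `|q 0 2%:R|); first by rewrite le_max; case: qM => ->; rewrite ?orbT.
  rewrite !le_max !lexx orbT /wgt /nrm2; split => //; rewrite lerD2l.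
  by rewrite /Num.max; case: ifP => _; rewrite real_normK ?num_real// ?lerDr ?lerDl sqr_ge0.
have [m1 m2 mw'] := mw.
have mp : 0 < m by apply: lt_le_trans mM; rewrite divr_gt0.
have r4 : 4 <= r * m by rewrite -ler_pdivrMl// mulrC.
have r4m : 2 * m <= r / 2 * (1 + m ^+ 2) /\ 2 <= r / 2 * (1 + m ^+ 2).
  have sq := sqr_ge0 (m - 1); rewrite expr2 in sq *; split; nra.
have bnd (x : R) : `|x| <= r / 2 * (1 + m ^+ 2) -> `|x / wgt q| <= r / 2.
  move=> xm; rewrite normrM normfV (gtr0_norm w0) ler_pdivrMr//; apply: le_trans xm _.
  by rewrite ler_wpM2l// divr_ge0// ltW.
have bnd2 (x : R) : `|x| <= m -> `|0 - x *+ 2 / wgt q| <= r / 2.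
  move=> xm; rewrite sub0r normrN; apply: bnd; rewrite normrMn -[_ *+ 2]mulr_natl.
  by apply: le_trans r4m.1; rewrite ler_wpM2l.
apply: le_lt_trans (_ : r / 2 < r); last by rewrite ltr_pdivrMr// ltr_pMr// ltr1n.
apply: normr_rV_le; first by rewrite divr_ge0// ltW.
have co l : (north - sig q) 0 l = north 0 l - sig q 0 l by rewrite !mxE.
apply: ord3P; rewrite co.
- by rewrite sigE !row3E; exact: bnd2.
- by rewrite sigE !row3E; exact: bnd2.
- by rewrite [north 0 _]row3_2 sig_third; apply: bnd; rewrite ger0_norm//; case: r4m.
Qed.

Lemma of_coord_sig q : of_coord psi q = q 0 0 *: psi (sig q).
Proof. by []. Qed.

Lemma in_coord_chart q : 0 < q 0 0 < 1 ->
  in_coord psi psi' g q = row3 (q 0 0) (X q) (Y q).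
Proof.
move=> /andP[q0 q1]; have q01 : 0 <= q 0 0 <= 1 by rewrite !ltW.
have sp : sphere (psi (sig q)) := psi_sphere hpsi (sig_sphere q).
have sb : sphere (b (q 0 0) (psi (sig q))) := b_sphere bci q01 sp.
rewrite /in_coord /= /to_coord of_coord_sig gb//.
have -> : enorm (q 0 0 *: b (q 0 0) (psi (sig q))) = q 0 0.
  by rewrite enormZ sb mulr1 gtr0_norm.
rewrite scalerA mulVf ?gt_eqF// scale1r.
have := stereo_bet (hgt_neq0 q01); rewrite /bet (kap_pos hpsi gb); last exact: sig_sphere.
  by move=> ->.
by rewrite q0 ltW.
Qed.

Definition cyl : set V := [set q : V | 0 < q 0 0 < 1].

Lemma open_cyl : open cyl.
Proof.
have -> : cyl = (fun q : V => q 0 0) @^-1` `]0, 1[%classic.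
  by apply/seteqP; split => q; rewrite /cyl /= in_itv.
apply: open_comp; last exact: interval_open.
by move=> q _; exact: (differentiable_continuous (differentiable_coordinate q 0)).
Qed.

(** The inverse diffeomorphism read in the chart, its value being kept on the sphere so that no
    stereographic denominator enters its smoothness. *)
Definition back (w : V) : V := psi' ((w 0 0)^-1 *: g' (w 0 0 *: psi (sig w))).

Lemma smooth_back j : smooth cyl (fun w => back w 0 j).
Proof.
have [[_ sg'] _ g'K _] := hg; have [[spsi spsi'] _ _ _] := hpsi.
have cs : cyl `<=` slab.
  by move=> w /andP[w0 w1]; rewrite /slab /= w1 andbT (lt_trans _ w0)// oppr_lt0.
have sinner i : smooth cyl (fun w => (w 0 0 *: psi (sig w)) 0 i).
  apply: (smooth_sub cs); exact: (smooth_ray_chart hpsi sS sig_sphere).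
have souter i : smooth cyl (fun w => g' (w 0 0 *: psi (sig w)) 0 i).
  apply: (smooth_on_comp i open_cyl sg') => // w /andP[w0 w1].
  apply: cball_scale; first exact: (psi_sphere hpsi (sig_sphere w)).
  by rewrite gtr0_norm// ltW.
apply: (smooth_on_comp j open_cyl spsi') => [w /andP[w0 w1]|i].
  have w01 : 0 <= w 0 0 <= 1 by rewrite !ltW.
  have [p0 sp0 E] := b_surj bci w01 (psi_sphere hpsi (sig_sphere w)).
  rewrite -E -gb// g'K; last by apply: cball_scale => //; rewrite gtr0_norm// ltW.
  by rewrite scalerA mulVf ?gt_eqF// scale1r.
apply: (smooth_ext_open open_cyl _ (smoothM open_cyl (smoothV open_cyl _ (smooth_coord open_cyl 0)) (souter i))).
  by move=> w _; rewrite mxE.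
by move=> w /andP[w0 _]; rewrite gt_eqF.
Qed.

Lemma back_chart q : 0 < q 0 0 < 1 -> back (row3 (q 0 0) (X q) (Y q)) = sig q.
Proof.
move=> /andP[q0 q1]; have q01 : 0 <= q 0 0 <= 1 by rewrite !ltW.
have sp : sphere (psi (sig q)) := psi_sphere hpsi (sig_sphere q).
have [_ _ g'K _] := hg.
have h0 := hgt_neq0 q01.
have sb : sphere (bs q).
  by apply: (bet_sphere hpsi bci gb); [|exact: sig_sphere]; rewrite !ltW// (lt_trans _ q0)// oppr_lt0.
have bn : bs q <> north.
  by move=> H; apply: (@sig_neq_north _ q); exact: (bet_north hpsi bci gb q01 (sig_sphere q) H).
have E : sig (row3 (q 0 0) (X q) (Y q)) = bs q.
  by rewrite /sig !row3E; have := stereo_invK sb bn; rewrite stereo_bet.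
rewrite /back E row3_0.
have kE : kap psi g (q 0 0) (sig q) = b (q 0 0) (psi (sig q)).
  by apply: (kap_pos hpsi gb); [rewrite q0 ltW|exact: sig_sphere].
have sk : sphere (b (q 0 0) (psi (sig q))) := b_sphere bci q01 sp.
rewrite [psi (bs q)](_ : _ = b (q 0 0) (psi (sig q))); last by rewrite /bet kE (psi'K hpsi sk).
rewrite -gb// g'K; last by apply: cball_scale => //; rewrite gtr0_norm// ltW.
by rewrite scalerA mulVf ?gt_eqF// scale1r (psiK hpsi)//; exact: sig_sphere.
Qed.

(* The inverse of the diffeomorphism, read in the chart, is a left inverse of
   the chart map, so that the chain rule forbids a singular Jacobian. *)
Lemma chart_jdet q : cyl q -> jdet X Y q != 0.
Proof.
move=> cq; have /andP[q0 q1] := cq.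
pose F (x : V) : V := row3 (x 0 0) (X x) (Y x).
have bF x : cyl x -> back (F x) = sig x by exact: back_chart.
have cF x : cyl x -> cyl (F x) by rewrite /cyl /= row3_0.
have dq : dom q by split; [rewrite /slab /= q1 andbT (lt_trans _ q0)// oppr_lt0|apply: hgt_neq0; rewrite !ltW].
have dX : differentiable X q := smooth_dif (smooth_chart 0 1) dq.
have dY : differentiable Y q := smooth_dif (smooth_chart 1 2%:R) dq.
pose A i w := back w 0 i * (1 - back w 0 2%:R)^-1.
have dA i : differentiable (A i) (F q).
  apply: differentiableM; first exact: smooth_dif (smooth_back i) (cF _ cq).
  apply: differentiableV; last by rewrite bF// sig_third mulf_neq0// invr_neq0// wgt_neq0.
  apply: differentiableB; first exact: differentiable_cst.
  exact: smooth_dif (smooth_back 2%:R) (cF _ cq).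
have AE (i j : 'I_3) x : (i, j) = (0, 1) \/ (i, j) = (1, 2%:R) -> cyl x -> A i (F x) = x 0 j.
  move=> ij cx; rewrite /A bF//; have := stereo_sig x; rewrite /stereo => -[e1 e2].
  by case: ij => -[-> ->].
have dF j : differentiable (fun x => F x 0 j) q.
  move: j; apply: ord3P.
  - have -> : (fun x => F x 0 0) = (fun x => x 0 0) by apply/funext => x; rewrite row3_0.
    exact: differentiable_coordinate.
  - by have -> : (fun x => F x 0 1) = X by apply/funext => x; rewrite row3_1.
  - by have -> : (fun x => F x 0 2%:R) = Y by apply/funext => x; rewrite row3_2.
have chain (i j k : 'I_3) : (i, j) = (0, 1) \/ (i, j) = (1, 2%:R) -> k != 0 ->
    pd 1 (A i) (F q) * pd k X q + pd 2%:R (A i) (F q) * pd k Y q = (k == j)%:R.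
  move=> ij k0; rewrite -(pd_coord q k j) -(open_eq_pd k open_cyl (AE i j ^~ ij) cq).
  rewrite pd_comp// sum_ord3.
  have -> : (fun x => F x 0 0) = (fun x => x 0 0) by apply/funext => x; rewrite row3_0.
  have -> : (fun x => F x 0 1) = X by apply/funext => x; rewrite row3_1.
  have -> : (fun x => F x 0 2%:R) = Y by apply/funext => x; rewrite row3_2.
  have gen (u z s t : R) : z = 0 -> s + t = u * z + s + t by move=> ->; rewrite mulr0 add0r.
  by apply: gen; rewrite pd_coord (negbTE k0).
have h11 := chain 0 1 1 (or_introl erefl) isT.
have h12 := chain 0 1 2%:R (or_introl erefl) isT.
have h21 := chain 1 2%:R 1 (or_intror erefl) isT.
have h22 := chain 1 2%:R 2%:R (or_intror erefl) isT.
apply/eqP; rewrite /jdet; move: h11 h12 h21 h22 => /=.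
move: (pd 1 X q) (pd 2%:R X q) (pd 1 Y q) (pd 2%:R Y q) => a b' c d.
move: (pd 1 (A 0) (F q)) (pd 2%:R (A 0) (F q)) (pd 1 (A 1) (F q)) (pd 2%:R (A 1) (F q)) => p r s t.
move=> h11 h12 h21 h22 D0.
have : (p * t - r * s) * (a * d - b' * c) = 1.
  transitivity ((p * a + r * c) * (s * b' + t * d) - (p * b' + r * d) * (s * a + t * c)); first by ring.
  by rewrite h11 h12 h21 h22 mulr1 mul0r subr0.
by rewrite D0 mulr0 => /esym/eqP; rewrite oner_eq0.
Qed.

End CoordinateFunctions.

(** * The boundary formula *)

Section BoundaryFormula.
Context {R : realType}.
Local Notation V := 'rV[R]_3.
Local Notation mu := (@lebesgue_measure R).
Implicit Types (p q : V).
Variables (psi psi' : V -> V).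
Hypothesis hpsi : diffeo_pair sphere psi psi'.

Lemma chart_eq (g1 g2 : V -> V) i j q q' : j != 0 ->
  (forall k, dev psi psi' g1 sig k q = dev psi psi' g2 sig k q') ->
  q 0 1 = q' 0 1 -> q 0 2%:R = q' 0 2%:R ->
  chart psi psi' g1 i j q = chart psi psi' g2 i j q'.
Proof.
move=> j0 E q1 q2; have wE : wgt q = wgt q' by rewrite /wgt /nrm2 q1 q2.
have jE : q 0 j = q' 0 j by move: j0; move: j; apply: ord3P.
by rewrite /chart /hgt !E wE jE.
Qed.

Section OneMap.
Variables (g g' : V -> V) (b : R -> V -> V) (eps : R).
Hypothesis hg : diffeo_pair cball g g'.
Hypothesis bci : forall rho : R, 0 <= rho <= 1 -> Diff_ci psi (b rho).
Hypothesis gb : forall (rho : R) p, 0 <= rho <= 1 -> sphere p ->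
  g (rho *: p) = rho *: b rho p.
Hypothesis eps01 : 0 < eps < 1.
Hypothesis bconst : forall (rho : R) p, 1 - eps < rho <= 1 -> sphere p -> b rho p = b 1 p.

Local Notation X := (chart psi psi' g 0 1).
Local Notation Y := (chart psi psi' g 1 2%:R).

Definition collar (ep : R) : set V := [set q : V | 1 - ep < q 0 0 < 1].

Lemma open_collar (ep : R) : open (collar ep).
Proof.
have -> : collar ep = (fun q : V => q 0 0) @^-1` `]1 - ep, 1[%classic.
  by apply/seteqP; split => q; rewrite /collar /= in_itv.
apply: open_comp; last exact: interval_open.
by move=> q _; exact: (differentiable_continuous (differentiable_coordinate q 0)).
Qed.

(** The right-hand side involves only [g] on the sphere and the plane coordinates: the source both
    of radial independence and of dependence on the boundary value alone. *)
Lemma dev_collar k q : collar eps q ->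
  dev psi psi' g sig k q = psi' (g (psi (sig q))) 0 k - sig q 0 k.
Proof.
move=> /andP[q0 q1]; have /andP[e0 e1] := eps01.
have qp : 0 < q 0 0 by apply: lt_trans q0; rewrite subr_gt0.
have sp : sphere (psi (sig q)) := psi_sphere hpsi (sig_sphere q).
rewrite /dev /bet (kap_pos hpsi gb) ?qp ?ltW//; last exact: sig_sphere.
rewrite bconst//; last by rewrite q0 ltW.
by have := gb (rho := 1) (p := psi (sig q)); rewrite !scale1r ler01 lexx => ->.
Qed.

Definition region : set V := [set q | dom psi psi' g q /\ jdet X Y q != 0].

Let sXd : smooth (dom psi psi' g) X. Proof. exact: (smooth_chart hpsi hg bci gb). Qed.
Let sYd : smooth (dom psi psi' g) Y. Proof. exact: (smooth_chart hpsi hg bci gb). Qed.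
Let odom : open (dom psi psi' g). Proof. exact: (open_dom hpsi hg bci gb). Qed.

Lemma open_region : open region.
Proof. exact: open_neq0 odom (smooth_jdet odom sXd sYd). Qed.

Let sX : smooth region X. Proof. by apply: smooth_sub sXd => q []. Qed.
Let sY : smooth region Y. Proof. by apply: smooth_sub sYd => q []. Qed.
Let D0 q : region q -> jdet X Y q != 0. Proof. by case. Qed.

Lemma cyl_region q : cyl q -> region q.
Proof.
move=> cq; split; last exact: (chart_jdet hpsi hg bci gb).
have /andP[q0 q1] := cq; split.
  by rewrite /slab /= q1 andbT (lt_trans _ q0)// oppr_lt0.
by apply: (hgt_neq0 hpsi bci gb); rewrite !ltW.
Qed.

Lemma fibre0_jet q : q 0 0 = 0 -> jdet X Y q = 1 /\ jdot X Y q = 0.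
Proof.
move=> q0; have dq : dom psi psi' g q.
  have half1 : 2^-1 < 1 :> R by rewrite invf_lt1// ltr1n.
  by apply: (ctube_dom hpsi bci gb half1); rewrite /ctube /= q0 lexx invr_ge0 ler0n.
apply: fibre_jdet; [exact: smooth_dif sXd dq|exact: smooth_dif sYd dq|].
move=> i i0; have : \forall s \near (0 : R), `|s| <= 1 by apply: nbhs0_le.
apply: filterS => s _.
have E0 : (s *: evec i + q) 0 0 = 0.
  by rewrite !mxE q0 eqxx eq_sym (negbTE i0) mulr0 addr0.
by split; exact: chart_0.
Qed.

Lemma ctube_region (r1 : R) : r1 < 1 -> ctube r1 `<=` region.
Proof.
move=> r11 q cq; have /andP[q0 q1] := cq.
move: q0; rewrite le_eqVlt => /orP[/eqP q0|q0]; last first.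
  by apply: cyl_region; rewrite /cyl /= q0 (le_lt_trans q1).
split; first exact: (ctube_dom hpsi bci gb r11).
by have [-> _] := fibre0_jet (esym q0); rewrite oner_neq0.
Qed.

Lemma flux_far (rho : R) i j : 0 < rho < 1 -> exists2 M : R, 0 < M &
  forall q, q 0 0 = rho -> M <= `|q 0 1| \/ M <= `|q 0 2%:R| -> flux X Y i j q = 0.
Proof.
move=> /andP[r0 r1]; have [|M M0 H] := @chart_far _ _ _ _ _ hpsi bci gb rho.
  by rewrite r0 ltW.
(* One unit beyond [M], so that transverse moves of length at most 1 stay where the chart is the
   identity. *)
exists (M + 1); first by rewrite addr_gt0.
move=> q q0 qM; apply: flux_jdot0.
have rq : region q by apply: cyl_region; rewrite /cyl /= q0 r0.
have [] // := fibre_jdet (smooth_dif sX rq) (smooth_dif sY rq).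
move=> k k0.
have : \forall s \near (0 : R), `|s| <= 1 by apply: nbhs0_le.
apply: filterS => s s1.
have E0 : (s *: evec k + q) 0 0 = rho.
  by rewrite !mxE eqxx eq_sym (negbTE k0) mulr0 add0r.
have Ek l : M + 1 <= `|q 0 l| -> M <= `|(s *: evec k + q) 0 l|.
  move=> ql; have dl : `|(s *: evec k) 0 l| <= 1.
    by rewrite !mxE normrM; case: (_ && _); rewrite /= ?normr1 ?normr0 ?mulr1 ?mulr0.
  have qE : q 0 l = (s *: evec k + q) 0 l - (s *: evec k) 0 l.
    by rewrite [(_ + q) 0 l]mxE addrAC subrr add0r.
  rewrite -(lerD2r 1); apply: le_trans ql _; rewrite [in leLHS]qE.
  by apply: le_trans (ler_normB _ _) _; rewrite lerD2l.
have qM' : M <= `|(s *: evec k + q) 0 1| \/ M <= `|(s *: evec k + q) 0 2%:R|.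
  by case: qM => [/Ek|/Ek]; [left|right].
by split; apply: H.
Qed.

Lemma density_collar q : collar eps q -> W_density psi psi' g q = 0.
Proof.
move=> cq; have /andP[e0 e1] := eps01.
have sub : collar eps `<=` cyl.
  by move=> x /andP[x0 x1]; rewrite /cyl /= x1 andbT (lt_trans _ x0)// subr_gt0.
have oC := @open_collar eps.
have sXc : smooth (collar eps) X by apply: smooth_sub sX => x /sub /cyl_region.
have sYc : smooth (collar eps) Y by apply: smooth_sub sY => x /sub /cyl_region.
have D0c x : collar eps x -> jdet X Y x != 0 by move=> /sub /cyl_region /D0.
rewrite (density_divergence oC cq sXc sYc D0c); last first.
  by move=> x /sub cx; exact: (in_coord_chart hpsi bci gb).
have radial i j x : j != 0 -> smooth (collar eps) (chart psi psi' g i j) -> collar eps x ->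
    pd 0 (chart psi psi' g i j) x = 0.
  move=> j0 sc cx; rewrite -(pd_cst (chart psi psi' g i j x) x 0); apply: pd_line_eq.
  - exact: smooth_dif sc cx.
  - exact: differentiable_cst.
  have nC : nbhs x (collar eps) by exact: open_nbhs_nbhs.
  have c : {for 0, continuous (fun s : R => s *: evec 0 + x)}.
    apply: cvgD; last exact: cvg_cst.
    by apply: cvgZr_tmp; exact: cvg_id.
  have n0 : \forall s \near (0 : R), collar eps (s *: evec 0 + x).
    by apply: c; rewrite scale0r add0r.
  apply: filterS n0 => s cs.
  have el l : l != 0 -> (s *: evec 0 + x) 0 l = x 0 l.
    by move=> l0; rewrite !mxE eqxx (negbTE l0) mulr0 add0r.
  have sE : sig (s *: evec 0 + x) = sig x by rewrite /sig !el.
  by apply: chart_eq => // [k||]; rewrite ?el// !dev_collar// sE.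
by apply: (divergence_radial oC sXc sYc D0c cq) => x; exact: radial.
Qed.

(** [r1 < 1] keeps the closed tube inside the slab where the charts are smooth; [1 - eps < r1] makes
    the density vanish beyond [r1], so the integral over the whole cylinder reduces to the tube. *)
Lemma W_boundary (r1 : R) : 1 - eps < r1 < 1 ->
  W psi psi' g = fine (\int[mu]_y \int[mu]_x (flux X Y 1 2%:R (row3 r1 x y))%:E)%E.
Proof.
move=> /andP[re r11]; have /andP[e0 e1] := eps01.
have r10 : 0 < r1 by apply: lt_trans re; rewrite subr_gt0.
have r01 : 0 < r1 < 1 by rewrite r10.
have oU := open_region; have cU := ctube_region r11.
have rapid_sub h : alv (rapid (dom psi psi' g) (tube r1)) h -> alv (rapid region (tube r1)) h.
  by apply: alv_sub => f [df H]; split => // q [dq _]; exact: df.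
have rX := rapid_sub _ (rapid_chart hpsi hg bci gb 0 1 r01).
have rY := rapid_sub _ (rapid_chart hpsi hg bci gb 1 2%:R r01).
have sF i j := smooth_flux oU sX sY D0 i j.
have rF i j k : rapid region (tube r1) (pd k (flux X Y i j)).
  exact: alv0 (alv_pd k (rapid_flux oU cU sX sY D0 rX rY i j)).
have P0 q : q 0 0 = 0 -> flux X Y 1 2%:R q = 0.
  by move=> /fibre0_jet[_ d0]; exact: flux_jdot0.
have far rho : in_tube r1 rho -> exists2 M : R, 0 < M & forall q, q 0 0 = rho ->
    M <= `|q 0 1| \/ M <= `|q 0 2%:R| -> flux X Y 2%:R 0 q = 0 /\ flux X Y 0 1 q = 0.
  move=> /andP[h0 h1]; have rho01 : 0 < rho < 1 by rewrite h0 (lt_trans h1).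
  have [M M0 HM] := flux_far 2%:R 0 rho01; have [N N0 HN] := flux_far 0 1 rho01.
  exists (Num.max M N); first by rewrite lt_max M0.
  move=> q q0 qM; split; [apply: HM|apply: HN] => //;
    by case: qM; rewrite ge_max => /andP[? ?]; [left|right].
have stokes := tube_stokes r10 cU (sF _ _) (sF _ _) (sF _ _) (rF _ _ _) (rF _ _ _) (rF _ _ _) P0 far.
rewrite /W /Rintegral; congr fine; rewrite -stokes integral_mkcond.
congr (integral _ _ _); apply/funext => -[[rho x] y].
rewrite /patch /tube_ext /= /in_tube.
have [/andP[h0 h1]|h] := boolP (0 < rho < 1); last first.
  rewrite memNset//=; last exact/negP.
  case: ifPn => // /andP[h0 h1]; by move: h; rewrite h0 (lt_trans h1).
rewrite mem_set /= ?h0//; have cq : cyl (row3 rho x y) by rewrite /cyl /= row3_0 h0.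
apply: (congr1 (@EFin R)); case: ifPn => [h2|].
  apply: (density_divergence open_cyl cq).
  - by apply: smooth_sub sX => z /cyl_region.
  - by apply: smooth_sub sY => z /cyl_region.
  - by move=> z /cyl_region /D0.
  - by move=> z cz; exact: (in_coord_chart hpsi bci gb).
rewrite -leNgt => h2; apply: density_collar.
by rewrite /collar /= row3_0 h1 (lt_le_trans re h2).
Qed.

End OneMap.
End BoundaryFormula.

Theorem proposition5p12 (R : realType)
  (psi psi' : 'rV[R]_3 -> 'rV[R]_3) (hpsi : diffeo_pair sphere psi psi')
  (g1 g2 : 'rV[R]_3 -> 'rV[R]_3)
  (hg1 : Diffps0 psi g1) (hg2 : Diffps0 psi g2)
  (hbd : forall p, sphere p -> g1 p = g2 p) :
  W psi psi' g1 = W psi psi' g2.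
Proof.
have [[[[g1' hg1'] _] [b1 [bci1 gb1 [eps1 e1 bc1]]]] _] := hg1.
have [[[[g2' hg2'] _] [b2 [bci2 gb2 [eps2 e2 bc2]]]] _] := hg2.
have [[a1 _] [a2 _]] := (andP e1, andP e2).
pose eps := Num.min eps1 eps2.
have eps0 : 0 < eps by rewrite lt_min a1.
(* A radius below 1 inside the collars of both maps. *)
pose r1 := 1 - eps / 2.
have re : 1 - eps < r1 by rewrite ltrD2l ltrN2 ltr_pdivrMr// ltr_pMr// ltr1n.
have r11 : r1 < 1 by rewrite gtrBl divr_gt0.
have re1 : 1 - eps1 < r1 < 1.
  by rewrite r11 andbT (le_lt_trans _ re)// lerD2l lerN2 ge_min lexx.
have re2 : 1 - eps2 < r1 < 1.
  by rewrite r11 andbT (le_lt_trans _ re)// lerD2l lerN2 ge_min lexx orbT.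
rewrite (W_boundary hpsi hg1' bci1 gb1 e1 bc1 re1) (W_boundary hpsi hg2' bci2 gb2 e2 bc2 re2).
(* On the common collar both charts are the same function of the shared boundary map. The collar
   being open, the derivatives entering [flux] agree as well. *)
have cE (q : 'rV[R]_3) i j : collar eps q -> j != 0 -> chart psi psi' g1 i j q = chart psi psi' g2 i j q.
  move=> /andP[q0 q1] j0; apply: chart_eq => // k.
  rewrite (dev_collar hpsi gb1 e1 bc1) ?(dev_collar hpsi gb2 e2 bc2).
  - by rewrite hbd//; exact: (psi_sphere hpsi (sig_sphere q)).
  - by rewrite /collar /= q1 andbT (le_lt_trans _ q0)// lerD2l lerN2 ge_min lexx orbT.
  - by rewrite /collar /= q1 andbT (le_lt_trans _ q0)// lerD2l lerN2 ge_min lexx.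
have FE : (fun x y => flux (chart psi psi' g1 0 1) (chart psi psi' g1 1 2%:R) 1 2%:R (row3 r1 x y)) =
    (fun x y => flux (chart psi psi' g2 0 1) (chart psi psi' g2 1 2%:R) 1 2%:R (row3 r1 x y)).
  apply/funext => x; apply/funext => y; apply: (@flux_local _ (collar eps)); first exact: open_collar.
  - by rewrite /collar /= row3_0 re.
  - by move=> q cq; exact: cE.
  - by move=> q cq; exact: cE.
exact: (congr1 (fun F : R -> R -> R => fine (\int[lebesgue_measure]_y \int[lebesgue_measure]_x (F x y)%:E)%E) FE).
Qed.
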